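(* Let $\mathbb G=\mathbb R^d$ or $\mathbb G=\mathbb Z^d$ act on the probability space $(\Omega,\mathcal F,\mathbb P)$ by $(\theta_g)_{g\in\mathbb G}$ and on $\mathbb R^d$ by the translations $\tau_gx=x+Vg$, with $V$ an invertible $d\times d$ matrix. Assume that $\mathbb P$ is $\mathbb G$-stationary and ergodic, that $\omega\mapsto\mu_\omega$ is a random locally finite non-negative measure on $\mathbb R^d$ with $\mu_{\theta_g\omega}=\tau_g\mu_\omega$ for all $\omega\in\Omega$, $g\in\mathbb G$, and that its intensity $m$ is finite. Then there exists a $\mathbb G$-invariant set $\mathcal A\subset\Omega$ with $\mathbb P(\mathcal A)=1$ and the following property. Let $\varphi:\mathbb R^d\to\mathbb R$ be any continuous function such that, for some $C>0$ and $\beta>2d+2$, $|\varphi(x)|\le C(1+|x|)^{-\beta}$ for all $x\in\mathbb R^d$. Then for all $\omega\in\mathcal A$ the integral $\int_{\mathbb R^d}|\varphi(x)|\,d\mu^\varepsilon_\omega(x)$ is finite (for all $\varepsilon>0$) and $$\lim_{\varepsilon\downarrow0}\int_{\mathbb R^d}\varphi(x)\,d\mu^\varepsilon_\omega(x)=m\int_{\mathbb R^d}\varphi(x)\,dx.$$ In particular, this limit holds for all $\omega\in\mathcal A$ and all $\varphi\in C_*(\mathbb R^d)$.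
   Context: $|x|$ is the Euclidean norm. $\mathbb G$ is $\mathbb R^d$ with the Euclidean topology or $\mathbb Z^d$ with the discrete topology. The action $(\theta_g)_{g\in\mathbb G}$ on $\Omega$ satisfies: $\theta_0$ is the identity, $\theta_g\circ\theta_{g'}=\theta_{g+g'}$, and $(g,\omega)\mapsto\theta_g\omega$ is measurable. A set $A\in\mathcal F$ is $\mathbb G$-invariant if $\theta_gA=A$ for all $g\in\mathbb G$. Stationary: $\mathbb P\circ\theta_g^{-1}=\mathbb P$ for all $g$; ergodic: $\mathbb P(A)\in\{0,1\}$ for every $\mathbb G$-invariant $A\in\mathcal F$. $\mathcal M$ is the space of locally finite non-negative Borel measures on $\mathbb R^d$, with the (metrizable) vague topology ($\nu_n\to\nu$ iff $\int f\,d\nu_n\to\int f\,d\nu$ for all $f\in C_c(\mathbb R^d)$) and its Borel $\sigma$-algebra. A random measure is a measurable map $\Omega\ni\omega\mapsto\mu_\omega\in\mathcal M$. For $\mathfrak m\in\mathcal M$, $\tau_g\mathfrak m(A):=\mathfrak m(\tau_gA)$ for all Borel $A$. $\Delta:=\{\sum_{i=1}^dt_iv^i:0\le t_i<1\}$, where $v^1,\dots,v^d$ are the columns of $V$. The intensity is $m:=\ell(\Delta)^{-1}\int_\Omega d\mathbb P(\omega)\,\mu_\omega(\Delta)$, with $\ell$ Lebesgue measure. The rescaled measure is $\mu^\varepsilon_\omega(A):=\varepsilon^d\mu_\omega(\varepsilon^{-1}A)$ for Borel $A$, $\varepsilon>0$. $C_*(\mathbb R^d)$ is the set of continuous $f:\mathbb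 R^d\to\mathbb R$ such that for every $\beta>0$ there is $C>0$ with $|f(x)|\le C(1+|x|)^{-\beta}$ for all $x$. *)

(* Defs.v *)
From HB Require Import structures.
From mathcomp Require Import all_boot all_order all_algebra.
From mathcomp Require Import all_classical all_reals all_analysis.

Set Implicit Arguments.
Unset Strict Implicit.
Unset Printing Implicit Defensive.

Import Order.TTheory GRing.Theory Num.Theory.
Import numFieldNormedType.Exports.

Local Open Scope classical_set_scope.
Local Open Scope ring_scope.

(* R^d as a measurable space: column vectors with the Borel sigma-algebra of
   their topology, which is the Euclidean one. *)
Notation borel_cV R d := (g_sigma_algebraType (@open 'cV[R]_d)).

(* The library norm `|x| on 'cV[R]_d is the sup norm. *)
Definition enorm (R : realType) (d : nat) (x : 'cV[R]_d) : R :=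
  Num.sqrt (\sum_(i < d) x i 0 ^+ 2).

(* Lebesgue measure on R^d: the d-fold product of the Lebesgue measure of the
   line, built on d-tuples and transported to column vectors. *)
Section lebesgue.
Context {R : realType}.
Local Open Scope ereal_scope.
Local Notation rtuple n := (n.-tuple (measurableTypeR R)).

Section lebesgue_cons.
Context (n : nat) (mu : {sigma_finite_measure set (rtuple n) -> \bar R}).

Let tcons (p : measurableTypeR R * rtuple n) : rtuple n.+1 :=
  [tuple of p.1 :: p.2].

Let measurable_tcons : measurable_fun [set: measurableTypeR R * rtuple n] tcons.
Proof. exact: measurable_cons. Qed.

Local Notation prod_mu := ((@lebesgue_measure R) \x mu).

Definition lebesgue_cons : set (rtuple n.+1) -> \bar R :=
  pushforward prod_mu tcons.

Let lebesgue_cons0 : lebesgue_cons set0 = 0.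
Proof. exact: measure0. Qed.

Let lebesgue_cons_ge0 A : 0 <= lebesgue_cons A.
Proof. exact: measure_ge0. Qed.

Let lebesgue_cons_sigma_additive : semi_sigma_additive lebesgue_cons.
Proof. exact: measure_semi_sigma_additive. Qed.

HB.instance Definition _ := isMeasure.Build _ _ _ lebesgue_cons
  lebesgue_cons0 lebesgue_cons_ge0 lebesgue_cons_sigma_additive.

Let lebesgue_cons_sigma_finite : sigma_finite setT lebesgue_cons.
Proof.
have /sigma_finiteP[F [FT ndF Foo]] :=
  sigma_finiteT (@lebesgue_measure R :
    {sigma_finite_measure set (measurableTypeR R) -> \bar R}%R).
have /sigma_finiteP[G [GT ndG Goo]] := sigma_finiteT mu.
pose unc (t : rtuple n.+1) : measurableTypeR R * rtuple n :=
  (tnth t ord0, [tuple of behead t]).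
have munc : measurable_fun [set: rtuple n.+1] unc.
  apply/measurable_fun_pair => /=; first exact: measurable_tnth.
  exact: measurable_behead.
exists (fun k => unc @^-1` (F k `*` G k)).
  apply/esym; rewrite -subTset => t _.
  have [i _ Fi] : (\bigcup_i F i) (unc t).1 by rewrite -FT.
  have [j _ Gj] : (\bigcup_i G i) (unc t).2 by rewrite -GT.
  exists (maxn i j) => //; split.
    by move: Fi; exact/subsetPset/ndF/leq_maxl.
  by move: Gj; exact/subsetPset/ndG/leq_maxr.
move=> k; have [mF Fk] := Foo k; have [mG Gk] := Goo k.
split.
  rewrite -[X in measurable X]setTI.
  by apply: munc => //; exact: measurableX.
rewrite /lebesgue_cons /pushforward.
rewrite (_ : tcons @^-1` _ = F k `*` G k).
  by rewrite product_measure1E// lte_mul_pinfty// ge0_fin_numE.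
have tconsK p : unc (tcons p) = p.
  by case: p => x t; rewrite /unc /tcons/=; congr pair; exact/val_inj.
by apply/funext => p; rewrite /preimage /mkset tconsK.
Qed.

HB.instance Definition _ := Measure_isSigmaFinite.Build _ _ _ lebesgue_cons
  lebesgue_cons_sigma_finite.

End lebesgue_cons.

Fixpoint lebesgue_tuple n : {sigma_finite_measure set (rtuple n) -> \bar R} :=
  match n with
  | 0 => \d_([tuple] : rtuple 0)
  | m.+1 => lebesgue_cons (lebesgue_tuple m)
  end.

End lebesgue.

Section cV_of_tuple.
Context {R : realType}.
Local Notation rtuple n := (n.-tuple (measurableTypeR R)).

Definition cV_of_tuple d (t : rtuple d) : borel_cV R d := \col_i tnth t i.

Lemma measurable_cV_of_tuple d : measurable_fun [set: rtuple d] (@cV_of_tuple d).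
Proof.
apply: (@measurability _ _ _ (borel_cV R d) _ _ (@open 'cV[R]_d)) => // _ [U oU <-]; rewrite setTI.
pose B (c : 'cV[rat]_d * rat) : set 'cV[R]_d := ball (map_mx ratr c.1 : 'cV[R]_d) (ratr c.2).
have mB c : measurable (cV_of_tuple (d:=d) @^-1` B c : set (rtuple d)).
  have [c0|c0] := ltP 0%R (ratr c.2 : R); last first.
    rewrite (_ : _ @^-1` _ = set0)//; apply/seteqP; split => // t /= [].
    by rewrite ltNge c0.
  rewrite (_ : _ @^-1` _ = \bigcap_(i in [set: 'I_d])
      ((fun t : rtuple d => tnth t i) @^-1` ball (ratr (c.1 i 0) : R) (ratr c.2))).
    apply: fin_bigcap_measurable => // i _.
    rewrite -[X in measurable X]setTI; apply: measurable_tnth => //.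
    by rewrite ball_itv; exact: measurable_itv.
  apply/seteqP; split => [t [_ Bt] i _|t Bt] /=.
    by have := Bt i 0; rewrite !mxE.
  by split => // i j; rewrite !mxE ord1; exact: Bt.
pose F n := if unpickle n is Some c then
  (if `[< B c `<=` U >] then cV_of_tuple (d:=d) @^-1` B c else set0) else set0.
rewrite (_ : _ @^-1` U = \bigcup_n F n).
  apply: bigcupT_measurable => n; rewrite /F; case: unpickle => // c.
  by case: asboolP.
apply/seteqP; split => [t /= Ut|t [n _]]; last first.
  by rewrite /F; case: unpickle => // c; case: asboolP => // BU /BU.
have /nbhs_ballP[e /= e0 eU] : nbhs (cV_of_tuple t : 'cV[R]_d) U.
  by move: oU; rewrite openE => /(_ _ Ut).
have /rat_in_itvoo[r] : (0 < e / 2)%R by rewrite divr_gt0.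
rewrite in_itv/= => /andP[r0 re].
have qP i : exists q : rat, (ball (tnth t i : R) (ratr r) (ratr q : R)).
  have /rat_in_itvoo[q] : (tnth t i - ratr r < tnth t i + ratr r)%R.
    by rewrite ltrD2l (lt_trans _ r0)// oppr_lt0.
  by rewrite in_itv/= => qB; exists q; rewrite ball_itv/= in_itv.
pose q : 'cV[rat]_d := \col_i projT1 (cid (qP i)).
exists (pickle (q, r)) => //; rewrite /F pickleK asboolT.
  split => //= i j; rewrite !mxE; apply: ball_sym; exact: projT2 (cid (qP i)).
move=> y [_ By]; apply: eU; split => // i j.
apply: (@le_ball _ _ _ (ratr r + ratr r)%R).
  by rewrite [leRHS]splitr lerD// ltW.
apply: (ball_triangle (y := ratr (q i 0) : R)).
  by rewrite !mxE; exact: projT2 (cid (qP i)).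
by have := By i j; rewrite !mxE ord1.
Qed.

End cV_of_tuple.

Section lebesgue_cV.
Context (R : realType) (d : nat).
Local Open Scope ereal_scope.

Definition lebesgue_cV : set (borel_cV R d) -> \bar R :=
  pushforward (lebesgue_tuple d) (@cV_of_tuple R d).

Let mcV := @measurable_cV_of_tuple R d.

Let lebesgue_cV0 : lebesgue_cV set0 = 0.
Proof. exact: measure0. Qed.

Let lebesgue_cV_ge0 A : 0 <= lebesgue_cV A.
Proof. exact: measure_ge0. Qed.

Let lebesgue_cV_sigma_additive : semi_sigma_additive lebesgue_cV.
Proof. exact: measure_semi_sigma_additive. Qed.

HB.instance Definition _ := isMeasure.Build _ _ _ lebesgue_cV
  lebesgue_cV0 lebesgue_cV_ge0 lebesgue_cV_sigma_additive.

End lebesgue_cV.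

Lemma lebesgue_cV_box (R : realType) d (B : 'I_d -> set R) :
  (forall i, measurable (B i)) ->
  lebesgue_cV [set x : 'cV[R]_d | forall i, B i (x i 0)] =
  (\prod_(i < d) @lebesgue_measure R (B i))%E.
Proof.
move=> mB; rewrite /lebesgue_cV /pushforward.
rewrite (_ : _ @^-1` _ =
    [set t : d.-tuple (measurableTypeR R) | forall i, B i (tnth t i)]); last first.
  by apply/seteqP; split => t /= Bt i; have := Bt i; rewrite /cV_of_tuple mxE.
elim: d B mB => [|d ih] B mB.
  rewrite big_ord0 /= diracE mem_set//; by case.
rewrite big_ord_recl/= /lebesgue_cons /pushforward -ih//.
rewrite (_ : _ @^-1` _ = B ord0 `*` [set t : d.-tuple (measurableTypeR R) |
   forall i, B (lift ord0 i) (tnth t i)]).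
  rewrite product_measure1E//; first exact: mB.
  rewrite (_ : [set _ | _] = \bigcap_(i in [set: 'I_d])
     ((fun t : d.-tuple (measurableTypeR R) => tnth t i) @^-1` B (lift ord0 i))).
    apply: fin_bigcap_measurable => // i _.
    by rewrite -[X in measurable X]setTI; apply: measurable_tnth => //; exact: mB.
  by apply/seteqP; split => [t Bt i _|t Bt i]; exact: Bt.
apply/seteqP; split => -[x t] /=.
  move=> Bt; split; first exact: (Bt ord0).
  by move=> i; have := Bt (lift ord0 i); rewrite tnthS.
move=> [Bx Bt] i; case: (unliftP ord0 i) => [j ->|->] //.
by rewrite tnthS.
Qed.

(* The space M of locally finite Borel measures on R^d, with the vague topology,
   i.e., the initial topology of the maps nu |-> \int f dnu, f in C_c(R^d). *)
Section vague_topology.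
Context (R : realType) (d : nat).

Record continuous_cpt_supp := ContinuousCptSupp {
  ccs_fun :> 'cV[R]_d -> R;
  ccs_continuous : continuous ccs_fun;
  ccs_compact : compact (closure [set x | ccs_fun x != 0]) }.

Definition locally_finite (nu : {measure set (borel_cV R d) -> \bar R}) :=
  forall x : 'cV[R]_d, exists U : set 'cV[R]_d,
    [/\ open U, U x & (nu U < +oo)%E].

Record lfmeasure := LFMeasure {
  lf_measure :> {measure set (borel_cV R d) -> \bar R};
  lf_locally_finite : locally_finite lf_measure }.

Lemma locally_finite_mzero : locally_finite mzero.
Proof. by move=> x; exists setT; split=> //; [exact: openT|rewrite /mzero/= ltry]. Qed.

HB.instance Definition _ := gen_eqMixin lfmeasure.
HB.instance Definition _ := gen_choiceMixin lfmeasure.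
HB.instance Definition _ :=
  isPointed.Build lfmeasure (LFMeasure locally_finite_mzero).

Definition cc_integral (nu : lfmeasure) : {ptws continuous_cpt_supp -> R} :=
  fun f => \int[nu]_x f x.

Definition vague : Type := initial_topology cc_integral.
HB.instance Definition _ := PointedTopological.on vague.

End vague_topology.

Notation borel_lf R d := (g_sigma_algebraType (@open (vague R d))).

(* The acting group G: R^d with its Euclidean topology, or Z^d with the discrete
   one. [group_emb] is the inclusion of G in R^d. *)
Variant group_kind := RealGroup | IntGroup.

Section acting_group.
Context (R : realType) (d : nat) (k : group_kind).

Definition group_scalar : nzRingType :=
  if k is RealGroup then R : nzRingType else int : nzRingType.

Definition acting_group : Type := 'cV[group_scalar]_d.

HB.instance Definition _ := GRing.Zmodule.on acting_group.
HB.instance Definition _ := isPointed.Build acting_group 0.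

End acting_group.

Definition group_open (R : realType) d k : set (set (acting_group R d k)) :=
  match k with
  | RealGroup => @open 'cV[R]_d
  | IntGroup => @open (discrete_topology 'cV[int]_d)
  end.

Definition group_emb (R : realType) d k : acting_group R d k -> 'cV[R]_d :=
  match k with
  | RealGroup => id
  | IntGroup => map_mx intr
  end.

Notation borel_group R d k := (g_sigma_algebraType (@group_open R d k)).

Section action.
Context (R : realType) (d : nat) (k : group_kind).
Context (dO : measure_display) (Omega : measurableType dO).
Implicit Types (theta : acting_group R d k -> Omega -> Omega) (P : probability Omega R).

Definition is_action theta :=
  [/\ forall w, theta 0 w = w,
      forall g g' w, theta g (theta g' w) = theta (g + g') w &
      measurable_fun [set: borel_group R d k * Omega]
        (fun p => theta p.1 p.2)].

Definition invariant_set theta (A : set Omega) := forall g, theta g @` A = A.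

Definition stationary P theta :=
  forall g (A : set Omega), measurable A -> P (theta g @^-1` A) = P A.

Definition ergodic P theta :=
  forall A : set Omega, measurable A -> invariant_set theta A ->
    P A = 0%E \/ P A = 1%E.

End action.

Section euclidean_space.
Context (R : realType) (d : nat).
Implicit Types (V : 'M[R]_d) (x : 'cV[R]_d) (phi : 'cV[R]_d -> R).
Implicit Types nu : {measure set (borel_cV R d) -> \bar R}.

Definition tau k V (g : acting_group R d k) x : 'cV[R]_d := x + V *m group_emb g.

Definition translate k V (g : acting_group R d k) nu (A : set (borel_cV R d)) : \bar R :=
  nu (tau V g @` A).

Definition rescale (eps : R) nu (A : set (borel_cV R d)) : \bar R :=
  ((eps ^+ d)%:E * nu ((fun x => eps^-1 *: x) @` A))%E.

Definition cell V : set (borel_cV R d) :=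
  [set x | exists2 t : 'I_d -> R,
    forall i, 0 <= t i < 1 & x = \sum_(i < d) t i *: col i V].

Definition intensity dO (Omega : measurableType dO) (P : probability Omega R) V
    (mu : Omega -> lfmeasure R d) : \bar R :=
  ((fine (lebesgue_cV (cell V)))^-1%:E * \int[P]_w mu w (cell V))%E.

Definition decay_bound phi (C beta : R) :=
  forall x, `|phi x| <= C * (1 + enorm x) `^ (- beta).

Definition Cstar phi :=
  continuous phi /\
  forall beta : R, 0 < beta -> exists2 C : R, 0 < C & decay_bound phi C beta.

End euclidean_space.

Section rescale_measure.
Context (R : realType) (d : nat) (eps : R).
Context (nu : {measure set (borel_cV R d) -> \bar R}).
Hypothesis eps_gt0 : 0 < eps.

Let scal (x : borel_cV R d) : borel_cV R d := eps *: (x : 'cV[R]_d).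

Let measurable_scal : measurable_fun setT scal.
Proof.
apply: (@measurability _ _ _ (borel_cV R d) _ _ (@open 'cV[R]_d)) => //.
move=> _ [U oU <-]; rewrite setTI; apply: sub_sigma_algebra.
have /continuousP : continuous (fun x : 'cV[R]_d => eps *: x).
  by move=> x; exact: scaler_continuous.
exact.
Qed.

Let scalE A : (fun x : 'cV[R]_d => eps^-1 *: x) @` A = scal @^-1` A.
Proof.
apply/seteqP; split => [_ [x Ax <-]|x Ax]; rewrite /scal/=.
  by rewrite scalerA divff ?gt_eqF// scale1r.
by exists (eps *: (x : 'cV[R]_d)) => //; rewrite scalerA mulVf ?gt_eqF// scale1r.
Qed.

Let nu_scal := pushforward nu scal.

Let nu_scal0 : nu_scal set0 = 0%E.
Proof. exact: measure0. Qed.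

Let nu_scal_ge0 A : (0 <= nu_scal A)%E.
Proof. exact: measure_ge0. Qed.

Let nu_scal_sigma_additive : semi_sigma_additive nu_scal.
Proof. exact: measure_semi_sigma_additive. Qed.

HB.instance Definition _ := isMeasure.Build _ _ _ nu_scal
  nu_scal0 nu_scal_ge0 nu_scal_sigma_additive.

Let rescaleE :
  rescale eps nu = mscale (NngNum (exprn_ge0 d (ltW eps_gt0))) nu_scal.
Proof. by apply/funext => A; rewrite /rescale scalE. Qed.

Let rescale0 : rescale eps nu set0 = 0%E.
Proof. by rewrite rescaleE; exact: measure0. Qed.

Let rescale_ge0 A : (0 <= rescale eps nu A)%E.
Proof. by rewrite rescaleE; exact: measure_ge0. Qed.

Let rescale_sigma_additive : semi_sigma_additive (rescale eps nu).
Proof. by rewrite rescaleE; exact: measure_semi_sigma_additive. Qed.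

HB.instance Definition _ := isMeasure.Build _ _ _ (rescale eps nu)
  rescale0 rescale_ge0 rescale_sigma_additive.

End rescale_measure.

(* Main.v *)
Require Import Defs.
From mathcomp Require Import all_boot all_order all_algebra.
From mathcomp Require Import all_classical all_reals all_analysis.
From mathcomp Require Import measurable_realfun.
From mathcomp Require Import ring lra zify.

Set Implicit Arguments.
Unset Strict Implicit.
Unset Printing Implicit Defensive.

Import Order.TTheory GRing.Theory Num.Theory.
Import numFieldNormedType.Exports.

(** Let f(x) be the mass of the unit cell of the lattice at x, so that E f(x) = m'
    does not depend on x. For a box shape with the origin in its interior, the
    limsup and the liminf of the normalized masses of the dilated boxes are
    invariant under every translation, discrete or continuous, because a translated
    box lies between two dilations of the original one; by ergodicity they are a.s.
    constant. To identify them, a large cube is covered, up to a small fraction of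
    its points, by disjoint translates of boxes whose averages are close to the
    limsup (resp. liminf): for each of several well separated scales, starting from
    the largest, a Vitali selection covers a fixed fraction of what remains. Taking
    expectations gives limsup <= m'; for m' <= liminf the mass of the uncovered
    cells is controlled by f <= (f - K)^+ + K.
    Inclusion-exclusion extends the limit to all boxes whose faces avoid the
    coordinate hyperplanes. A continuous function with the stated decay is then
    integrated by Riemann sums over a grid having the origin at the centre of a cell,
    the tail being summed over cubic shells. *)

(** Ergodicity is assumed for the whole group: for [RealGroup] the subgroup [Z^d] may act
    non-ergodically, so the limit cannot be read off from an ergodic theorem for [Z^d]. Two roles
    are therefore separated. Covering and stationarity use integer shifts only, in both cases;
    arbitrary shifts enter through the invariance of the limsup and liminf events. This invariance
    must hold at every point, not just almost surely, because [ergodic] and the required set both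
    refer to exact invariance. One null set has to serve all [phi]. The exceptional events are
    indexed by a rational level and an integer shape, hence are countably many; after
    [typical_boxmass] everything is deterministic, for a fixed [w]. The passage to functions rests
    on uniformity: the Riemann approximation depends on a measure only through a polynomial growth
    constant, so a single grid serves Lebesgue measure and all rescaled measures with [eps <= 1]. A
    shell at distance [q] has mass of order at most [q^d] against a decay [q^-(d+2)], which leaves a
    summable [q^-2]. *)

Local Open Scope ring_scope.

(** * Covering a discrete cube by boxes of several scales *)

Section lattice_boxes.
Context (d M : nat) (a b : 'I_d -> nat).
Local Notation T := {ffun 'I_d -> 'I_M}.
Local Open Scope set_scope.
Local Open Scope nat_scope.

(** The lower bound [x - a n] is moved to the side of [y] since subtraction on [nat] truncates. A
    box that leaves the cube is cut off, which is why [card_good] asks good boxes for the full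
    cardinality. *)
Definition lbox (x : T) (n : nat) : {set T} :=
  [set y : T | [forall i, (x i <= y i + a i * n) && (y i < x i + b i * n)]].

Definition touching (n : nat) (U : {set T}) : {set T} :=
  [set x : T | ~~ [disjoint lbox x n & U]].

Lemma card_interval (l u : nat) : #|[pred j : 'I_M | l <= j < u]| <= u - l.
Proof.
rewrite cardE -(size_map (@nat_of_ord M)) -[leqRHS](size_iota l).
apply: uniq_leq_size; first by rewrite map_inj_uniq ?enum_uniq//; exact: val_inj.
move=> _ /mapP[j + ->]; rewrite mem_enum inE mem_iota => /andP[lj ju].
by rewrite lj subnKC// (leq_trans lj (ltnW ju)).
Qed.

Lemma card_box (l u : 'I_d -> nat) :
  #|[set x : T | [forall i, l i <= x i < u i]]| <= \prod_i (u i - l i).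
Proof.
have -> : #|[set x : T | [forall i, l i <= x i < u i]]| =
    #|(family (fun i => [pred j : 'I_M | l i <= j < u i]))|.
  by apply: eq_card => x; rewrite inE; apply/forallP/familyP => H i; have := H i;
    rewrite inE.
by rewrite card_family foldrE big_map big_enum; apply: leq_prod => i _;
  exact: card_interval.
Qed.

Lemma card_box_fit (l u : 'I_d -> nat) : (forall i, u i <= M) ->
  #|[set x : T | [forall i, l i <= x i < u i]]| = \prod_i (u i - l i).
Proof.
move=> uM.
have -> : #|[set x : T | [forall i, l i <= x i < u i]]| =
    #|(family (fun i => [pred j : 'I_M | l i <= j < u i]))|.
  by apply: eq_card => x; rewrite inE; apply/forallP/familyP => H i; have := H i;
    rewrite inE.
rewrite card_family foldrE big_map big_enum; apply: eq_bigr => i _.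
rewrite cardE -(size_map (@nat_of_ord M)) -[RHS](size_iota (l i)).
apply/perm_size/uniq_perm; rewrite ?iota_uniq//.
  by rewrite map_inj_uniq ?enum_uniq//; exact: val_inj.
move=> j; rewrite mem_iota; apply/mapP/idP => [[k + ->]|].
  by rewrite mem_enum inE; lia.
move=> lj; have ji : j < u i by lia.
exists (Ordinal (leq_trans ji (uM i))) => //; rewrite mem_enum inE/=; lia.
Qed.

(** If the box of [x] at scale [L] meets that of [y] at scale [n], each [x i] lies between
    [y i - (a i * n + b i * L)] and [y i + b i * n + a i * L], an interval of length
    [(a i + b i) * (n + L)]. For [L = n] this gives [2 ^ d] times the size of a full box. *)
Lemma card_touching (L n : nat) (y : T) :
  #|touching L (lbox y n)| <= (\prod_i (a i + b i)) * (n + L) ^ d.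
Proof.
apply: (@leq_trans (\prod_i (y i + b i * n + a i * L - (y i - (a i * n + b i *
  L))))); last first.
  have -> : \prod_(i < d) (a i + b i) * (n + L) ^ d = \prod_(i < d) ((a i + b i) * (n
    + L)).
    by rewrite big_split/= prod_nat_const card_ord.
  by apply: leq_prod => i _; nia.
apply: leq_trans (card_box _ _); apply/subset_leq_card/fintype.subsetP => x.
rewrite !inE => /pred0Pn[z /=]; rewrite !inE => /andP[/forallP xz /forallP yz].
by apply/forallP => i; have /andP[? ?] := xz i; have /andP[? ?] := yz i; lia.
Qed.

Lemma touchingU L (U U' : {set T}) : touching L (U :|: U') = touching L U :|:
  touching L U'.
Proof.
by apply/finset.setP => x; rewrite !inE -negb_and -!finset.setI_eq0 finset.setIUr
  finset.setU_eq0.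
Qed.

Lemma lbox_center x n : 0 < n -> (forall i, 0 < b i) -> x \in lbox x n.
Proof. by move=> n0 b0; rewrite inE; apply/forallP => i; have := b0 i; nia. Qed.

Context (G : T -> nat -> Prop).
Hypothesis card_good : forall x n, G x n -> #|lbox x n| = (\prod_i (a i + b i)) * n ^ d.
Hypothesis good_center : forall x n, G x n -> x \in lbox x n.

(** Recorded as a construction rather than as a family of boxes, so that counts and sums over [U]
    follow by induction. *)
Inductive tiled (l : nat) : {set T} -> Prop :=
| Tiled0 : tiled l finset.set0
| TiledU (x : T) n (U : {set T}) : G x n -> l <= n -> [disjoint lbox x n & U] ->
  tiled l U ->
    tiled l (lbox x n :|: U).

Lemma tiledW l l' U : l' <= l -> tiled l U -> tiled l' U.
Proof.
move=> ll; elim=> [|x n U' Gxn ln dU _ ih]; first exact: Tiled0.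
by apply: TiledU => //; exact: leq_trans ln.
Qed.

Lemma card_disjointU (A B : {set T}) : [disjoint A & B] -> #|A :|: B| = #|A| + #|B|.
Proof. by rewrite -finset.setI_eq0 => /eqP AB; rewrite cardsU AB cards0 subn0. Qed.

(** Greedy choice: the box of a [y] with largest [r y] is taken, and every point whose box at scale
    [r y] touches it is dropped, which costs at most [2 ^ d] times the size of the chosen box. A
    remaining point has a box of scale at most [r y], hence disjoint from the chosen one. *)
Lemma vitali_tiled l (r : T -> nat) (S U : {set T}) : tiled l U ->
  (forall x, x \in S -> [/\ G x (r x), l <= r x & [disjoint lbox x (r x) & U]]) ->
  exists U', [/\ tiled l U', #|U| <= #|U'| & #|S| + 2 ^ d * #|U| <= 2 ^ d * #|U'|].
Proof.
have [k] := ubnP #|S|; elim: k S U => // k ih S U Sk tU SG.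
have [->|[x0 x0S]] := finset.set_0Vmem S; first by exists U; rewrite cards0.
have [y yS ymax] : exists2 y, y \in S & forall x, x \in S -> r x <= r y.
  by case: (arg_maxnP r x0S) => y yS ym; exists y.
have [Gy ly dy] := SG _ yS.
pose U1 := lbox y (r y) :|: U.
have cU1 : #|U1| = (\prod_i (a i + b i)) * r y ^ d + #|U|.
  by rewrite card_disjointU// card_good.
have cT := card_touching (r y) (r y) y.
pose S' := S :\: touching (r y) (lbox y (r y)).
have SS' : #|S| <= #|S'| + #|touching (r y) (lbox y (r y))|.
  by rewrite -(cardsID (touching (r y) (lbox y (r y))) S) addnC leq_add2l
    subset_leq_card// finset.subsetIr.
(* [y] lies in its own box, so it is dropped too and the induction on [#|S|] progresses. *)
have yT : y \in touching (r y) (lbox y (r y)).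
  by rewrite inE; apply/pred0Pn; exists y => /=; rewrite (good_center Gy).
have S'k : #|S'| < k.
  apply: leq_trans (_ : #|S| <= k); last by rewrite -ltnS.
  apply: proper_card; apply/andP; split; first exact: finset.subsetDl.
  apply/fintype.subsetPn; exists y => //.
  by rewrite inE yT.
have [|x|U' [tU' UU' SU']] := ih S' U1 S'k; first exact: TiledU.
  rewrite inE => /andP[xT xS]; have [Gx lx dx] := SG _ xS; split => //.
  rewrite -finset.setI_eq0 finset.setIUr finset.setU_eq0 !finset.setI_eq0 dx andbT.
  move: xT; rewrite inE negbK; apply: disjointWl.
  apply/fintype.subsetP => z; rewrite !inE => /forallP xz; apply/forallP => i.
  have /andP[? ?] := xz i; have := ymax _ xS; nia.
exists U'; split => //; first by apply: leq_trans UU'; rewrite cU1 leq_addl.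
move: cT; rewrite addnn -mul2n expnMn; nia.
Qed.

(** Points whose box at the largest admissible scale [L] touches [U] are given up and form the error
    term. The other points have boxes of scale at most [L], which avoid [U], so the Vitali selection
    applies to them. *)
Lemma stage_tiled l l' L (S U : {set T}) : l' <= l -> tiled l U ->
  (forall x, x \in S -> exists n, [/\ G x n, l' <= n & n <= L]) ->
  exists U', [/\ tiled l' U', #|U| <= #|U'| &
    #|S| + 2 ^ d * #|U| <= 2 ^ d * #|U'| + #|touching L U|].
Proof.
move=> ll tU SG.
have /choice[r rP] : forall x, exists n, x \in S -> [/\ G x n, l' <= n & n <= L].
  move=> x; case: (boolP (x \in S)) => xS; last by exists 0.
  by have [n] := SG _ xS; exists n.
have [x|U' [tU' UU' SU']] := @vitali_tiled l' r (S :\: touching L U) U (tiledW ll tU).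
  rewrite !inE negbK => /andP[dx xS]; have [Gx lx xL] := rP _ xS; split => //.
  move: dx; apply: disjointWl.
  apply/fintype.subsetP => z; rewrite !inE => /forallP xz; apply/forallP => i.
  have /andP[? ?] := xz i; nia.
exists U'; split => //.
have : #|S| <= #|S :\: touching L U| + #|touching L U|.
  by rewrite -(cardsID (touching L U) S) addnC leq_add2l subset_leq_card//
    finset.subsetIr.
lia.
Qed.

(** [card_touching] summed over the boxes of [U]. With [kappa] close to 1, the points lost at the
    next stage are barely more than those already covered. *)
Lemma tiled_touching (R : realFieldType) (kappa : R) l L U : tiled l U ->
  (forall n, (l <= n)%N -> ((n + L)%N ^ d)%N%:R <= kappa * (n ^ d)%N%:R)%R ->
  (#|touching L U|%:R <= kappa * #|U|%:R)%R.
Proof.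
move=> + kP; elim=> [|x n U' Gxn ln dU _ ih].
  rewrite cards0 mulr0 (_ : touching _ _ = finset.set0) ?cards0//.
  by apply/finset.setP => x; rewrite !inE -finset.setI_eq0 finset.setI0 eqxx.
rewrite card_disjointU// natrD mulrDr touchingU.
apply: (@le_trans _ _ (#|touching L (lbox x n)| + #|touching L U'|)%:R%R).
  by rewrite ler_nat cardsU leq_subr.
rewrite natrD lerD// card_good// natrM mulrCA.
apply: (@le_trans _ _ (((\prod_i (a i + b i)) * (n + L) ^ d)%:R)%R).
  by rewrite ler_nat card_touching.
by rewrite natrM; apply: ler_wpM2l; rewrite ?kP.
Qed.

(* Larger scales first: the boxes chosen so far are so large that the points near
   their boundary do not matter at the next scale, and at each scale the Vitali
   selection covers a fraction 2^-d of what is left. *)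
Lemma multiscale_cover (R : realFieldType) (kappa : R) (l L : nat -> nat) J (S : {set
  T}) :
  (1 <= kappa)%R -> (forall j, l j <= l j.+1) ->
  (forall j n, (l j.+1 <= n)%N -> ((n + L j)%N ^ d)%N%:R <= kappa * (n ^ d)%N%:R)%R ->
  (forall x, x \in S -> forall j, j < J -> exists n, [/\ G x n, l j <= n & n <= L j]) ->
  exists2 U, tiled (l 0) U &
    ((1 - (1 - (2 ^ d)%:R^-1) ^+ J) * #|S|%:R <= kappa * #|U|%:R)%R.
Proof.
move=> k1 ll lL SG.
have t0 : (0 < (2 ^ d)%:R :> R)%R by rewrite ltr0n expn_gt0.
set t := ((2 ^ d)%:R : R)%R in t0 *.
have t1 : (t^-1 <= 1)%R by rewrite invf_le1// ler1n expn_gt0.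
(* The induction runs over the stages, from index [J - 1] downwards; the deficit
   [#|S| - kappa * #|U|] shrinks by the factor [1 - t^-1] at each of them. *)
suff H j : j <= J -> exists2 U, tiled (l (J - j)) U &
    (#|S|%:R - kappa * #|U|%:R <= (1 - t^-1) ^+ j * #|S|%:R)%R.
  have [U tU HU] := H J (leqnn _); exists U; first by rewrite subnn in tU.
  by rewrite mulrBl mul1r lerBlDl addrC -lerBlDl.
elim: j => [_|j ih jJ].
  by exists finset.set0; [exact: Tiled0|rewrite cards0 mulr0 subr0 expr0 mul1r].
have [U tU HU] := ih (ltnW jJ).
have Jj : J - j = (J - j.+1).+1 by lia.
have [||U' [tU' UU' SU']] := @stage_tiled (l (J - j)) (l (J - j.+1)) (L (J - j.+1)) S
  U _ tU.
- by rewrite Jj.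
- by move=> x xS; apply: SG => //; lia.
exists U' => //.
have tt := tiled_touching tU (fun n (H : l (J - j) <= n) => lL (J - j.+1) n (eq_rect
  _ (fun k => l k <= n) H _ Jj)).
have {}SU' : (#|S|%:R + t * #|U|%:R <= t * #|U'|%:R + kappa * #|U|%:R)%R.
  have : (#|S|%:R + t * #|U|%:R <= t * #|U'|%:R + #|touching (L (J - j.+1)%N) U|%:R)%R.
    by rewrite -!natrM -!natrD ler_nat.
  by move/le_trans; apply; rewrite lerD2l.
have {}UU' : (#|U|%:R <= #|U'|%:R :> R)%R by rewrite ler_nat.
set s := (#|S|%:R)%R in SU' HU *; set u := (#|U|%:R)%R in SU' UU' HU.
set u' := (#|U'|%:R)%R in SU' UU' *.
have s0 : (0 <= s)%R by rewrite /s.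
have q0 : (0 <= (1 - t^-1) ^+ j.+1 * s)%R by rewrite mulr_ge0// exprn_ge0// subr_ge0.
(* A non-positive deficit stays so, as [u <= u']. Otherwise [s - kappa * u <= t * (u' - u)] gives
   the contraction. *)
have [su|su] := leP s (kappa * u)%R.
  by apply: le_trans q0; rewrite subr_le0 (le_trans su)// ler_wpM2l// (le_trans _ k1).
apply: (@le_trans _ _ ((1 - t^-1) * (s - kappa * u))%R).
  have -> : ((1 - t^-1) * (s - kappa * u) = s - kappa * u - t^-1 * (s - kappa * u))%R
    by ring.
  have : (t^-1 * (s - kappa * u) <= u' - u)%R.
    rewrite mulrC ler_pdivrMr//; lra.
  have := t1; nra.
by rewrite exprS -mulrA; apply: ler_wpM2l => //; rewrite subr_ge0.
Qed.

(** Stated for [c] and [f] of any sign, so that applied to [- c] and [- f] it also bounds sums from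
    above. *)
Lemma tiled_sum_ge (R : realFieldType) (c : R) (f : T -> R) l U : tiled l U ->
  (forall x n, G x n -> c * #|lbox x n|%:R <= \sum_(y in lbox x n) f y)%R ->
  (c * #|U|%:R <= \sum_(y in U) f y)%R.
Proof.
move=> + cP; elim=> [|x n U' Gxn ln dU _ ih].
  by rewrite cards0 mulr0 big_set0.
rewrite card_disjointU// natrD mulrDr.
rewrite (eq_bigl [predU lbox x n & U']) => [|y]; last by rewrite !inE.
by rewrite bigU//= lerD// cP.
Qed.

End lattice_boxes.

Local Open Scope classical_set_scope.

(** * Parallelepipeds of R^d and Lebesgue measure *)

Section cV_topology.
Context (R : realType) (d : nat).

Lemma cvgr_sum (T I : Type) (F : set_system T) {FF : Filter F} (s : seq I)
  (f : I -> T -> R) (l : I -> R) : (forall i, f i x @[x --> F] --> l i) ->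
  \sum_(i <- s) f i x @[x --> F] --> \sum_(i <- s) l i.
Proof.
move=> fl; elim: s => [|i s ih].
  by under eq_fun do rewrite big_nil; rewrite big_nil; exact: cvg_cst.
by under eq_fun do rewrite big_cons; rewrite big_cons; exact: cvgD.
Qed.

Lemma cvgr_prod (T I : Type) (F : set_system T) {FF : Filter F} (s : seq I)
  (f : I -> T -> R) (l : I -> R) : (forall i, f i x @[x --> F] --> l i) ->
  \prod_(i <- s) f i x @[x --> F] --> \prod_(i <- s) l i.
Proof.
move=> fl; elim: s => [|i s ih].
  by under eq_fun do rewrite big_nil; rewrite big_nil; exact: cvg_cst.
by under eq_fun do rewrite big_cons; rewrite big_cons; exact: cvgM.
Qed.

Lemma cvg_cV (T : Type) (F : set_system T) {FF : Filter F}
    (f : T -> 'cV[R]_d) (l : 'cV[R]_d) :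
  (forall i, f x i 0 @[x --> F] --> l i 0) -> f @ F --> l.
Proof.
move=> fl A [B lB BA]; apply: filterS (BA) _.
have : \forall x \near F, forall i, B i 0 (f x i 0).
  by apply: filter_forall => i; exact: (fl i _ (lB i 0)).
by apply: filterS => x Bx i j; rewrite ord1.
Qed.

Lemma mulmx_continuous (W : 'M[R]_d) : continuous (fun x : 'cV[R]_d => W *m x).
Proof.
move=> x; apply: (cvg_cV (FF := @nbhs_filter 'cV[R]_d x)) => i; rewrite mxE.
under eq_fun do rewrite mxE.
apply: (cvgr_sum (FF := @nbhs_filter 'cV[R]_d x)) => j; apply: cvgM;
  [exact: cvg_cst|exact: coord_continuous].
Qed.

Lemma mulmx_coord_continuous (W : 'M[R]_d) i :
  continuous (fun x : 'cV[R]_d => (W *m x) i 0).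
Proof.
move=> x; apply: (@continuous_comp _ _ _ (fun x => W *m x) (fun M : 'cV[R]_d => M i 0)).
  exact: mulmx_continuous.
exact: coord_continuous.
Qed.

Lemma continuous_borel_cV (f : 'cV[R]_d -> R) : continuous f ->
  measurable_fun [set: borel_cV R d] (f : borel_cV R d -> R).
Proof.
move=> /continuousP cf; apply: (measurability _
  (measurable_realfun.RGenOpens.measurableE R)).
move=> _ [_ [a [b ->] <-]]; rewrite setTI; apply: sub_sigma_algebra.
exact/cf/interval_open.
Qed.

Lemma continuous_borel_cV_cV (f : 'cV[R]_d -> 'cV[R]_d) : continuous f ->
  measurable_fun [set: borel_cV R d] (f : borel_cV R d -> borel_cV R d).
Proof.
move=> /continuousP cf; apply: (@measurability _ _ _ (borel_cV R d) _ _ (@open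
  'cV[R]_d)) => //.
move=> _ [U oU <-]; rewrite setTI; apply: sub_sigma_algebra; exact: cf.
Qed.

Lemma compact_cube (V : 'M[R]_d) (r : R) : V \in unitmx ->
  compact [set x : 'cV[R]_d | forall i, `|(invmx V *m x) i 0| <= r].
Proof.
move=> uV.
(* [rV_compact] concerns row vectors, so the cube is written as the image of a product of segments
   under [u |-> V *m u^T]. *)
have -> : [set x : 'cV[R]_d | forall i, `|(invmx V *m x) i 0| <= r] =
    (fun u : 'rV[R]_d => V *m u^T) @` [set v : 'rV[R]_d | forall i, `[- r,
      r]%classic (v ord0 i)].
  apply/seteqP; split => [x xr|_ [v vr <-] i] /=.
    exists (invmx V *m x)^T; last by rewrite trmxK mulKVmx.
    by move=> i; rewrite mxE /= in_itv/= -ler_norml xr.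
  by have := vr i; rewrite mulKmx// mxE /= in_itv/= -ler_norml.
apply: continuous_compact; last first.
  apply: (@rV_compact R d (fun=> `[- r, r]%classic)) => i; exact: segment_compact.
apply: continuous_subspaceT => u; apply: (@continuous_comp _ _ _ (fun u => u^T) (fun
  x => V *m x)).
  apply: (cvg_cV (FF := @nbhs_filter 'rV[R]_d u)) => i; rewrite mxE;
    under eq_fun do rewrite mxE.
  exact: coord_continuous.
exact: mulmx_continuous.
Qed.

End cV_topology.

Section vbox.
Context (R : realType) (d : nat) (V : 'M[R]_d).
Hypothesis uV : V \in unitmx.
Implicit Types (a b : 'I_d -> R) (r : R).

(** Coordinates are taken in the basis of the columns of [V], where [tau V g] shifts both corners by
    [g]. Half-open sides let adjacent boxes tile without overlap. *)
Definition vbox a b : set (borel_cV R d) :=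
  [set x | forall i, a i <= (invmx V *m (x : 'cV[R]_d)) i 0 < b i].

Lemma measurable_vbox a b : measurable (vbox a b).
Proof.
have -> : vbox a b = \bigcap_(i in [set: 'I_d])
    ((fun x : borel_cV R d => (invmx V *m (x : 'cV[R]_d)) i 0) @^-1` `[a i,
      b i[%classic).
  apply/seteqP; split => [x xab i _|x xab i]/=; first by rewrite in_itv/=; exact: xab.
  by have := xab i Logic.I; rewrite /= in_itv.
apply: fin_bigcap_measurable => // i _; rewrite -[X in measurable X]setTI.
apply: continuous_borel_cV => //; exact: mulmx_coord_continuous.
Qed.

Lemma subset_vbox a b a' b' : (forall i, a' i <= a i) -> (forall i, b i <= b' i) ->
  vbox a b `<=` vbox a' b'.
Proof.
move=> aa bb x xab i; have /andP[xa xb] := xab i.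
by rewrite (le_trans (aa i))// (lt_le_trans xb).
Qed.

Lemma locally_finite_compact (nu : {measure set (borel_cV R d) -> \bar R}) (K : set
  'cV[R]_d) :
  locally_finite nu -> compact K -> exists2 W : set (borel_cV R d),
    measurable W & K `<=` W /\ (nu W < +oo)%E.
Proof.
move=> lf; rewrite compact_cover => cK.
have /choice[U HU] := lf.
have [x _|x Kx|D _ KD] := cK _ setT U; first by case: (HU x).
  by exists x => //; have [] := HU x.
have mU x : measurable (U x : set (borel_cV R d)).
  by apply: sub_sigma_algebra; case: (HU x).
exists (\big[setU/set0]_(x <- finmap.enum_fset D) U x).
  exact: bigsetU_measurable.
split; first by rewrite -bigcup_fset.
elim: (finmap.enum_fset D) => [|x s ih]; first by rewrite big_nil measure0 ltry.
rewrite big_cons (le_lt_trans (measureU2 _ _ _))//.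
  by apply: bigsetU_measurable.
by rewrite lte_add_pinfty//; have [] := HU x.
Qed.

Lemma vbox_lty (nu : {measure set (borel_cV R d) -> \bar R}) a b :
  locally_finite nu -> (nu (vbox a b) < +oo)%E.
Proof.
move=> lf.
pose r : R := \big[Num.max/0]_(i < d) Num.max `|a i| `|b i|.
have [W mW [KW nuW]] := locally_finite_compact lf (@compact_cube R d V r uV).
apply: le_lt_trans nuW; apply: le_measure; rewrite ?inE//.
  exact: measurable_vbox.
move=> x xab; apply: KW => i /=; have /andP[xa xb] := xab i.
have : Num.max `|a i| `|b i| <= r by apply: le_bigmax.
rewrite ge_max => /andP[]; rewrite !ler_norml => /andP[? ?] /andP[? ?].
by apply/andP; split; lra.
Qed.

Lemma cell_vbox : cell V = vbox (fun=> 0) (fun=> 1).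
Proof.
apply/seteqP; split => x.
  move=> [t t01 ->] i.
  have -> : \sum_(i < d) t i *: col i V = V *m \col_i t i.
    apply/colP => j; rewrite summxE mxE; apply: eq_bigr => l _.
    by rewrite !mxE mulrC.
  by rewrite mulKmx// mxE t01.
move=> x01; exists (fun i => (invmx V *m (x : 'cV[R]_d)) i 0) => //.
rewrite -[LHS](mulKVmx uV); apply/colP => j; rewrite summxE mxE.
by apply: eq_bigr => l _; rewrite !mxE mulrC.
Qed.

Lemma image_tau k (g : acting_group R d k) a b :
  tau V g @` vbox a b =
  vbox (fun i => a i + group_emb g i 0) (fun i => b i + group_emb g i 0).
Proof.
apply/seteqP; split => [_ [x xab <-] i|x xab].
  by rewrite /tau mulmxDr mulKmx// mxE lerD2r ltrD2r.
exists ((x : 'cV[R]_d) - V *m group_emb g); last by rewrite /tau subrK.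
by move=> i; rewrite mulmxBr mulKmx// mxE [(- group_emb g) i 0]mxE lerBrDr ltrBlDr.
Qed.

Lemma image_scale (e : R) a b : 0 < e ->
  (fun x : 'cV[R]_d => e^-1 *: x) @` vbox a b =
  vbox (fun i => e^-1 * a i) (fun i => e^-1 * b i).
Proof.
move=> e0; have e0' : 0 < e^-1 by rewrite invr_gt0.
apply/seteqP; split => [_ [x xab <-] i|x xab].
  by rewrite -scalemxAr mxE ler_pM2l ?ltr_pM2l.
exists (e *: (x : 'cV[R]_d)); last by rewrite scalerA mulVf ?gt_eqF// scale1r.
move=> i; rewrite -scalemxAr mxE.
by have := xab i; rewrite !(mulrC e^-1) ler_pdivrMr// ltr_pdivlMr// !(mulrC _ e).
Qed.

End vbox.

Definition image_measure d d' (T1 : measurableType d) (T2 : measurableType d')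
    (R : realType) (m : {measure set T1 -> \bar R}) (f : T1 -> T2)
    (mf : measurable_fun [set: T1] f) : {measure set T2 -> \bar R} :=
  measure_function_pushforward__canonical__measure_function_Measure m mf.

(** * Scaling of Lebesgue measure and the volume of the cell *)

Section lebesgue_affine.
Context (R : realType) (d : nat).

Definition obox (a b : 'I_d -> R) : set (borel_cV R d) :=
  [set x | forall i, `]a i, b i[%classic ((x : 'cV[R]_d) i 0)].

(** An open set is the union of the sup-norm balls with rational centre and radius that it contains;
    these balls are open boxes, and there are countably many of them. *)
Lemma measurable_obox : measurable `<=` <<s range (fun c => obox c.1 c.2) >>.
Proof.
set G := range _.
apply: smallest_sub; first exact: smallest_sigma_algebra.
move=> U oU.
pose B (c : 'cV[rat]_d * rat) : set 'cV[R]_d :=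
  obox (fun i => ratr (c.1 i 0) - ratr c.2) (fun i => ratr (c.1 i 0) + ratr c.2).
pose F n := if unpickle n is Some c then (if `[< B c `<=` U >] then B c else set0)
  else set0.
have -> : U = \bigcup_n F n.
  apply/seteqP; split => [t /= Ut|t [n _]]; last first.
    by rewrite /F; case: unpickle => // c; case: asboolP => // BU /BU.
  have /nbhs_ballP[e /= e0 eU] : nbhs (t : 'cV[R]_d) U.
    by move: oU; rewrite openE => /(_ _ Ut).
  have /rat_in_itvoo[r] : 0 < e / 2 by rewrite divr_gt0.
  rewrite in_itv/= => /andP[r0 re].
  have /choice[q qP] : forall i, exists q : rat, t i 0 - ratr r < ratr q < t i 0 +
    ratr r.
    move=> i; have /rat_in_itvoo[q] : t i 0 - ratr r < t i 0 + ratr r.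
      by rewrite ltrD2l (lt_trans _ r0)// oppr_lt0.
    by rewrite in_itv/= => qB; exists q.
  exists (pickle (\col_i q i, r)) => //; rewrite /F pickleK asboolT.
    move=> i; rewrite /= mxE in_itv/=; have /andP[? ?] := qP i; apply/andP; split; lra.
  move=> y By; apply: eU; split => // i j.
  have := By i; rewrite /= !mxE in_itv/= ord1 => /andP[? ?].
  have /andP[? ?] := qP i.
  rewrite /ball/= ltr_norml; apply/andP; split; lra.
apply: sigma_algebra_bigcup => n.
rewrite /F; case: unpickle => [c|]; last exact: sigma_algebra0.
case: asboolP => _; last exact: sigma_algebra0.
by apply: sub_sigma_algebra; exists (fun i => ratr (c.1 i 0) - ratr c.2,
  fun i => ratr (c.1 i 0) + ratr c.2).
Qed.

Lemma lebesgue_obox a b : lebesgue_cV (obox a b) =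
  (\prod_(i < d) @lebesgue_measure R `]a i, b i[%classic)%E.
Proof. by apply: lebesgue_cV_box => i; exact: measurable_itv. Qed.

Lemma lebesgue_obox_lty a b : (lebesgue_cV (obox a b) < +oo)%E.
Proof.
rewrite lebesgue_obox.
have -> : (\prod_(i < d) @lebesgue_measure R `]a i, b i[%classic =
   \prod_(i < d) (if a i < b i then b i - a i else 0)%:E)%E.
  by apply: eq_bigr => i _; rewrite lebesgue_measure_itv/= lte_fin; case: ifP.
by rewrite prodEFin ltry.
Qed.

(** Uniqueness of measures on the intersection-stable class of open boxes: [m1] is the image of
    Lebesgue measure under [x |-> s x + c], multiplied by [s ^ d], and on boxes the equality is a
    product of one-dimensional ones. *)
Lemma lebesgue_cV_affine (s : R) (c : 'cV[R]_d) (A : set (borel_cV R d)) :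
  0 < s -> measurable A ->
  ((s ^+ d)%:E * lebesgue_cV ((fun x : 'cV[R]_d => (s *: x + c)%R) @^-1` A) =
    lebesgue_cV A)%E.
Proof.
move=> s0 mA.
pose h (x : borel_cV R d) : borel_cV R d := s *: (x : 'cV[R]_d) + c.
have mh : measurable_fun setT h.
  apply: (@continuous_borel_cV_cV _ _ (fun x => s *: x + c)) => x.
  have sc : continuous (fun x : 'cV[R]_d => s *: x) by move=> y;
    exact: scaler_continuous.
  exact: (cvgD (sc x) (cvg_cst c)).
pose m1 := mscale (NngNum (exprn_ge0 d (ltW s0))) (image_measure (@lebesgue_cV R d) mh).
rewrite -[LHS]/(m1 A).
pose g k := obox (fun=> - k%:R) (fun=> k%:R).
have hbox a b : h @^-1` obox a b = obox (fun i => (a i - c i 0) / s) (fun i => (b i -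
  c i 0) / s).
  have hi x i : h x i 0 = s * x i 0 + c i 0 by rewrite /h !mxE.
  apply/seteqP; split => x xab i; have := xab i; rewrite /= hi !in_itv/=;
    by rewrite ltr_pdivrMr// ltr_pdivlMr// ltrBlDr ltrBrDr (mulrC s).
have m1box a b : m1 (obox a b) = lebesgue_cV (obox a b).
  rewrite /m1 /mscale/= /pushforward hbox !lebesgue_obox.
  have -> : ((s ^+ d)%:E = \prod_(i < d) s%:E)%E by rewrite prodEFin prodr_const
    card_ord.
  rewrite -big_split/=; apply: eq_bigr => i _.
  rewrite !lebesgue_measure_itv/= !lte_fin ltr_pM2r ?invr_gt0// ltrD2r.
  case: ifP => _; last by rewrite mule0.
  rewrite -!EFinB -EFinM; congr EFin; field; exact: lt0r_neq0.
apply: (@g_sigma_algebra_measure_unique _ _ (borel_cV R d) (range (fun c => obox c.1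
  c.2)) _ g) => //.
- move=> _ [[a b] _ <-] /=.
  rewrite (_ : obox a b = \bigcap_(i in [set: 'I_d])
    ((fun x : borel_cV R d => (x : 'cV[R]_d) i 0) @^-1` `]a i, b i[%classic));
      last first.
    by apply/seteqP; split => [x H i _|x H i]; exact: H.
  apply: fin_bigcap_measurable => // i _; rewrite -[X in measurable X]setTI.
  apply: continuous_borel_cV => //; exact: coord_continuous.
- by move=> k; exists (fun=> - k%:R, fun=> k%:R).
- apply/seteqP; split => // x _; pose r := \sum_(i < d) `|(x : 'cV[R]_d) i 0|.
  exists (Num.bound r) => // i /=; rewrite in_itv/= -ltr_norml.
  have r0 : 0 <= r by apply: sumr_ge0.
  apply: le_lt_trans (archi_boundP r0); rewrite /r (bigD1 i)//= lerDl; exact: sumr_ge0.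
- move=> _ _ [[a b] _ <-] [[a' b'] _ <-].
  exists (fun i => Num.max (a i) (a' i), fun i => Num.min (b i) (b' i)) => //=.
  apply/seteqP; split => [x H|x [H1 H2] i].
    by split => i; have := H i; rewrite /= !in_itv/= gt_max lt_min => /andP[/andP[?
      ?] /andP[? ?]]; apply/andP.
  by have := H1 i; have := H2 i; rewrite /= !in_itv/= gt_max lt_min => /andP[-> ->]
    /andP[-> ->].
- by move=> _ [[a b] _ <-] /=; exact: m1box.
- move=> k; apply: le_lt_trans (lebesgue_obox_lty (fun=> - k%:R) (fun=> k%:R)).
  by rewrite -m1box.
exact: measurable_obox.
Qed.

Lemma lebesgue_locally_finite : locally_finite (@lebesgue_cV R d).
Proof.
move=> x; exists (ball x 1); split; first exact: ball_open.
- exact: ballxx.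
- apply: le_lt_trans (lebesgue_obox_lty (fun i => x i 0 - 1) (fun i => x i 0 + 1)).
  apply: le_measure; rewrite ?inE.
  + by apply: sub_sigma_algebra; exact: ball_open.
  + rewrite (_ : obox _ _ = \bigcap_(i in [set: 'I_d])
      ((fun x : borel_cV R d => (x : 'cV[R]_d) i 0) @^-1` `]x i 0 - 1,
        x i 0 + 1[%classic)); last first.
      by apply/seteqP; split => [? H i _|? H i]; exact: H.
    apply: fin_bigcap_measurable => // i _; rewrite -[X in measurable X]setTI.
    apply: continuous_borel_cV => //; exact: coord_continuous.
  + move=> y [_ By] i; have := By i 0; rewrite /ball/= ltr_distlC in_itv/= =>
    /andP[-> ->] //.
Qed.

Context (V : 'M[R]_d).
Hypothesis uV : V \in unitmx.

(** The box is the preimage of the cell under [x |-> t^-1 (x - V a)]. Volumes are only compared with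
    that of the cell, so no determinant has to be computed. *)
Lemma lebesgue_vbox (a : 'I_d -> R) (t : R) : 0 < t ->
  lebesgue_cV (vbox V a (fun i => a i + t)) = ((t ^+ d)%:E * lebesgue_cV (cell V))%E.
Proof.
move=> t0; have it0 : 0 < t^-1 by rewrite invr_gt0.
have mc : measurable (cell V) by rewrite cell_vbox//; exact: measurable_vbox.
rewrite -(lebesgue_cV_affine (- (t^-1 *: (V *m \col_i a i))) it0 mc).
rewrite muleA -EFinM -exprMn mulfV ?gt_eqF// expr1n mul1e; congr lebesgue_cV.
have E (x : 'cV[R]_d) i : (invmx V *m (t^-1 *: x - t^-1 *: (V *m \col_i a i))) i 0 =
    t^-1 * ((invmx V *m x) i 0 - a i).
  rewrite -scalerBr -scalemxAr mulmxBr mulKmx// mxE; congr (_ * _).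
  by rewrite mxE; congr (_ + _); rewrite !mxE.
rewrite cell_vbox//; apply/seteqP; split => x xa i; have := xa i; rewrite E mulrC.
  by rewrite ler_pdivlMr// ltr_pdivrMr// mul0r mul1r subr_ge0 ltrBlDl.
by rewrite ler_pdivlMr// ltr_pdivrMr// mul0r mul1r subr_ge0 ltrBlDl.
Qed.

(** For positivity: if the cell were null, so would be its dilated translates, while a large one
    contains the open unit cube, of measure 1. *)
Lemma lebesgue_cell : exists2 c : R, 0 < c & lebesgue_cV (cell V) = c%:E.
Proof.
have fin : (lebesgue_cV (cell V) < +oo)%E.
  by rewrite cell_vbox//; apply: vbox_lty => //; exact: lebesgue_locally_finite.
have mc : measurable (cell V) by rewrite cell_vbox//; exact: measurable_vbox.
have : lebesgue_cV (cell V) != 0%E.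
  apply/eqP => c0.
  (* [k] exceeds every coordinate of [V^-1 x], in absolute value, for [x] in the unit cube. *)
  pose k : R := 1 + \sum_i \sum_j `|invmx V i j|.
  have k0 : 0 < k by rewrite ltr_pwDl// sumr_ge0// => i _; exact: sumr_ge0.
  have : lebesgue_cV (vbox V (fun=> - k) (fun i => - k + (k + k))) = 0%E.
    have kk : 0 < k + k by exact: addr_gt0.
    by rewrite (lebesgue_vbox _ kk) c0 mule0.
  apply/eqP; rewrite gt_eqF//.
  apply: (@lt_le_trans _ _ (lebesgue_cV (obox (fun=> 0) (fun=> 1)))).
    rewrite lebesgue_obox (_ : (\prod_(_ < d) _ = 1)%E) ?lte01//.
    by rewrite big1// => i _; rewrite lebesgue_measure_itv/= lte_fin ltr01 oppr0 adde0.
  apply: le_measure; rewrite ?inE; last 2 first.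
  - exact: measurable_vbox.
  - move=> x x01 i; rewrite addKr.
    have : `|(invmx V *m (x : 'cV[R]_d)) i 0| < k.
      rewrite mxE; apply: (@le_lt_trans _ _ (\sum_j `|invmx V i j|)).
        apply: le_trans (ler_norm_sum _ _ _) _; apply: ler_sum => j _.
        rewrite normrM -[leRHS]mulr1 ler_wpM2l//.
        by have := x01 j; rewrite /= in_itv/= => /andP[? ?]; rewrite gtr0_norm// ltW.
      have : 0 <= \sum_(l < d | l != i) \sum_j `|invmx V l j|.
        by apply: sumr_ge0 => l _; exact: sumr_ge0.
      by move=> H; rewrite /k [X in 1 + X](bigD1 i)//=; apply: ltr_pwDl => //;
        exact: ler_wpDr.
    by rewrite ltr_norml => /andP[/ltW -> ->].
  - rewrite (_ : obox _ _ = \bigcap_(i in [set: 'I_d])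
      ((fun x : borel_cV R d => (x : 'cV[R]_d) i 0) @^-1` `]0, 1[%classic)); last first.
      by apply/seteqP; split => [? H i _|? H i]; exact: H.
    apply: fin_bigcap_measurable => // i _; rewrite -[X in measurable X]setTI.
    apply: continuous_borel_cV => //; exact: coord_continuous.
have : (0 <= lebesgue_cV (cell V))%E by [].
case: (lebesgue_cV (cell V)) fin => // c _; rewrite lee_fin eqe => c0 cn.
by exists c => //; rewrite lt_neqAle eq_sym cn.
Qed.

End lebesgue_affine.

(** * Partition of grid-aligned boxes into cells *)

Section grid.
Context (R : realType) (d M : nat) (V : 'M[R]_d).
Local Notation T := {ffun 'I_d -> 'I_M}.
Context (o : 'I_d -> R) (h : R).
Hypothesis h0 : 0 < h.

Definition gcell (y : T) : set (borel_cV R d) :=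
  vbox V (fun i => o i + h * (y i)%:R) (fun i => o i + h * (y i).+1%:R).

Lemma trivIset_gcell (D : set T) : trivIset D gcell.
Proof.
move=> y z _ _ [x [xy xz]]; apply/ffunP => i; apply/val_inj => /=.
have := xy i; have := xz i; set t := (_ *m _) i 0 => /andP[z1 z2] /andP[y1 y2].
have lty (p q : nat) : o i + h * p%:R <= t -> t < o i + h * q.+1%:R -> (p <= q)%N.
  move=> tp tq; have := le_lt_trans tp tq.
  by rewrite ltrD2l ltr_pM2l// ltr_nat ltnS.
by apply/eqP; rewrite eqn_leq (lty _ _ y1 z2) (lty _ _ z1 y2).
Qed.

Lemma vbox_gcell (l u : 'I_d -> nat) : (forall i, (u i <= M)%N) ->
  vbox V (fun i => o i + h * (l i)%:R) (fun i => o i + h * (u i)%:R) =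
  \bigcup_(y in [set` enum [pred y : T | [forall i, (l i <= y i < u i)%N]]]) gcell y.
Proof.
move=> uM; apply/seteqP; split => [x xlu|x [y yD xy] i]; last first.
  move: yD; rewrite /= mem_enum inE => /forallP/(_ i)/andP[ly yu];
    have /andP[h1 h2] := xy i.
  by rewrite (le_trans _ h1) ?(lt_le_trans h2)// lerD2l ler_pM2l// ler_nat.
pose t i := (invmx V *m (x : 'cV[R]_d)) i 0.
have tP i : exists y : 'I_M, [/\ (l i <= y)%N, (y < u i)%N & o i + h * y%:R <= t i <
  o i + h * y.+1%:R].
  have /andP[t1 t2] := xlu i.
  have s0 : 0 <= (t i - o i) / h.
    apply: divr_ge0; last exact: ltW.
    by rewrite subr_ge0; apply: le_trans t1; rewrite lerDl mulr_ge0// ltW.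
  have /andP[n1 n2] := truncn_itv s0.
  set n := Num.truncn _ in n1 n2.
  have {}n1 : o i + h * n%:R <= t i by rewrite -lerBrDl mulrC -ler_pdivlMr.
  have {}n2 : t i < o i + h * n.+1%:R by rewrite -ltrBlDl mulrC -ltr_pdivrMr.
  have lt (p q : nat) : o i + h * p%:R <= t i -> t i < o i + h * q%:R -> (p < q)%N.
    by move=> /le_lt_trans /[apply]; rewrite ltrD2l ltr_pM2l// ltr_nat.
  have nu := lt _ _ n1 t2.
  exists (Ordinal (leq_trans nu (uM i))); split => //=; last by rewrite n1.
  by rewrite -ltnS (lt _ _ t1 n2).
have /choice[y yP] := tP.
exists [ffun i => y i].
  by rewrite /= mem_enum inE; apply/forallP => i; rewrite ffunE; case: (yP i) => -> ->.
by move=> i; rewrite ffunE; case: (yP i).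
Qed.

Lemma measure_vbox_gcell (nu : {measure set (borel_cV R d) -> \bar R}) (l u : 'I_d ->
  nat) :
  (forall i, (u i <= M)%N) ->
  nu (vbox V (fun i => o i + h * (l i)%:R) (fun i => o i + h * (u i)%:R)) =
  (\sum_(y : T | [forall i, (l i <= y i < u i)%N]) nu (gcell y))%E.
Proof.
move=> uM; rewrite vbox_gcell// measure_fin_bigcup//.
- by rewrite -fsbig_seq ?enum_uniq// big_enum.
- exact: trivIset_gcell.
- by move=> y _; exact: measurable_vbox.
Qed.

End grid.

(** * Measurability of the mass of a parallelepiped *)

Lemma integrable_indic_lty d (T : measurableType d) (R : realType)
    (m : {measure set T -> \bar R}) (A : set T) :
  measurable A -> (m A < +oo)%E -> m.-integrable setT (EFin \o \1_A).
Proof.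
move=> mA mAoo; apply/integrableP; split.
  by apply/measurable_EFinP; exact: measurable_indic.
rewrite (eq_integral (fun x => (\1_A x)%:E)) => [|x _];
  first by rewrite integral_indic// setIT.
by rewrite /= ger0_norm.
Qed.

Section evaluation.
Context (R : realType) (d : nat).

(** The vague topology is initial for [cc_integral], whose target carries the product topology;
    evaluation at [f] is thus a composition of two continuous maps. *)
Lemma open_vague_preimage (f : continuous_cpt_supp R d) (U : set R) : open U ->
  open ((fun nu : vague R d => cc_integral nu f) @^-1` U).
Proof.
have cf : continuous (fun nu : vague R d => cc_integral nu f).
  move=> nu.
  apply: (@cvg_comp _ _ _ (@cc_integral R d : vague R d -> {ptws continuous_cpt_supp
    R d -> R}) (fun g => g f) _ (nbhs (cc_integral nu : {ptws continuous_cpt_supp R d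
    -> R}))).
    exact: (@initial_continuous _ _ (@cc_integral R d)).
  set g := (cc_integral nu : {ptws continuous_cpt_supp R d -> R}).
  have /cvg_sup/(_ f) gg : g --> g by exact: cvg_id.
  move=> A nA; apply: gg.
  exact: (@initial_continuous _ _ (fun g : forall i : continuous_cpt_supp R d,
    R => g f)).
by move=> oU; move/continuousP : cf; exact.
Qed.

Lemma measurable_cc_integral dO (Omega : measurableType dO)
    (mu : Omega -> lfmeasure R d) (f : continuous_cpt_supp R d) :
  measurable_fun [set: Omega] (mu : Omega -> borel_lf R d) ->
  measurable_fun [set: Omega] (fun w => \int[mu w]_x f x).
Proof.
move=> mmu; apply: (measurability _ (measurable_realfun.RGenOpens.measurableE R)).
move=> _ [_ [a [b ->] <-]].
apply: (mmu measurableT ((fun nu : vague R d => cc_integral nu f) @^-1` `]a,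
  b[%classic)).
apply: sub_sigma_algebra; apply: open_vague_preimage; exact: interval_open.
Qed.

(* The truncation of [z] to [0, 1], written so that continuity is immediate. *)
Definition clamp (z : R) : R := (`|z| - `|z - 1| + 1) / 2.

Lemma clamp_continuous : continuous clamp.
Proof.
move=> z; rewrite /clamp; apply: cvgM; last exact: cvg_cst.
apply: cvgD; last exact: cvg_cst.
apply: cvgB; first exact: norm_continuous.
apply: (@continuous_comp _ _ _ (fun z : R => z - 1) (fun z : R => `|z|));
  last exact: norm_continuous.
by apply: cvgB; [exact: cvg_id|exact: cvg_cst].
Qed.

Lemma clamp0 z : z <= 0 -> clamp z = 0.
Proof. by move=> z0; rewrite /clamp ler0_norm// ler0_norm; lra. Qed.

Lemma clamp1 z : 1 <= z -> clamp z = 1.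
Proof. by move=> z0; rewrite /clamp ger0_norm ?ger0_norm; lra. Qed.

Lemma clamp_ge0 z : 0 <= clamp z.
Proof. by have [/clamp0->//|/ltW z0] := leP z 0; rewrite /clamp (ger0_norm z0);
  case: (ger0P (z - 1)); lra. Qed.

Lemma clamp_le1 z : clamp z <= 1.
Proof. by have [/clamp1->//|/ltW z0] := leP 1 z; rewrite /clamp (@ler0_norm _ (z -
  1)); [case: (ger0P z); lra|lra]. Qed.

(** For positive [n], a ramp of width [1/n] just before [a] and another just before [b]: the first
    factor is 1 for [t >= a] and the second is 0 for [t >= b], so that the limit is the indicator of
    an interval closed on the left and open on the right. *)
Definition plateau (a b t : R) (n : nat) : R :=
  clamp (n%:R * (t - a) + 1) * clamp (n%:R * (b - t)).

Lemma plateau_cvg a b t : plateau a b t n @[n --> \oo] --> (if a <= t < b then 1 else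
  0 : R).
Proof.
apply: cvg_near_cst; case: (leP a t) => [at_|ta] /=; last first.
  near=> n; rewrite /plateau clamp0 ?mul0r//.
  have : (a - t)^-1 <= n%:R by near: n; exact: nbhs_infty_ger.
  have a0 : 0 < a - t by lra.
  by rewrite -div1r ler_pdivrMr//; lra.
case: (ltP t b) => tb; last first.
  near=> n; rewrite /plateau [clamp (n%:R * (b - t))]clamp0 ?mulr0//.
  by rewrite mulr_ge0_le0//; lra.
near=> n; rewrite /plateau !clamp1 ?mulr1//.
  have : (b - t)^-1 <= n%:R by near: n; exact: nbhs_infty_ger.
  have a0 : 0 < b - t by lra.
  by rewrite -div1r ler_pdivrMr//; lra.
by rewrite lerDr mulr_ge0//; lra.
Unshelve. all: by end_near. Qed.

Lemma plateau_ge0 a b t n : 0 <= plateau a b t n.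
Proof. by rewrite mulr_ge0// clamp_ge0. Qed.

Lemma plateau_le1 a b t n : plateau a b t n <= 1.
Proof. by rewrite mulr_ile1// ?clamp_ge0// clamp_le1. Qed.

Lemma plateau_neq0 a b t n : plateau a b t n.+1 != 0 -> a - 1 <= t < b.
Proof.
apply: contraNT; rewrite negb_and -!ltNge => /orP[ta|]; rewrite /plateau.
  rewrite clamp0 ?mul0r//.
  have : 1 <= n.+1%:R :> R by rewrite ler1n.
  by nra.
by rewrite -leNgt => bt; rewrite [X in _ * X]clamp0 ?mulr0// mulr_ge0_le0//; lra.
Qed.

Context (V : 'M[R]_d).
Hypothesis uV : V \in unitmx.
Implicit Types a b : 'I_d -> R.

(** The index [n.+1] keeps the left ramps of width at most 1: all these functions vanish outside one
    bounded box, whose indicator dominates them. *)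
Definition box_plateau a b (n : nat) (x : 'cV[R]_d) : R :=
  \prod_(i < d) plateau (a i) (b i) ((invmx V *m x) i 0) n.+1.

Lemma box_plateau_continuous a b n : continuous (box_plateau a b n).
Proof.
move=> x; apply: (cvgr_prod (FF := @nbhs_filter 'cV[R]_d x)) => i.
have c : {for x, continuous (fun x : 'cV[R]_d => (invmx V *m x) i 0)}.
  exact: mulmx_coord_continuous.
apply: (@continuous_comp _ _ _ (fun x => (invmx V *m x) i 0) (fun t => plateau (a i)
  (b i) t n.+1)) => //.
apply: cvgM.
  apply: (@continuous_comp _ _ _ (fun t : R => n.+1%:R * (t - a i) + 1) clamp);
    last exact: clamp_continuous.
  by apply: cvgD; [apply: cvgM; [exact: cvg_cst|apply: cvgB;
    [exact: cvg_id|exact: cvg_cst]]|exact: cvg_cst].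
apply: (@continuous_comp _ _ _ (fun t : R => n.+1%:R * (b i - t)) clamp);
  last exact: clamp_continuous.
by apply: cvgM; [exact: cvg_cst|apply: cvgB; [exact: cvg_cst|exact: cvg_id]].
Qed.

Lemma box_plateau_supp a b n (x : 'cV[R]_d) : box_plateau a b n x != 0 ->
  vbox V (fun i => a i - 1) b x.
Proof.
rewrite /box_plateau prodf_seq_neq0 => /allP H i; apply: (@plateau_neq0 _ _ _ n).
by have := H i (mem_index_enum _).
Qed.

Lemma box_plateau_compact a b n :
  compact (closure [set x : 'cV[R]_d | box_plateau a b n x != 0]).
Proof.
pose r : R := \big[Num.max/0]_(i < d) Num.max `|a i - 1| `|b i|.
have cK := @compact_cube R d V r uV.
apply: (subclosed_compact _ cK); first exact: closed_closure.
have clK := compact_closed (@norm_hausdorff _ _) cK.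
rewrite [X in _ `<=` X]((closure_id _).1 clK).
apply: closureS => x /box_plateau_supp xab i; have /andP[xa xb] := xab i.
have : Num.max `|a i - 1| `|b i| <= r by apply: le_bigmax.
rewrite ge_max => /andP[]; rewrite !ler_norml => /andP[? ?] /andP[? ?].
by apply/andP; split; lra.
Qed.

Definition box_plateau_cc a b n : continuous_cpt_supp R d :=
  ContinuousCptSupp (@box_plateau_continuous a b n) (@box_plateau_compact a b n).

Lemma box_plateau_cvg (nu : lfmeasure R d) a b :
  (\int[nu]_x (box_plateau a b n x)%:E)%E @[n --> \oo] --> nu (vbox V a b).
Proof.
set B := vbox V (fun i => a i - 1) b.
have mB : measurable B by exact: measurable_vbox.
have mab : measurable (vbox V a b) by exact: measurable_vbox.
rewrite -[X in _ --> nu X]setIT -integral_indic//.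
have [] := @dominated_convergence _ (borel_cV R d) R nu setT measurableT
  (fun n x => (box_plateau a b n x)%:E) (EFin \o \1_(vbox V a b)) (EFin \o \1_B).
- move=> n; apply/measurable_EFinP; apply: continuous_borel_cV;
    exact: box_plateau_continuous.
- by apply/measurable_EFinP; exact: measurable_indic.
- apply/aeW => x _; apply: cvg_EFin; first by near=> n.
  rewrite (_ : \1_(vbox V a b) x = \prod_(i < d) (if a i <= (invmx V *m (x :
    'cV[R]_d)) i 0 < b i then 1 else 0 : R)).
    apply: cvgr_prod => i.
    have := @plateau_cvg (a i) (b i) ((invmx V *m (x : 'cV[R]_d)) i 0).
    by rewrite -cvg_shiftS.
  rewrite indicE; case: (boolP (x \in vbox V a b)) => [|]; rewrite ?inE => xab.
    by rewrite big1// => i _; rewrite xab.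
  apply/esym/eqP; apply: contraR xab; rewrite prodf_seq_neq0 => /allP H;
    rewrite inE => i.
  have := H i (mem_index_enum _); rewrite /=; by case: ifP => //; rewrite eqxx.
- by apply: integrable_indic_lty => //; exact: (vbox_lty uV _ _ (lf_locally_finite nu)).
- apply/aeW => x n _; rewrite lee_fin ger0_norm; last by apply: prodr_ge0 => i _;
    exact: plateau_ge0.
  rewrite indicE; case: (boolP (x \in B)) => [_|]; last rewrite notin_setE => xB.
    by apply: prodr_ile1 => i _; rewrite plateau_ge0 plateau_le1.
  have [->//|/box_plateau_supp] := eqVneq (box_plateau a b n x) 0; by move/xB.
by [].
Unshelve. all: by end_near. Qed.

(** Integrals of compactly supported continuous functions are vaguely continuous, hence measurable
    in [w]; the mass of a half-open box is a pointwise limit of such integrals. *)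
Lemma measurable_eval_vbox dO (Omega : measurableType dO)
    (mu : Omega -> lfmeasure R d) a b :
  measurable_fun [set: Omega] (mu : Omega -> borel_lf R d) ->
  measurable_fun [set: Omega] (fun w => mu w (vbox V a b)).
Proof.
move=> mmu.
apply: (emeasurable_fun_cvg (fun n w => (\int[mu w]_x (box_plateau_cc a b n x))%:E)).
  by move=> n; apply/measurable_EFinP; exact: measurable_cc_integral.
move=> w _; have := @box_plateau_cvg (mu w) a b.
apply: cvg_trans; apply: near_eq_cvg; near=> n.
rewrite /Rintegral fineK//.
rewrite ge0_fin_numE; last first.
  by apply: integral_ge0 => x _; rewrite lee_fin; apply: prodr_ge0 => i _;
    exact: plateau_ge0.
set B := vbox V (fun i => a i - 1) b.
have mB : measurable B by exact: measurable_vbox.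
apply: (@le_lt_trans _ _ (\int[mu w]_x (\1_B x)%:E)%E); last first.
  by rewrite integral_indic// setIT; exact: (vbox_lty uV _ _ (lf_locally_finite _)).
apply: ge0_le_integral => //.
- by move=> x _; rewrite lee_fin; apply: prodr_ge0 => i _; exact: plateau_ge0.
- apply/measurable_EFinP; apply: continuous_borel_cV; exact: box_plateau_continuous.
- by apply/measurable_EFinP; exact: measurable_indic.
- move=> x _ /=; rewrite lee_fin indicE; case: (boolP (x \in B)) => [_|];
    last rewrite notin_setE => xB.
    by apply: prodr_ile1 => i _; rewrite plateau_ge0 plateau_le1.
  have [->//|/box_plateau_supp] := eqVneq (box_plateau a b n x) 0; by move/xB.
Unshelve. all: by end_near. Qed.

End evaluation.

(** * Covering along the orbits of the action *)

(** The constant [3 ^ d] is what the induction carries: the product [(1 + e) (1 + 3^d e)] adds to 1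
    the terms [e], [3^d e] and [3^d e^2], each at most [3^d e]. *)
Lemma exprD1_le (R : realFieldType) (d : nat) (e : R) : 0 <= e <= 1 ->
  (1 + e) ^+ d <= 1 + 3 ^+ d * e.
Proof.
move=> /andP[e0 e1]; elim: d => [|d ih]; first by rewrite !expr0; lra.
have p3 : 1 <= 3 ^+ d :> R by rewrite exprn_ege1// ler1n.
rewrite !exprS; apply: (@le_trans _ _ ((1 + e) * (1 + 3 ^+ d * e))).
  by rewrite ler_wpM2l//; lra.
have : 3 ^+ d * e * e <= 3 ^+ d * e by rewrite ler_piMr// mulr_ge0//; lra.
nra.
Qed.

Lemma eventually_expDn_le (R : archiRealFieldType) (d L : nat) (e : R) : 0 < e ->
  exists2 l : nat, (0 < l)%N &
    forall n, (l <= n)%N -> ((n + L)%N ^ d)%N%:R <= (1 + e) * (n ^ d)%N%:R.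
Proof.
move=> e0; pose t : R := Num.min 1 (e / 3 ^+ d).
have p3 : 0 < 3 ^+ d :> R by rewrite exprn_gt0.
have t0 : 0 < t by rewrite /t lt_min ltr01 divr_gt0.
have t1 : t <= 1 by rewrite /t ge_min lexx.
exists (Num.bound (L%:R / t)).+1 => // n nl.
have n0 : 0 < n%:R :> R by rewrite ltr0n (leq_trans _ nl).
have Ln : L%:R / n%:R <= t.
  rewrite ler_pdivrMr// -ler_pdivrMl// mulrC.
  have : 0 <= L%:R / t by rewrite divr_ge0// ltW.
  move/archi_boundP/ltW/le_trans; apply; rewrite ler_nat; exact: ltnW.
rewrite !natrX natrD (_ : n%:R + L%:R = n%:R * (1 + L%:R / n%:R)); last by field; lra.
rewrite exprMn [leRHS]mulrC ler_pM2l ?exprn_gt0//.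
apply: (@le_trans _ _ ((1 + t) ^+ d)).
  rewrite lerXn2r ?nnegrE ?lerD2l// addr_ge0// ?divr_ge0// ltW//.
apply: le_trans (exprD1_le _ _) _; first by rewrite (ltW t0).
rewrite lerD2l mulrC -ler_pdivlMr// /t ge_min lexx orbT //.
Qed.

Lemma leq_exp2r_w m n e : (m <= n)%N -> (m ^ e <= n ^ e)%N.
Proof. by case: e => // e mn; rewrite leq_exp2r. Qed.

Section group_nat.
Context (R : realType) (d : nat) (k : group_kind).

(** The indices of the discrete cube as elements of either group: the covering moves only along
    these. *)
Definition gnat (x : 'I_d -> nat) : acting_group R d k :=
  (\col_i (x i)%:R : 'cV[group_scalar R k]_d).

Lemma group_emb_gnat (x : 'I_d -> nat) i : group_emb (gnat x) i 0 = (x i)%:R.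
Proof. by rewrite /gnat /group_emb; case: k; rewrite !mxE// natz. Qed.

End group_nat.

Section stationary_events.
Context (R : realType) (d : nat) (k : group_kind).
Context (dO : measure_display) (Omega : measurableType dO) (P : probability Omega R).
Context (theta : acting_group R d k -> Omega -> Omega).
Hypothesis act : is_action theta.
Hypothesis stat : stationary P theta.

Lemma measurable_theta g : measurable_fun setT (theta g).
Proof.
case: act => _ _ m; exact: (@measurable_fun_pair2 _ _ _ _ _ _ (fun p : borel_group R
  d k * Omega => theta p.1 p.2) g).
Qed.

Lemma integral_theta g (f : Omega -> \bar R) : measurable_fun setT f -> (forall w,
  (0 <= f w)%E) ->
  (\int[P]_w f (theta g w) = \int[P]_w f w)%E.
Proof.
move=> mf f0; have /esym := ge0_integral_pushforward (measurable_theta g) P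
  measurableT mf (fun y _ => f0 y).
rewrite preimage_setT => ->.
apply: (@eq_measure_integral _ _ _ _ P (image_measure P (measurable_theta g))) => A
  mA _.
exact: stat.
Qed.

Context (a b : 'I_d -> nat).
Hypothesis b0 : forall i, (0 < b i)%N.

(** The last two conditions keep the box inside the discrete cube, so that it has its full
    cardinality. *)
Definition fitting M (G : nat -> set Omega) (w : Omega) (x : {ffun 'I_d -> 'I_M}) (n
  : nat) :=
  [/\ (0 < n)%N, G n (theta (gnat R k (fun i => x i : nat)) w), forall i,
    (a i * n <= x i)%N &
      forall i, (x i + b i * n <= M)%N].

Lemma card_fitting M G w (x : {ffun 'I_d -> 'I_M}) n : fitting G w x n ->
  #|lbox a b x n| = ((\prod_i (a i + b i)) * n ^ d)%N.
Proof.
move=> [n0 _ ax bx].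
have -> : ((\prod_i (a i + b i)) * n ^ d)%N = (\prod_i (x i + b i * n - (x i - a i *
  n)))%N.
  rewrite (_ : n ^ d = \prod_(i < d) n)%N; last by rewrite prod_nat_const card_ord.
  rewrite -big_split/=; apply: eq_bigr => i _; have := ax i; nia.
rewrite -(card_box_fit (M := M))//; apply: eq_card => y; rewrite !inE.
by apply: eq_forallb => i; have := ax i; lia.
Qed.

Lemma fitting_center M G w (x : {ffun 'I_d -> 'I_M}) n : fitting G w x n -> x \in
  lbox a b x n.
Proof. by case=> n0 *; exact: lbox_center. Qed.

Context (G : nat -> set Omega).
Hypothesis mG : forall n, measurable (G n).
Hypothesis Gio : forall l, P (\bigcup_(n in [set n | (l <= n)%N]) G n) = 1%E.

(** Continuity of [P] from below along the growing windows [l <= n <= L]. Bounded windows make it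
    possible to choose the next scale far above the present one. *)
Lemma window_exists (l : nat) (e : R) : 0 < e ->
  exists2 L : nat, (l <= L)%N & (P (~` \bigcup_(n in [set n | (l <= n <= L)%N]) G n)
    <= e%:E)%E.
Proof.
move=> e0; pose F L := \bigcup_(n in [set n | (l <= n <= L)%N]) G n.
have mF L : measurable (F L) by apply: bigcup_measurable.
have UF : \bigcup_L F L = \bigcup_(n in [set n | (l <= n)%N]) G n.
  apply/seteqP; split => [w [L _ [n /andP[ln _] Gn]]|w [n ln Gn]]; first by exists n.
  by exists n => //; exists n => //=; rewrite ln leqnn.
have : P \o F @ \oo --> P (\bigcup_L F L).
  apply: nondecreasing_cvg_mu => //; first exact: bigcupT_measurable.
  move=> L L' LL; apply/subsetPset => w [n /andP[ln nL] Gn].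
  by exists n => //=; rewrite ln (leq_trans nL).
rewrite UF Gio => cF.
have : \forall L \near \oo, ((1 - e)%:E < P (F L))%E.
  apply: (cF [set x | ((1 - e)%:E < x)%E]); apply: open_nbhs_nbhs; split.
    exact: open_ereal_gt_ereal.
  by rewrite /= lte_fin; lra.
move=> [N _ HN]; exists (maxn l N); first exact: leq_maxl.
have := HN (maxn l N) (leq_maxr _ _) => /= h.
rewrite -/(F _) probability_setC// leeBlDr//; last by rewrite fin_num_measure.
have -> : 1%E = (e%:E + (1 - e)%:E)%E by rewrite -EFinD; congr EFin; lra.
by rewrite leeD2l// ltW.
Qed.

(* [Z w] counts the points of the cube that lack a good box at one of the scales. *)
Lemma stationary_cover (kappa : R) : 0 < kappa < 1 ->
  exists M (Z : Omega -> R), [/\ (0 < M)%N, measurable_fun setT Z, (forall w, 0 <= Z w),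
    (\int[P]_w (Z w)%:E <= ((1 - kappa) * (M ^ d)%N%:R)%:E)%E &
    forall w, exists2 U : {set {ffun 'I_d -> 'I_M}},
      tiled a b (fitting G w) 1 U & kappa * (M ^ d)%N%:R - Z w <= #|U|%:R].
Proof.
(* With [kappa = 1 - 4 e] all losses fit in, because [(1 - 4 e) (1 + e)^2 <= 1 - e]. *)
move=> /andP[k0 k1]; pose e : R := (1 - kappa) / 4.
have e0 : 0 < e by rewrite /e; lra.
have [J HJ] : exists J, (1 - (2 ^ d)%N%:R^-1) ^+ J <= e.
  have t0 : 0 < (2 ^ d)%N%:R :> R by rewrite ltr0n expn_gt0.
  have t1 : ((2 ^ d)%N%:R : R)^-1 <= 1 by rewrite invf_le1// ler1n expn_gt0.
  have : (1 - ((2 ^ d)%N%:R : R)^-1) ^+ n @[n --> \oo] --> (0 : R).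
    by apply: cvg_expr; rewrite ger0_norm ?subr_ge0.
  move=> /cvgrPdist_le/(_ _ e0)[N _ HN]; exists N.
  have := HN N (leqnn _); rewrite /= sub0r normrN; apply: le_trans; exact: ler_norm.
(* The failure probability allowed at each of the [J] scales; their sum is at most [e]. *)
pose e' : R := e / J.+1%:R.
have e'0 : 0 < e' by rewrite divr_gt0.
have /choice[lf lfP] : forall L, exists l : nat, (0 < l)%N /\
    forall n, (l <= n)%N -> ((n + L)%N ^ d)%N%:R <= (1 + e) * (n ^ d)%N%:R :> R.
  by move=> L; have [l l0 lP] := eventually_expDn_le d L e0; exists l.
have /choice[Lf LfP] : forall l, exists L : nat,
    (P (~` \bigcup_(n in [set n | (l <= n <= L)%N]) G n) <= e'%:E)%E.
  by move=> l; have [L _ ?] := window_exists l e'0; exists L.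
(* The separation of scales: enlarging a box of scale at least [l j.+1] by [L j] multiplies its size
   by at most [1 + e]. *)
pose l := fix l j := if j is j'.+1 then maxn (l j') (lf (Lf (l j'))) else 1%N.
pose L j := Lf (l j).
have ll j : (l j <= l j.+1)%N by rewrite /= leq_maxl.
have lL j n : (l j.+1 <= n)%N -> ((n + L j)%N ^ d)%N%:R <= (1 + e) * (n ^ d)%N%:R.
  by move=> /= ln; apply: (lfP (L j)).2; apply: leq_trans ln; exact: leq_maxr.
have l1 j : (1 <= l j)%N by elim: j => // j ih; apply: leq_trans ih (ll j).
pose W j := \bigcup_(n in [set n | (l j <= n <= L j)%N]) G n.
have mW j : measurable (W j) by apply: bigcup_measurable.
pose H := \bigcup_(j < J) ~` W j.
have mH : measurable H by apply: bigcup_measurable => j _; exact: measurableC.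
have PH : (P H <= e%:E)%E.
  rewrite /H bigcup_mkord.
  apply: le_trans (@Boole_inequality _ _ _ P (fun j => ~` W j) J _) _.
    by move=> i _; exact: measurableC.
  apply: (@le_trans _ _ (\sum_(i < J) e'%:E)%E); first by apply: lee_sum => i _;
    exact: LfP.
  rewrite sumEFin sumr_const card_ord lee_fin -mulr_natr /e'.
  have hJ : J%:R / J.+1%:R <= 1 :> R by rewrite ler_pdivrMr// mul1r ler_nat.
  by rewrite mulrAC -mulrA; apply: ler_piMr => //; exact: ltW.
(* [Q] bounds the extent of every box in use, so boxes around points of the inner cube [B], of side
   [N0], stay in the cube of side [M = N0 + 2 Q]; [N0] is taken large enough to make the margin
   negligible. *)
pose Q := (\sum_i (a i + b i) * \max_(j < J) L j)%N.
have [N0 N00 HN0] := eventually_expDn_le d (2 * Q) e0.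
pose M := (N0 + 2 * Q)%N.
pose B : {set {ffun 'I_d -> 'I_M}} := finset (fun x : {ffun 'I_d -> 'I_M} => [forall
  i, (Q <= x i < Q + N0)%N]).
have cB : #|B| = (N0 ^ d)%N.
  rewrite (@card_box_fit d M (fun=> Q) (fun=> (Q + N0)%N)); last by move=> i;
    rewrite /M; lia.
  by rewrite (eq_bigr (fun=> N0)) ?prod_nat_const ?card_ord// => i _; lia.
have MB : ((M ^ d)%N%:R : R) <= (1 + e) * (N0 ^ d)%N%:R by exact: HN0.
pose gx (x : {ffun 'I_d -> 'I_M}) := gnat R k (fun i => x i : nat).
pose Z w : R := \sum_(x <- enum B) \1_H (theta (gx x) w).
have m1 x : measurable_fun setT (fun w => \1_H (theta (gx x) w) : R).
  have mi : measurable_fun setT (\1_H : Omega -> R) by exact: measurable_indic.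
  exact: (measurableT_comp mi (measurable_theta _)).
have Z0 w : 0 <= Z w by apply: sumr_ge0.
exists M, Z; split => //.
- by rewrite /M addn_gt0 N00.
- by apply: measurable_sum => x; exact: m1.
- have -> : (\int[P]_w (Z w)%:E = \sum_(x <- enum B) P H)%E.
    under eq_integral do rewrite -sumEFin.
    rewrite ge0_integral_sum//; last by move=> x; exact/measurable_EFinP.
    apply: eq_bigr => x _; rewrite (integral_theta (gx x) (f := EFin \o \1_H))//=.
      by rewrite integral_indic// setIT.
    by apply/measurable_EFinP; exact: measurable_indic.
  apply: (@le_trans _ _ (\sum_(x <- enum B) e%:E)%E); first by apply: lee_sum.
  rewrite sumEFin big_const_seq count_predT -cardE cB iter_addr_0 lee_fin -[e *+
    _]mulr_natr.
  apply: (@le_trans _ _ (e * (M ^ d)%N%:R)).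
    by rewrite ler_wpM2l ?(ltW e0)// ler_nat; apply: leq_exp2r_w; rewrite /M leq_addr.
  by rewrite ler_wpM2r// /e; lra.
move=> w.
pose S := finset (fun x : {ffun 'I_d -> 'I_M} => (x \in B) && `[< ~ H (theta (gx x)
  w) >]).
have [|||||x xS j jJ|U tU HU] := @multiscale_cover d M a b (fitting G w) _ _ R (1 +
  e) l L J S.
- exact: card_fitting.
- exact: fitting_center.
- lra.
- exact: ll.
- exact: lL.
- move: xS; rewrite inE => /andP[+ /asboolP nH]; rewrite inE => /forallP xB.
  have [n /andP[ln nL] Gn] : W j (theta (gx x) w).
    by apply: contrapT => nW; apply: nH; exists j.
  exists n; split => //; have nQ : (forall i, (a i + b i) * n <= Q)%N.
    move=> i; rewrite /Q (bigD1 i)//=; apply: leq_trans (leq_addr _ _).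
    rewrite leq_mul2l (leq_trans nL) ?orbT//.
    exact: (@leq_bigmax _ (fun j : 'I_J => L j) (Ordinal jJ)).
  split => //; first exact: leq_trans (l1 j) ln.
  + move=> i; have /andP[Qx _] := xB i; have := nQ i; rewrite mulnDl => h.
    exact: leq_trans (leq_trans (leq_addr _ _) h) Qx.
  + move=> i; have /andP[_ xQ] := xB i; have := nQ i; rewrite mulnDl => h.
    apply: leq_trans (leq_add (ltnW xQ) (leq_trans (leq_addl _ _) h)) _.
    by rewrite -addnA addnCA addnn -mul2n.
exists U => //.
have SB : #|S|%:R = (N0 ^ d)%N%:R - Z w :> R.
  rewrite /Z big_enum/= -cB -!sum1_card !natr_sum -sumrB big_mkcond [RHS]big_mkcond.
  apply: eq_bigr => x _; rewrite inE; case: (x \in B) => //=.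
  rewrite indicE; case: asboolP => h; first by rewrite memNset ?subr0.
  by rewrite mem_set ?subrr//; exact: contrapT.
rewrite SB in HU.
have S0 : 0 <= (N0 ^ d)%N%:R - Z w by rewrite -SB.
set q := (1 - _) ^+ J in HU HJ.
set u := (#|U|%:R) in HU *.
set N := (N0 ^ d)%N%:R in HU MB S0.
set m := (M ^ d)%N%:R in MB *.
have h1 : (1 - e) * (N - Z w) <= (1 + e) * u.
  apply: le_trans HU; rewrite ler_wpM2r//; lra.
have h2 : kappa * m <= (1 - 4 * e) * ((1 + e) * N).
  by rewrite (_ : 1 - 4 * e = kappa); [rewrite ler_wpM2l// ltW|rewrite /e; lra].
have N00' : 0 <= N by [].
have := Z0 w; have e4 : e <= 1 by rewrite /e; lra.
rewrite -(ler_pM2l (_ : 0 < 1 + e)); last lra.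
have h3 : (1 + e) * (kappa * m) <= (1 + e) * ((1 - 4 * e) * ((1 + e) * N)).
  by rewrite ler_wpM2l//; lra.
have : (1 + e) * ((1 - 4 * e) * ((1 + e) * N)) <= (1 - e) * N.
  have -> : (1 + e) * ((1 - 4 * e) * ((1 + e) * N)) = (1 - 2 * e - 7 * e ^+ 2 - 4 * e
    ^+ 3) * N by ring.
  have : 0 <= e ^+ 2 by exact: sqr_ge0.
  have : 0 <= e ^+ 3 by rewrite exprn_ge0// ltW.
  by move=> ? ?; rewrite ler_wpM2r//; lra.
nra.
Qed.

End stationary_events.

(** * Bounds on the limsup and the liminf of box averages *)

Section mean_bounds.
Context (R : realType) (d : nat) (k : group_kind).
Context (dO : measure_display) (Omega : measurableType dO) (P : probability Omega R).
Context (theta : acting_group R d k -> Omega -> Omega) (V : 'M[R]_d).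
Context (mu : Omega -> lfmeasure R d).
Hypothesis uV : V \in unitmx.
Hypothesis act : is_action theta.
Hypothesis stat : stationary P theta.
Hypothesis mmu : measurable_fun [set: Omega] (mu : Omega -> borel_lf R d).
Hypothesis cov : forall (w : Omega) (g : acting_group R d k) (A : set (borel_cV R d)),
  measurable A -> mu (theta g w) A = translate V g (mu w) A.

Lemma mu_theta_vbox g w p q : mu (theta g w) (vbox V p q) =
  mu w (vbox V (fun i => p i + group_emb g i 0) (fun i => q i + group_emb g i 0)).
Proof. by rewrite cov ?/translate ?image_tau//; exact: measurable_vbox. Qed.

Lemma mu_vbox_fin w p q : mu w (vbox V p q) \is a fin_num.
Proof. rewrite ge0_fin_numE//; exact: (vbox_lty uV _ _ (lf_locally_finite _)). Qed.

Definition mass w p q : R := fine (mu w (vbox V p q)).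

Lemma mass_ge0 w p q : 0 <= mass w p q.
Proof. exact: fine_ge0. Qed.

Lemma EFin_mass w p q : (mass w p q)%:E = mu w (vbox V p q).
Proof. by rewrite fineK// mu_vbox_fin. Qed.

Lemma le_mass w p q p' q' : (forall i, p' i <= p i) -> (forall i, q i <= q' i) ->
  mass w p q <= mass w p' q'.
Proof.
move=> pp qq; rewrite -lee_fin !EFin_mass; apply: le_measure; rewrite ?inE.
- exact: measurable_vbox.
- exact: measurable_vbox.
- exact: subset_vbox.
Qed.

Lemma measurable_mass p q : measurable_fun setT (fun w => mass w p q).
Proof.
apply/measurable_EFinP; rewrite (_ : _ \o _ = fun w => mu w (vbox V p q)).
  exact: measurable_eval_vbox.
by apply/funext => w; rewrite /= EFin_mass.
Qed.

Lemma mass_theta g w p q : mass (theta g w) p q =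
  mass w (fun i => p i + group_emb g i 0) (fun i => q i + group_emb g i 0).
Proof. by rewrite /mass mu_theta_vbox. Qed.

Context (m : R).
Hypothesis Em : (\int[P]_w mu w (cell V) = m%:E)%E.

Local Notation cellmass w := (mass w (fun=> 0) (fun=> 1)).

Lemma integral_cellmass : (\int[P]_w (cellmass w)%:E = m%:E)%E.
Proof. by rewrite -Em; apply: eq_integral => w _; rewrite EFin_mass -cell_vbox. Qed.

Context (a b : 'I_d -> nat).
Hypothesis b0 : forall i, (0 < b i)%N.

Definition boxmass (n : nat) (w : Omega) : R :=
  mass w (fun i => - (a i * n)%:R) (fun i => (b i * n)%:R).

(** Volume counted in cells. Accordingly [m] is the mean mass of one cell, and division by the
    volume of the cell happens only at the end. *)
Definition boxvol (n : nat) : R := (\prod_i (a i + b i) * n ^ d)%N%:R.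

Lemma mass_gcell M w (y : {ffun 'I_d -> 'I_M}) :
  mass w (fun i => 0 + 1 * (y i)%:R) (fun i => 0 + 1 * (y i).+1%:R) =
  cellmass (theta (gnat R k (fun i => y i : nat)) w).
Proof.
rewrite mass_theta; congr (mass w); apply/funext => i;
  by rewrite group_emb_gnat ?natr1 -?(natr1 (y i)) mul1r ?add0r// addrC.
Qed.

(** By covariance the cell at [y] seen from [w] is the unit cell seen from the shifted point. The
    cells indexed by a fitting box partition a parallelepiped, so discrete sums become box
    masses. *)
Lemma sum_cellmass_lbox M w G (x : {ffun 'I_d -> 'I_M}) n : fitting theta a b G w x n ->
  \sum_(y in lbox a b x n) cellmass (theta (gnat R k (fun i => y i : nat)) w) =
  boxmass n (theta (gnat R k (fun i => x i : nat)) w).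
Proof.
move=> [n0 _ ax bx]; apply/EFin_inj; rewrite -sumEFin /boxmass mass_theta EFin_mass.
under eq_bigr do rewrite -mass_gcell EFin_mass.
have := @measure_vbox_gcell R d M V (fun=> 0) 1 ltr01 (mu w)
  (fun i => x i - a i * n)%N (fun i => x i + b i * n)%N bx.
have -> : vbox V (fun i => 0 + 1 * (x i - a i * n)%N%:R) (fun i => 0 + 1 * (x i + b i
  * n)%N%:R)
   = vbox V (fun i : 'I_d => - (a i * n)%:R + group_emb (gnat R k (fun i0 : 'I_d => x
     i0 : nat)) i 0)
  (fun i : 'I_d => (b i * n)%:R + group_emb (gnat R k (fun i0 : 'I_d => x i0 : nat))
    i 0).
  congr vbox; apply/funext => i; rewrite group_emb_gnat add0r mul1r.
    by rewrite natrB// addrC.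
  by rewrite natrD addrC.
move=> ->; apply: eq_bigl => y; rewrite inE; apply: eq_forallb => i.
by have := ax i; lia.
Qed.

Lemma integral_cellmass_theta g : (\int[P]_w (cellmass (theta g w))%:E = m%:E)%E.
Proof.
rewrite -integral_cellmass (integral_theta act stat g (f := fun w => (cellmass
  w)%:E))//.
- by apply/measurable_EFinP; exact: measurable_mass.
- by move=> w; rewrite lee_fin mass_ge0.
Qed.

Lemma mean_ge0 : 0 <= m.
Proof. by rewrite -lee_fin -Em; exact: integral_ge0. Qed.

Lemma measurable_cellmass_theta g : measurable_fun setT (fun w => cellmass (theta g w)).
Proof.
exact: (measurableT_comp (measurable_mass (fun=> 0) (fun=> 1)) (measurable_theta act
  g)).
Qed.

Section limsup_bound.
Variable c : R.
Hypothesis c0 : 0 <= c.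

(** Over the tiles the cell masses add up to at least [c * #|U|]. Taking expectations over the whole
    cube, with [#|U| >= kappa M^d - Z] and [E Z <= (1 - kappa) M^d], gives [c (2 kappa - 1) <= m]
    for every [kappa < 1]. *)
Lemma le_mean_limsup (G := fun n => [set w | c * boxvol n <= boxmass n w]) :
  (forall l, P (\bigcup_(n in [set n | (l <= n)%N]) G n) = 1%E) -> c <= m.
Proof.
move=> Gio.
have mG n : measurable (G n).
  rewrite /G -[X in measurable X]setTI.
  have -> : [set w | c * boxvol n <= boxmass n w] = (boxmass n) @^-1` `[c * boxvol n,
    +oo[%classic.
    by apply/seteqP; split => w /=; rewrite in_itv/= andbT.
  by apply: measurable_mass.
have key kappa : 0 < kappa < 1 -> c * (2 * kappa - 1) <= m.
  move=> kk; have [M [Z [M0 mZ Z0 EZ HU]]] := stationary_cover act stat a b0 mG Gio kk.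
  pose T : finType := {ffun 'I_d -> 'I_M}.
  have Md : 0 < (M ^ d)%N%:R :> R by rewrite ltr0n expn_gt0 M0.
  have pt w : c * kappa * (M ^ d)%N%:R <= \sum_(y : T) cellmass (theta (gnat R k (fun
    i => y i : nat)) w) + c * Z w.
    have [U tU cU] := HU w.
    have cUs : c * #|U|%:R <= \sum_(y in U) cellmass (theta (gnat R k (fun i => y i :
      nat)) w).
      apply: (tiled_sum_ge tU) => x n Gx; rewrite (sum_cellmass_lbox Gx)
        (card_fitting Gx); by case: Gx.
    rewrite -lerBlDr.
    apply: (@le_trans _ _ (c * #|U|%:R)); first by rewrite -mulrA -mulrBr ler_wpM2l.
    apply: le_trans cUs _; rewrite [leRHS](bigID (mem U))/= lerDl;
      apply: sumr_ge0 => y _; exact: mass_ge0.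
  have : ((c * kappa * (M ^ d)%N%:R)%:E <= ((M ^ d)%N%:R * m)%:E + c%:E * ((1 -
    kappa) * (M ^ d)%N%:R)%:E)%E.
    rewrite -[leLHS]mule1 -(@probability_setT _ _ _ P) -integral_cst//.
    apply: (@le_trans _ _ (\int[P]_w ((\sum_(y : T) cellmass (theta (gnat R k (fun i
      => y i : nat)) w))%:E + (c * Z w)%:E))%E).
      apply: ge0_le_integral => //.
      - by move=> w _; rewrite lee_fin !mulr_ge0// ltW//; case/andP: kk.
      - apply: emeasurable_funD; apply/measurable_EFinP.
          apply: measurable_sum => y; exact: measurable_cellmass_theta.
        by apply: measurable_funM.
      - by move=> w _; rewrite lee_fin.
    rewrite ge0_integralD//=; last 4 first.
    - by move=> w _; rewrite lee_fin; apply: sumr_ge0 => y _; exact: mass_ge0.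
    - by apply/measurable_EFinP; apply: measurable_sum => y;
        exact: measurable_cellmass_theta.
    - by move=> w _; rewrite lee_fin mulr_ge0.
    - by apply/measurable_EFinP; apply: measurable_funM.
    apply: leeD.
      under eq_integral do rewrite -sumEFin.
      rewrite ge0_integral_sum//; last 2 first.
      - by move=> y; apply/measurable_EFinP; exact: measurable_cellmass_theta.
      - by move=> y w _; rewrite lee_fin mass_ge0.
      under eq_bigr do rewrite integral_cellmass_theta.
      rewrite sumEFin sumr_const card_ffun !card_ord mulr_natl//.
    under eq_integral do rewrite EFinM.
    rewrite ge0_integralZl//; last 2 first.
    - exact/measurable_EFinP.
    - by move=> w _; rewrite lee_fin.
    by apply: lee_wpmul2l => //; rewrite lee_fin.
  rewrite -EFinM -EFinD lee_fin => h.
  rewrite -(ler_pM2r Md); nra.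
have [->//|cn] := eqVneq c 0; first exact: mean_ge0.
rewrite leNgt; apply/negP => mc.
have cp : 0 < c by rewrite lt_neqAle eq_sym cn.
(* Chosen to make [c (2 kappa - 1)] the midpoint of [m] and [c]. *)
pose kappa := 1 - (c - m) / (4 * c).
have kE : c * (2 * kappa - 1) = c - (c - m) / 2 by rewrite /kappa; field; lra.
have m0 := mean_ge0.
have : 0 < kappa < 1.
  rewrite /kappa; have : 0 < (c - m) / (4 * c) by rewrite divr_gt0//; lra.
  have : (c - m) / (4 * c) <= 1 / 4 by rewrite ler_pdivrMr; lra.
  by move=> ? ?; apply/andP; split; lra.
by move=> /key; rewrite kE; lra.
Qed.

End limsup_bound.

(* The mass of an uncovered cell is at most [(f - K)^+ + K], whose first term has a
   small mean by integrability and whose second is multiplied by the small number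
   of uncovered cells. *)
Section liminf_bound.
Variable c : R.
Hypothesis c0 : 0 <= c.

Let exc (K : R) (w : Omega) : R := Num.max (cellmass w - K) 0.

Let exc_ge0 K w : 0 <= exc K w.
Proof. by rewrite /exc le_max lexx orbT. Qed.

Let measurable_exc K : measurable_fun setT (exc K).
Proof.
apply: measurable_maxr => //; apply: measurable_funB => //.
exact: measurable_mass.
Qed.

Let exc_small (e : R) : 0 < e -> exists2 K : R, 0 <= K & (\int[P]_w (exc K w)%:E <=
  e%:E)%E.
Proof.
move=> e0.
have [] := @dominated_convergence _ _ _ P setT measurableT
  (fun n w => (exc n%:R w)%:E) (cst 0%E) (fun w => (cellmass w)%:E).
- by move=> n; exact/measurable_EFinP.
- exact: measurable_cst.
- apply/aeW => w _; apply: cvg_near_cst; near=> n.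
  rewrite /exc max_r// subr_le0; near: n; exact: nbhs_infty_ger.
- apply/integrableP; split; first by apply/measurable_EFinP; exact: measurable_mass.
  under eq_integral do rewrite gee0_abs ?lee_fin ?mass_ge0//.
  by rewrite integral_cellmass ltry.
- apply/aeW => w n _; rewrite gee0_abs ?lee_fin// /exc ge_max mass_ge0 andbT.
  by rewrite gerBl.
move=> _ _; rewrite integral_cst// mul0e => cv.
have [N _ /(_ N (leqnn _)) HN] : \forall n \near \oo,
  ((\int[P]_w (exc n%:R w)%:E < e%:E)%E : Prop).
  apply: (cv [set x | (x < e%:E)%E]); apply: open_nbhs_nbhs; split.
    exact: open_ereal_lt_ereal.
  by rewrite /= lte_fin.
by exists N%:R => //; exact: ltW.
Unshelve. all: by end_near. Qed.

Lemma liminf_le_mean (G := fun n => [set w | boxmass n w <= c * boxvol n]) :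
  (forall l, P (\bigcup_(n in [set n | (l <= n)%N]) G n) = 1%E) -> m <= c.
Proof.
move=> Gio.
have mG n : measurable (G n).
  rewrite /G -[X in measurable X]setTI.
  have -> : [set w | boxmass n w <= c * boxvol n] = (boxmass n) @^-1` `]-oo,
    c * boxvol n]%classic.
    by apply/seteqP; split => w /=; rewrite in_itv/=.
  by apply: measurable_mass.
have key kappa K e : 0 < kappa < 1 -> 0 <= K -> (\int[P]_w (exc K w)%:E <= e%:E)%E ->
    m <= c + e + 2 * K * (1 - kappa).
  move=> kk K0 Ke; have [M [Z [M0 mZ Z0 EZ HU]]] := stationary_cover act stat a b0 mG
    Gio kk.
  have k1 : 0 <= 1 - kappa by case/andP: kk => _ /ltW; rewrite subr_ge0.
  pose T : finType := {ffun 'I_d -> 'I_M}.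
  pose th (y : T) := theta (gnat R k (fun i => y i : nat)).
  have Md : 0 < (M ^ d)%N%:R :> R by rewrite ltr0n expn_gt0 M0.
  have cT : #|T| = (M ^ d)%N by rewrite card_ffun !card_ord.
  have mexc y : measurable_fun setT (fun w => exc K (th y w)).
    exact: (measurableT_comp (measurable_exc K) (measurable_theta act _)).
  have iexc y : (\int[P]_w (exc K (th y w))%:E <= e%:E)%E.
    apply: le_trans Ke; rewrite /th (integral_theta act stat _ (f := fun w => (exc K
      w)%:E))//.
      exact/measurable_EFinP.
    by move=> w; rewrite lee_fin.
  have pt w : \sum_(y : T) cellmass (th y w) <=
      (c + K * (1 - kappa)) * (M ^ d)%N%:R + K * Z w + \sum_(y : T) exc K (th y w).
    have [U tU cU] := HU w.
    have cUs : \sum_(y in U) cellmass (th y w) <= c * #|U|%:R.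
      rewrite -lerN2 -mulNr -sumrN; apply: (tiled_sum_ge tU) => x n Gx.
      rewrite sumrN (sum_cellmass_lbox Gx) (card_fitting Gx) mulNr lerN2; by case: Gx.
    have UT : #|U|%:R <= (M ^ d)%N%:R :> R by rewrite -cT ler_nat max_card.
    (* At most [(1 - kappa) M^d + Z] cells are uncovered, a number of mean at most
       [2 (1 - kappa) M^d]; this is the origin of the term [2 * K * (1 - kappa)]. *)
    have cUC : \sum_(y | y \notin U) cellmass (th y w) <=
        \sum_(y : T) exc K (th y w) + K * ((M ^ d)%N%:R - #|U|%:R).
      apply: (@le_trans _ _ (\sum_(y | y \notin U) (exc K (th y w) + K))).
        apply: ler_sum => y _; rewrite -lerBlDr /exc le_max lexx //.
      rewrite big_split/= lerD//.
        by rewrite [leRHS](bigID (mem U))/= lerDr; apply: sumr_ge0.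
      rewrite sumr_const -[K *+ _]mulr_natr ler_wpM2l//.
      rewrite -cT -(cardC (mem U)) natrD addrAC subrr add0r//.
    rewrite (bigID (mem U))/=.
    have : c * #|U|%:R <= c * (M ^ d)%N%:R by rewrite ler_wpM2l.
    have : K * ((M ^ d)%N%:R - #|U|%:R) <= K * ((1 - kappa) * (M ^ d)%N%:R + Z w).
      by rewrite ler_wpM2l//; lra.
    by lra.
  pose A := (c + K * (1 - kappa)) * (M ^ d)%N%:R.
  have A0 : 0 <= A by rewrite /A mulr_ge0 ?addr_ge0 ?mulr_ge0 // ltW.
  have : (((M ^ d)%N%:R * m)%:E <= A%:E + K%:E * ((1 - kappa) * (M ^ d)%N%:R)%:E +
    ((M ^ d)%N%:R * e)%:E)%E.
    apply: (@le_trans _ _ (\int[P]_w (\sum_(y : T) cellmass (th y w))%:E)%E).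
      under eq_integral do rewrite -sumEFin.
      rewrite ge0_integral_sum//; last 2 first.
      - by move=> y; apply/measurable_EFinP; exact: measurable_cellmass_theta.
      - by move=> y w _; rewrite lee_fin mass_ge0.
      under eq_bigr do rewrite integral_cellmass_theta.
      by rewrite sumEFin sumr_const cT mulr_natl.
    apply: (@le_trans _ _ (\int[P]_w (A%:E + (K * Z w)%:E + (\sum_(y : T) exc K (th y
      w))%:E))%E).
      apply: ge0_le_integral => //.
      - by move=> w _; rewrite lee_fin; apply: sumr_ge0 => y _; exact: mass_ge0.
      - by apply/measurable_EFinP; apply: measurable_sum => y;
          exact: measurable_cellmass_theta.
      - apply: emeasurable_funD; last by apply/measurable_EFinP;
          apply: measurable_sum => y; exact: mexc.
        by apply: emeasurable_funD => //; apply/measurable_EFinP;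
          apply: measurable_funM.
      - by move=> w _; rewrite lee_fin.
    rewrite ge0_integralD//=; last 4 first.
    - by move=> w _; rewrite lee_fin addr_ge0// mulr_ge0.
    - by apply: emeasurable_funD => //; apply/measurable_EFinP; apply: measurable_funM.
    - by move=> w _; rewrite lee_fin; apply: sumr_ge0.
    - by apply/measurable_EFinP; apply: measurable_sum => y; exact: mexc.
    rewrite ge0_integralD//=; last 2 first.
    - by move=> w _; rewrite lee_fin mulr_ge0.
    - by apply/measurable_EFinP; apply: measurable_funM.
    have -> : (\int[P]_w A%:E = A%:E)%E by rewrite integral_cst//= probability_setT
      mule1.
    apply: leeD; first apply: leeD => //.
      under eq_integral do rewrite EFinM.
      rewrite ge0_integralZl//; last 2 first.
      - exact/measurable_EFinP.
      - by move=> w _; rewrite lee_fin.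
      by apply: lee_wpmul2l => //; rewrite lee_fin.
    under eq_integral do rewrite -sumEFin.
    rewrite ge0_integral_sum//; last 2 first.
    - by move=> y; apply/measurable_EFinP; exact: mexc.
    - by move=> y w _; rewrite lee_fin.
    apply: (@le_trans _ _ (\sum_(y : T) e%:E)%E); first by apply: lee_sum => y _;
      exact: iexc.
    by rewrite sumEFin sumr_const cT mulr_natl.
  rewrite -EFinM -!EFinD lee_fin /A => h.
  rewrite -(ler_pM2l Md); lra.
apply/ler_addgt0Pr => e e0.
have e20 : 0 < e / 2 by lra.
have [K K0 Ke] := exc_small e20.
(* With [kappa = 1 - eta] this gives [2 K eta <= e / 2] and keeps [kappa] strictly between 0 and 1;
   [K + 1] avoids a division by 0. *)
pose eta := Num.min (1 / 2) (e / (4 * (K + 1))).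
have eta0 : 0 < eta by rewrite /eta lt_min; apply/andP; split;
  [lra|rewrite divr_gt0//; lra].
have eta1 : eta <= 1 / 2 by rewrite /eta ge_min lexx.
have etaK : eta * (4 * (K + 1)) <= e.
  by rewrite -ler_pdivlMr; [rewrite /eta ge_min lexx orbT|lra].
have := key (1 - eta) K (e / 2); rewrite (_ : 0 < 1 - eta < 1); last by apply/andP;
  split; lra.
move=> /(_ isT K0 Ke)/le_trans; apply; nra.
Qed.

End liminf_bound.

End mean_bounds.

(** * The invariant set of full probability *)

Lemma inv_doubleS_le (R : numFieldType) j :
  ((2 * j.+1).+1%:R : R)^-1 <= j.+1%:R^-1 / 2.
Proof. by rewrite -invfM lef_pV2 ?posrE ?mulr_gt0// mulrC -natrM ler_nat; lia. Qed.

Section invariant_events.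
Context (R : realType) (d : nat) (k : group_kind).
Context (dO : measure_display) (Omega : measurableType dO) (P : probability Omega R).
Context (theta : acting_group R d k -> Omega -> Omega) (V : 'M[R]_d).
Context (mu : Omega -> lfmeasure R d).
Hypothesis uV : V \in unitmx.
Hypothesis act : is_action theta.
Hypothesis stat : stationary P theta.
Hypothesis erg : ergodic P theta.
Hypothesis mmu : measurable_fun [set: Omega] (mu : Omega -> borel_lf R d).
Hypothesis cov : forall (w : Omega) (g : acting_group R d k) (A : set (borel_cV R d)),
  measurable A -> mu (theta g w) A = translate V g (mu w) A.
Context (m : R).
Hypothesis Em : (\int[P]_w mu w (cell V) = m%:E)%E.

Lemma invariant_setP (A : set Omega) :
  (forall g w, A w -> A (theta g w)) -> invariant_set theta A.
Proof.
case: act => t0 tD _ HA g; apply/seteqP; split => [_ [w Aw <-]|w Aw]; first exact: HA.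
by exists (theta (- g) w); [exact: HA|rewrite tD subrr t0].
Qed.

Lemma invariant_setC (A : set Omega) : invariant_set theta A -> invariant_set theta
  (~` A).
Proof.
case: act => t0 tD _ HA; apply: invariant_setP => g w nAw /= Agw; apply: nAw.
rewrite -(HA (- g)); exists (theta g w) => //.
by rewrite tD addNr t0.
Qed.

Lemma invariant_bigcup (F : nat -> set Omega) : (forall n, invariant_set theta (F n)) ->
  invariant_set theta (\bigcup_n F n).
Proof.
move=> HF; apply: invariant_setP => g w [n _ Fw]; exists n => //.
by rewrite -(HF n g); exists w.
Qed.

Section shape.
Context (a b : 'I_d -> nat).
Hypothesis a0 : forall i, (0 < a i)%N.
Hypothesis b0 : forall i, (0 < b i)%N.
Local Notation bmass := (boxmass V mu a b).
Local Notation bvol := (@boxvol R d a b).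

Lemma boxvol_ge0 n : 0 <= bvol n.
Proof. by []. Qed.

(* The slack [1 / (j + 1)] absorbs the change of box under a translation, which
   makes these events exactly invariant. *)
Definition limsup_ge (c : R) : set Omega :=
  \bigcap_j \bigcap_l \bigcup_(n in [set n | (l <= n)%N])
    [set w | (c - j.+1%:R^-1) * bvol n <= bmass n w].

Definition liminf_le (c : R) : set Omega :=
  \bigcap_j \bigcap_l \bigcup_(n in [set n | (l <= n)%N])
    [set w | bmass n w <= (c + j.+1%:R^-1) * bvol n].

Lemma measurable_boxmass n : measurable_fun setT (bmass n).
Proof. exact: measurable_mass. Qed.

Lemma measurable_boxmass_ge n c : measurable [set w | c <= bmass n w].
Proof.
rewrite -[X in measurable X]setTI.
have -> : [set w | c <= bmass n w] = bmass n @^-1` `[c, +oo[%classic.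
  by apply/seteqP; split => w /=; rewrite in_itv/= andbT.
exact: measurable_boxmass.
Qed.

Lemma measurable_boxmass_le n c : measurable [set w | bmass n w <= c].
Proof.
rewrite -[X in measurable X]setTI.
have -> : [set w | bmass n w <= c] = bmass n @^-1` `]-oo, c]%classic.
  by apply/seteqP; split => w /=; rewrite in_itv/=.
exact: measurable_boxmass.
Qed.

Lemma measurable_limsup_ge c : measurable (limsup_ge c).
Proof.
apply: bigcapT_measurable => j; apply: bigcapT_measurable => l.
apply: bigcup_measurable => n _.
exact: measurable_boxmass_ge.
Qed.

Lemma measurable_liminf_le c : measurable (liminf_le c).
Proof.
apply: bigcapT_measurable => j; apply: bigcapT_measurable => l.
apply: bigcup_measurable => n _.
exact: measurable_boxmass_le.
Qed.

(** Here the origin has to be interior to the shape: as all [a i] and [b i] are at least 1, raising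
    the scale by [p] moves every face outwards by at least [p], which exceeds the coordinates of [g]
    and so swallows the shift. *)
Lemma boxmass_theta g : exists p, forall n w,
  bmass n w <= bmass (n + p) (theta g w) /\ bmass n (theta g w) <= bmass (n + p) w.
Proof.
pose r : R := \sum_i `|group_emb g i 0|.
have gr i : `|group_emb g i 0| <= r by rewrite /r (bigD1 i)//= lerDl sumr_ge0.
pose p := Num.bound r.
have rp : r <= p%:R by apply/ltW/archi_boundP; apply: sumr_ge0.
have ap i : `|group_emb g i 0| <= (a i * p)%:R.
  by rewrite (le_trans (gr i))// (le_trans rp)// ler_nat leq_pmull.
have bp i : `|group_emb g i 0| <= (b i * p)%:R.
  by rewrite (le_trans (gr i))// (le_trans rp)// ler_nat leq_pmull.
exists p => n w; rewrite /boxmass !(mass_theta uV cov).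
by split; apply: le_mass => // i; have := ap i; have := bp i;
  rewrite !ler_norml !mulnDr !natrD => /andP[? ?] /andP[? ?]; lra.
Qed.

Lemma boxvolD_le p (e : R) : 0 < e ->
  exists l, forall n, (l <= n)%N -> bvol (n + p) <= (1 + e) * bvol n.
Proof.
move=> e0; have [l _ Hl] := eventually_expDn_le d p e0.
exists l => n ln; rewrite /boxvol !natrM mulrCA.
by apply: ler_wpM2l; rewrite ?Hl.
Qed.

(** The slack [e] of level [j] is split in halves: one covers the slack of the level [2 * j.+1] at
    which [w] is used, the other pays for the growth of the volume by [1 + t], where
    [c * t = e / 2]. *)
Lemma invariant_limsup_ge c : invariant_set theta (limsup_ge c).
Proof.
apply: invariant_setP => g w Hw j _ l _; have [p Hp] := boxmass_theta g.
set e := j.+1%:R^-1.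
have e0 : 0 < e by rewrite invr_gt0.
(* A non-positive threshold is met by every box, masses being non-negative. *)
have [ce|ce] := leP (c - e) 0.
  exists l; rewrite /mkset ?leqnn// (le_trans _ (mass_ge0 _ _ _ _ _))//.
  by rewrite mulr_le0_ge0// boxvol_ge0.
pose t := e / 2 / c.
have c0 : 0 < c by lra.
have t0 : 0 < t by rewrite !divr_gt0.
have [l0 Hl0] := boxvolD_le p t0.
have [n /= ln Hn] := Hw (2 * j.+1)%N Logic.I (maxn l l0) Logic.I.
move: ln; rewrite geq_max => /andP[ln l0n].
exists (n + p)%N => /=; first exact: leq_trans ln (leq_addr _ _).
apply: le_trans (Hp n w).1; apply: le_trans Hn.
apply: (@le_trans _ _ ((c - e) * ((1 + t) * bvol n))).
  by rewrite ler_wpM2l ?Hl0// ltW.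
rewrite mulrA ler_wpM2r ?boxvol_ge0//.
have je : (2 * j.+1).+1%:R^-1 <= e / 2 by exact: inv_doubleS_le.
have ct : c * t = e / 2 by rewrite /t; field; lra.
have et : 0 <= e * t by rewrite mulr_ge0 ?ltW.
rewrite (_ : (c - e) * (1 + t) = c - e + c * t - e * t); last by ring.
rewrite ct; move: (_^-1) je => z; lra.
Qed.

Lemma invariant_liminf_le c : 0 <= c -> invariant_set theta (liminf_le c).
Proof.
move=> c0; apply: invariant_setP => g w Hw j _ l _; have [p Hp] := boxmass_theta g.
set e := j.+1%:R^-1.
have e0 : 0 < e by rewrite invr_gt0.
have e1 : e <= 1 by rewrite /e invf_le1// ler1n.
(* Now [c * t + t = e / 2], where the extra [t] absorbs the product of [t] with the slack of the
   finer level. *)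
pose t := e / 2 / (c + 1).
have t0 : 0 < t by rewrite !divr_gt0//; lra.
have [l0 Hl0] := boxvolD_le p t0.
(* The box of [w] at scale [n] controls the box of the shifted point at scale [n - p], so [n] has to
   exceed the required bounds by [p]. *)
have [n /= ln Hn] := Hw (2 * j.+1)%N Logic.I (maxn l l0 + p)%N Logic.I.
have pn : (p <= n)%N by apply: leq_trans ln; exact: leq_addl.
have [lm l0m] : (l <= n - p)%N /\ (l0 <= n - p)%N.
  have : (maxn l l0 <= n - p)%N by rewrite leq_subRL// addnC.
  by rewrite geq_max => /andP[].
exists (n - p)%N => //=.
apply: le_trans (Hp (n - p)%N w).2 _; rewrite subnK//.
apply: le_trans Hn _.
have := Hl0 _ l0m; rewrite subnK// => Hv.
have e'0 : 0 <= ((2 * j.+1).+1%:R : R)^-1 by [].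
apply: (@le_trans _ _ ((c + (2 * j.+1).+1%:R^-1) * ((1 + t) * bvol (n - p)))).
  by rewrite ler_wpM2l// addr_ge0.
rewrite mulrA ler_wpM2r ?boxvol_ge0//.
have je : (2 * j.+1).+1%:R^-1 <= e / 2 by exact: inv_doubleS_le.
have ct : c * t + t = e / 2 by rewrite /t; field; lra.
have et : (2 * j.+1).+1%:R^-1 * t <= 1 * t.
  by rewrite ler_wpM2r ?(ltW t0)//; apply: le_trans je _; lra.
rewrite mulrDr mulr1 mulrDl; move: (_^-1) je et => z; lra.
Qed.

(** By ergodicity the only alternative is probability 1. Then boxes of average at least
    [c - j.+1%:R^-1] occur almost surely at arbitrarily large scales, and for large [j] this
    contradicts [le_mean_limsup]. *)
Lemma probability_limsup_ge c : m < c -> P (limsup_ge c) = 0%E.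
Proof.
move=> mc; case: (erg (measurable_limsup_ge c) (invariant_limsup_ge c)) => // P1.
have m0 := mean_ge0 Em.
pose j := Num.bound ((c - m)^-1).
have cm0 : 0 < c - m by lra.
have jc : j.+1%:R^-1 < c - m.
  rewrite -[ltRHS]invrK ltf_pV2 ?posrE ?invr_gt0//.
  have : 0 <= (c - m)^-1 by rewrite invr_ge0 ltW.
  by move=> /archi_boundP/lt_le_trans; apply; rewrite ler_nat.
have jc' : m < c - j.+1%:R^-1 by rewrite ltrBrDl -ltrBrDr.
suff : c - j.+1%:R^-1 <= m by rewrite leNgt jc'.
  apply: (le_mean_limsup uV act stat mmu cov Em (a := a) b0);
    first exact: le_trans m0 (ltW jc').
move=> l; apply/eqP; rewrite eq_le probability_le1//=; last first.
    apply: bigcup_measurable => n _.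
    exact: measurable_boxmass_ge.
  rewrite -P1; apply: le_measure; rewrite ?inE.
  - exact: measurable_limsup_ge.
  - apply: bigcup_measurable => n _.
    exact: measurable_boxmass_ge.
  - by move=> w Hw; exact: (Hw j Logic.I l Logic.I).
Qed.

Lemma probability_liminf_le c : 0 <= c -> c < m -> P (liminf_le c) = 0%E.
Proof.
move=> c0 cm; case: (erg (measurable_liminf_le c) (invariant_liminf_le c0)) => // P1.
pose j := Num.bound ((m - c)^-1).
have cm0 : 0 < m - c by lra.
have jc : j.+1%:R^-1 < m - c.
  rewrite -[ltRHS]invrK ltf_pV2 ?posrE ?invr_gt0//.
  have : 0 <= (m - c)^-1 by rewrite invr_ge0 ltW.
  by move=> /archi_boundP/lt_le_trans; apply; rewrite ler_nat.
have jc' : c + j.+1%:R^-1 < m by rewrite -ltrBrDl.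
suff : m <= c + j.+1%:R^-1 by rewrite leNgt jc'.
  apply: (liminf_le_mean uV act stat mmu cov Em (a := a) b0); first by rewrite addr_ge0.
  move=> l; apply/eqP; rewrite eq_le probability_le1//=; last first.
    by apply: bigcup_measurable => n _; exact: measurable_boxmass_le.
  rewrite -P1; apply: le_measure; rewrite ?inE.
  - exact: measurable_liminf_le.
  - by apply: bigcup_measurable => n _; exact: measurable_boxmass_le.
  - by move=> w Hw; exact: (Hw j Logic.I l Logic.I).
Qed.

End shape.

(** Rational levels and finite functions to [nat] make the index type countable, so that one null
    set serves every shape; the successors put the origin in the interior of the shape. The levels
    [r = m] and [r < 0] carry no event. *)
Definition exceptional (c : rat * ({ffun 'I_d -> nat} * {ffun 'I_d -> nat})) : set
  Omega :=
  let r : R := ratr c.1 in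
  let a := fun i => (c.2.1 i).+1 in let b := fun i => (c.2.2 i).+1 in
  if m < r then limsup_ge a b r else if 0 <= r < m then liminf_le a b r else set0.

Let exceptional_pickled n := oapp exceptional set0 (unpickle n).

Definition typical : set Omega := ~` \bigcup_n exceptional_pickled n.

Lemma exceptional_subset c : exceptional c `<=` \bigcup_n exceptional_pickled n.
Proof.
move=> w ew; exists (pickle c); first exact: Logic.I.
by rewrite /exceptional_pickled pickleK.
Qed.

Lemma exceptionalP c : [/\ measurable (exceptional c),
  invariant_set theta (exceptional c) &
  P (exceptional c) = 0%E].
Proof.
have i0 : invariant_set theta set0 by apply: invariant_setP.
rewrite /exceptional; case: ifP => [mr|_]; last case: ifP => [/andP[r0 rm]|_];
  split => //.
- exact: measurable_limsup_ge.
- exact: invariant_limsup_ge.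
- exact: probability_limsup_ge.
- exact: measurable_liminf_le.
- exact: invariant_liminf_le.
- exact: probability_liminf_le.
Qed.

Let exceptional_pickledP n : [/\ measurable (exceptional_pickled n),
  invariant_set theta (exceptional_pickled n) & P (exceptional_pickled n) = 0%E].
Proof.
rewrite /exceptional_pickled; case: unpickle => [c|]/=; first exact: exceptionalP.
by split => //; apply: invariant_setP.
Qed.

Lemma measurable_typical : measurable typical.
Proof.
apply: measurableC; apply: bigcupT_measurable => n.
by case: (exceptional_pickledP n).
Qed.

Lemma invariant_typical : invariant_set theta typical.
Proof.
apply: invariant_setC; apply: invariant_bigcup => n.
by case: (exceptional_pickledP n).
Qed.

Lemma probability_typical : P typical = 1%E.
Proof.
have mF n : measurable (exceptional_pickled n) by case: (exceptional_pickledP n).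
have mU : measurable (\bigcup_n exceptional_pickled n) by exact: bigcupT_measurable.
rewrite probability_setC// (_ : P _ = 0%E) ?sube0//.
apply/eqP; rewrite -measure_le0; apply: le_trans (measure_sigma_subadditive _ mF mU
  (@subset_refl _ _)) _.
by rewrite eseries0// => n _ _; case: (exceptional_pickledP n).
Qed.

(** If the upper bound failed at arbitrarily large scales, [w] would belong to [limsup_ge] at a
    rational level between [m] and [m + e], which is an exceptional event; the lower bound is
    symmetric. *)
Lemma typical_boxmass w (a b : 'I_d -> nat) (e : R) : typical w ->
  (forall i, (0 < a i)%N) -> (forall i, (0 < b i)%N) -> 0 < e ->
  exists l, forall n, (l <= n)%N ->
    `|boxmass V mu a b n w - m * @boxvol R d a b n| <= e * @boxvol R d a b n.
Proof.
move=> tw a0 b0 e0.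
have m0 := mean_ge0 Em.
pose c (r : rat) := (r, ([ffun i => (a i).-1], [ffun i => (b i).-1])) : rat * ({ffun
  'I_d -> nat} * {ffun 'I_d -> nat}).
have tr r : ~ exceptional (c r) w.
  by move=> ew; apply: tw; exact: exceptional_subset ew.
have aE : (fun i => ([ffun i => (a i).-1] i).+1) = a.
  by apply/funext => i; rewrite ffunE prednK.
have bE : (fun i => ([ffun i => (b i).-1] i).+1) = b.
  by apply/funext => i; rewrite ffunE prednK.
have [l1 Hl1] : exists l, forall n, (l <= n)%N -> boxmass V mu a b n w <= (m + e) *
  @boxvol R d a b n.
  have /rat_in_itvoo[r] : m < m + e by lra.
  rewrite in_itv/= => /andP[mr re].
  have := tr r; rewrite /exceptional /= aE bE mr => nL.
  apply: contrapT => nl; apply: nL => j _ l _.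
  move/forallNP/(_ l)/existsNP : nl => [n /not_implyP[ln /negP]]; rewrite -ltNge => H.
  exists n => //=; apply: ltW; apply: le_lt_trans H.
  by rewrite ler_wpM2r//; apply: le_trans (ltW re); rewrite gerBl.
have [l2 Hl2] : exists l, forall n, (l <= n)%N -> (m - e) * @boxvol R d a b n <=
  boxmass V mu a b n w.
  (* Here the lower bound is trivial; otherwise the rational level chosen below is non-negative, as
     [exceptional] demands for the liminf. *)
  have [me|me] := leP (m - e) 0.
    exists 0%N => n _; rewrite (le_trans _ (mass_ge0 _ _ _ _ _))//.
    by rewrite mulr_le0_ge0.
  have /rat_in_itvoo[r] : m - e < m by lra.
  rewrite in_itv/= => /andP[er rm].
  have := tr r; rewrite /exceptional /= aE bE ltNge (ltW rm)/= rm andbT.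
  rewrite (_ : 0 <= ratr r) => [nL|]; last lra.
  apply: contrapT => nl; apply: nL => j _ l _.
  move/forallNP/(_ l)/existsNP : nl => [n /not_implyP[ln /negP]]; rewrite -ltNge => H.
  exists n => //=; apply: ltW; apply: lt_le_trans H _.
  by rewrite ler_wpM2r//; apply: le_trans (ltW er) _; rewrite lerDl.
exists (maxn l1 l2) => n; rewrite geq_max => /andP[/Hl1 h1 /Hl2 h2].
rewrite ler_norml; apply/andP; split; lra.
Qed.

End invariant_events.

(** * Limits for general boxes *)

Section truncn_limits.
Context (R : realType).

Lemma cvg_truncn : Num.truncn (N : R) @[N --> +oo%R] --> \oo.
Proof.
move=> A [k _ kA].
suff : \forall N \near +oo%R, A (Num.truncn (N : R)) by [].
near=> N; apply: kA => /=.
have N0 : 0 <= N by near: N; exact: nbhs_pinfty_ge.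
have kN : k%:R <= N by near: N; exact: nbhs_pinfty_ge.
have /andP[_ h] := truncn_itv N0.
by have := le_lt_trans kN h; rewrite ltr_nat ltnS.
Unshelve. all: by end_near. Qed.

Lemma cvg_truncn_ratio (j : nat) : (j <= 1)%N ->
  (Num.truncn (N : R) + j)%:R / N @[N --> +oo%R] --> (1 : R).
Proof.
move=> j1; apply/cvgrPdist_le => e e0; near=> N.
have N1 : 1 <= N by near: N; exact: nbhs_pinfty_ge.
have Ne : e^-1 <= N by near: N; apply: nbhs_pinfty_ge; exact: num_real.
have /andP[n1 n2] := truncn_itv (le_trans ler01 N1).
have Ne' : 1 <= e * N by rewrite -ler_pdivrMl// mulr1.
have -> : 1 - (Num.truncn N + j)%:R / N = (N - (Num.truncn N + j)%:R) / N by field; lra.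
rewrite normrM normfV (gtr0_norm (lt_le_trans ltr01 N1)).
rewrite ler_pdivrMr ?(lt_le_trans ltr01 N1)//.
apply: le_trans Ne'; rewrite ler_norml natrD.
have j0 : 0 <= j%:R :> R by [].
have j1' : j%:R <= 1 :> R by rewrite lern1.
by move: n2; rewrite -natr1 => n2; apply/andP; split; lra.
Unshelve. all: by end_near. Qed.

End truncn_limits.

Section box_limits.
Context (R : realType) (d : nat) (dO : measure_display) (Omega : measurableType dO)
  (V : 'M[R]_d).
Context (mu : Omega -> lfmeasure R d) (w : Omega) (m : R).
Hypothesis uV : V \in unitmx.
Hypothesis boxmass_lim : forall (a b : 'I_d -> nat) (e : R),
  (forall i, (0 < a i)%N) -> (forall i, (0 < b i)%N) -> 0 < e ->
  exists l, forall n, (l <= n)%N ->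
    `|boxmass V mu a b n w - m * @boxvol R d a b n| <= e * @boxvol R d a b n.

Lemma cvg_boxmass (a b : 'I_d -> nat) :
  (forall i, (0 < a i)%N) -> (forall i, (0 < b i)%N) ->
  boxmass V mu a b n w / n%:R ^+ d @[n --> \oo] --> m * (\prod_i (a i + b i))%N%:R.
Proof.
move=> a0 b0; set s := (\prod_i _)%N.
have s0 : 0 < s%:R :> R by rewrite ltr0n prodn_gt0// => i; rewrite addn_gt0 a0.
apply/cvgrPdist_le => e e0; have es0 : 0 < e / s%:R by rewrite divr_gt0.
have [l Hl] := boxmass_lim a0 b0 es0.
near=> n; have n0 : (0 < n)%N by near: n; exact: nbhs_infty_gt.
have nd : 0 < n%:R ^+ d :> R by rewrite exprn_gt0// ltr0n.
have -> : m * s%:R - boxmass V mu a b n w / n%:R ^+ d =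
   (m * s%:R * n%:R ^+ d - boxmass V mu a b n w) / n%:R ^+ d by field; lra.
rewrite normrM normfV (gtr0_norm nd) ler_pdivrMr//.
have : `|boxmass V mu a b n w - m * @boxvol R d a b n| <= e / s%:R * @boxvol R d a b n.
  by apply: Hl; near: n; exact: nbhs_infty_ge.
have -> : @boxvol R d a b n = s%:R * n%:R ^+ d by rewrite /boxvol natrM natrX.
by rewrite (mulrA (e / _)) divfK ?gt_eqF// distrC mulrA.
Unshelve. all: by end_near. Qed.

(** A box around the origin grows with its dilation factor, so a real [N] is squeezed between the
    integer dilations by [truncn N] and [truncn N + 1]. *)
Lemma cvg_mass_around0 (p q : 'I_d -> int) : (forall i, p i < 0 < q i) ->
  mass V mu w (fun i => N * (p i)%:~R) (fun i => N * (q i)%:~R) / N ^+ d @[N -->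
    +oo%R] -->
  m * \prod_i (q i - p i)%:~R.
Proof.
move=> pq; pose a i := `|p i|%N; pose b i := `|q i|%N.
have a0 i : (0 < a i)%N by rewrite absz_gt0; have := pq i; lia.
have b0 i : (0 < b i)%N by rewrite absz_gt0; have := pq i; lia.
have pE i : (p i)%:~R = - (a i)%:R :> R.
  have E : p i = - (a i)%:Z by rewrite /a; have := pq i; lia.
  by rewrite [LHS](congr1 intr E) mulrNz.
have qE i : (q i)%:~R = (b i)%:R :> R.
  have E : q i = (b i)%:Z by rewrite /b; have := pq i; lia.
  by rewrite [LHS](congr1 intr E).
have -> : \prod_i (q i - p i)%:~R = (\prod_i (a i + b i))%N%:R :> R.
  by rewrite natr_prod; apply: eq_bigr => i _; rewrite rmorphB/= pE qE opprK natrD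
    addrC.
set L := m * _.
have f j : (j <= 1)%N -> boxmass V mu a b (Num.truncn N + j) w / N ^+ d @[N -->
  +oo%R] --> L.
  move=> j1.
  have c1 : boxmass V mu a b (n + j) w / (n + j)%:R ^+ d @[n --> \oo] --> L.
    have := cvg_boxmass a0 b0; rewrite -(cvg_shiftn j).
    by under eq_fun do rewrite addnC.
  have c2 := cvg_comp _ _ (@cvg_truncn R) c1.
  have c3 : ((Num.truncn N + j)%:R / N) ^+ d @[N --> +oo%R] --> (1 : R).
    rewrite -[X in _ --> X](expr1n _ d).
    apply: (cvg_comp _ _ (cvg_truncn_ratio j1) (@exprn_continuous _ d 1)).
  have : boxmass V mu a b (Num.truncn N + j) w / (Num.truncn N + j)%:R ^+ d *
      ((Num.truncn N + j)%:R / N) ^+ d @[N --> +oo%R] --> L.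
    by rewrite -[L]mulr1; exact: (cvgM c2 c3).
  apply: cvg_trans; apply: near_eq_cvg.
  near=> N; rewrite /= exprMn mulrA divfK ?exprVn//.
  have N1 : 1 <= N by near: N; exact: nbhs_pinfty_ge.
  rewrite expf_neq0// pnatr_eq0 addn_eq0 negb_and -lt0n truncn_gt0 N1 //.
apply: (@squeeze_cvgr _ _ _ _ (fun N => boxmass V mu a b (Num.truncn N + 0) w / N ^+ d)
   (fun N => boxmass V mu a b (Num.truncn N + 1) w / N ^+ d)); [|exact: f|exact: f].
near=> N; have N1 : 1 <= N by near: N; exact: nbhs_pinfty_ge.
have Nd : 0 <= (N ^+ d)^-1 by rewrite invr_ge0 exprn_ge0//; lra.
have /andP[n1 n2] := truncn_itv (le_trans ler01 N1).
have h0 (x : nat) : (x * (Num.truncn N + 0))%:R <= N * x%:R.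
  by rewrite addn0 mulnC natrM ler_wpM2r.
have h1 (x : nat) : N * x%:R <= (x * (Num.truncn N + 1))%:R.
  by rewrite addn1 mulnC natrM ler_wpM2r// ltW.
by apply/andP; split; rewrite ler_wpM2r//; apply: le_mass => // i;
  rewrite ?pE ?qE ?mulrN ?lerN2.
Unshelve. all: by end_near. Qed.

Definition upd (T : Type) (p : 'I_d -> T) j v i := if i == j then v else p i.

Lemma mass_split (p q : 'I_d -> R) j r : p j <= r <= q j ->
  mass V mu w p q = mass V mu w p (upd q j r) + mass V mu w (upd p j r) q.
Proof.
move=> /andP[pr rq]; apply/EFin_inj; rewrite EFinD !EFin_mass//.
rewrite -measureU; last 3 first.
- exact: measurable_vbox.
- exact: measurable_vbox.
- apply/seteqP; split => // x [/(_ j) + /(_ j)]; rewrite /upd eqxx.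
  by move=> /andP[_ /lt_le_trans h] /andP[/h]; rewrite ltxx.
congr (mu w _); apply/seteqP; split => [x H|x [H|H] i].
- have [xr|rx] := ltP ((invmx V *m (x : 'cV[R]_d)) j 0) r; [left|right] => i;
    have := H i; rewrite /upd.
    by case: eqP => [->|//]; rewrite xr => /andP[->].
  by case: eqP => [->|//]; rewrite rx => /andP[_ ->].
- have := H i; rewrite /upd; case: eqP => [->|//] /andP[-> /lt_le_trans]; exact.
- by have := H i; rewrite /upd; case: eqP => [->|//] /andP[/(le_trans pr) -> ->].
Qed.

(* Induction on the number of coordinates where the box does not straddle 0: such a
   box is the difference of two boxes that do straddle 0 in that coordinate. *)
Lemma cvg_mass_grid (p q : 'I_d -> int) : (forall i, [/\ p i < q i,
  p i != 0 & q i != 0]) ->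
  mass V mu w (fun i => N * (p i)%:~R) (fun i => N * (q i)%:~R) / N ^+ d @[N -->
    +oo%R] -->
  m * \prod_i (q i - p i)%:~R.
Proof.
pose bad (p q : 'I_d -> int) := [pred i | ~~ (p i < 0 < q i)].
have [n] := ubnP #|bad p q|.
elim: n p q => // n ih p q cn pq.
have [/existsP[j jpq]|] := boolP [exists j, ~~ (p j < 0 < q j)]; last first.
  by rewrite negb_exists => /forallP H; apply: cvg_mass_around0 => i; have := H i;
    rewrite negbK.
have less (p' q' : 'I_d -> int) : (forall i, i != j -> p' i = p i /\ q' i = q i) ->
  p' j < 0 < q' j ->
    (#|bad p' q'| < n)%N.
  move=> E Ej; apply: leq_trans (_ : #|bad p q| <= n)%N; last by rewrite -ltnS.
  apply: proper_card; apply/andP; split.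
    apply/fintype.subsetP => i; rewrite !inE; have [->|ij] := eqVneq i j;
      first by rewrite Ej.
    by have [-> ->] := E _ ij.
  by apply/fintype.subsetPn; exists j; rewrite inE//= Ej.
have updE (T : Type) (p' : 'I_d -> T) v : upd p' j v j = v by rewrite /upd eqxx.
have updN (T : Type) (p' : 'I_d -> T) v i : i != j -> upd p' j v i = p' i by rewrite
  /upd => /negbTE ->.
have updM (N : R) (p' : 'I_d -> int) v :
    upd (fun i => N * (p' i)%:~R) j (N * v%:~R) = (fun i => N * (upd p' j v i)%:~R).
  by apply/funext => i; rewrite /upd; case: ifP.
have prodE (p' q' : 'I_d -> int) : (forall i, i != j -> p' i = p i /\ q' i = q i) ->
    \prod_i (q' i - p' i)%:~R = (q' j - p' j)%:~R * \prod_(i | i != j) (q i - p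
      i)%:~R :> R.
  by move=> E; rewrite (bigD1 j)//=; congr (_ * _); apply: eq_bigr => i /E[-> ->].
have updK (T : Type) (p' : 'I_d -> T) v v' : v' = p' j -> upd (upd p' j v) j v' = p'.
  by move=> ->; apply/funext => i; rewrite /upd; case: eqP => [->|].
have okq v : p j < v -> v != 0 -> forall i, [/\ p i < upd q j v i,
  p i != 0 & upd q j v i != 0].
  move=> pv v0 i; have [->|ij] := eqVneq i j; last by rewrite updN//; exact: pq.
  by rewrite updE; have [] := pq j.
have okp v : v < q j -> v != 0 -> forall i, [/\ upd p j v i < q i,
  upd p j v i != 0 & q i != 0].
  move=> pv v0 i; have [->|ij] := eqVneq i j; last by rewrite updN//; exact: pq.
  by rewrite updE; have [] := pq j.
have [pqj pj0 qj0] := pq j.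
(* In coordinate [j], a box on the negative side is the one from [p] to 1 minus the one from [q] to
   1; on the positive side it is the one from -1 to [q] minus the one from -1 to [p]. Since no face
   is at 0, all four straddle 0 strictly. *)
have [pj|pj] := ltP (p j) 0.
  have qj : q j < 0 by rewrite lt_neqAle qj0 leNgt; move: jpq; rewrite pj.
  have ok2 i : [/\ upd p j (q j) i < upd q j 1 i, upd p j (q j) i != 0 & upd q j 1 i
    != 0].
    rewrite /upd; case: eqP => [_|_]; last exact: pq.
    by rewrite qj0; split => //; apply: lt_trans qj _.
  have c1 : mass V mu w (fun i => N * (p i)%:~R) (fun i => N * (upd q j 1 i)%:~R) / N
    ^+ d @[N --> +oo%R] -->
      m * \prod_i (upd q j 1 i - p i)%:~R.
    apply: ih; last by apply: okq => //; lia.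
    by apply: less => [i ij|]; rewrite ?updE ?updN// pj.
  have c2 : mass V mu w (fun i => N * (upd p j (q j) i)%:~R) (fun i => N * (upd q j 1
    i)%:~R) / N ^+ d @[N --> +oo%R] -->
      m * \prod_i (upd q j 1 i - upd p j (q j) i)%:~R.
    apply: ih => //.
    by apply: less => [i ij|]; rewrite ?updE ?updN// qj.
  have PE : \prod_i (upd q j 1 i - p i)%:~R - \prod_i (upd q j 1 i - upd p j (q j)
    i)%:~R = \prod_i (q i - p i)%:~R :> R.
    rewrite !prodE; [|by []|by move=> i ij; rewrite ?updN|by move=> i ij;
      rewrite ?updN].
    by rewrite -mulrBl !updE -mulrzBr; congr (_ *~ _ * _); lia.
  have : mass V mu w (fun i => N * (p i)%:~R) (fun i => N * (upd q j 1 i)%:~R) / N ^+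
    d -
      mass V mu w (fun i => N * (upd p j (q j) i)%:~R) (fun i => N * (upd q j 1
        i)%:~R) / N ^+ d @[N --> +oo%R] -->
      m * \prod_i (q i - p i)%:~R.
    by rewrite -PE mulrBr; exact: (cvgB c1 c2).
  apply: cvg_trans; apply: near_eq_cvg; near=> N.
  have N0 : 0 < N by near: N; exact: nbhs_pinfty_gt.
  rewrite -!mulrBl; congr (_ / _).
  rewrite (@mass_split (fun i => N * (p i)%:~R) (fun i => N * (upd q j 1 i)%:~R) j (N
    * (q j)%:~R)).
    by rewrite !updM updK// addrK.
  by rewrite updE !ler_pM2l// !ler_int; lia.
have {}pj : 0 < p j by rewrite lt_neqAle eq_sym pj0.
have ok2 i : [/\ upd p j (-1) i < upd q j (p j) i, upd p j (-1) i != 0 & upd q j (p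
  j) i != 0].
  rewrite /upd; case: eqP => [_|_]; last exact: pq.
  by rewrite pj0; split => //; apply: lt_trans pj.
have c1 : mass V mu w (fun i => N * (upd p j (-1) i)%:~R) (fun i => N * (q i)%:~R) /
  N ^+ d @[N --> +oo%R] -->
    m * \prod_i (q i - upd p j (-1) i)%:~R.
  apply: ih; last by apply: okp => //; lia.
  by apply: less => [i ij|]; rewrite ?updE ?updN//=; lia.
have c2 : mass V mu w (fun i => N * (upd p j (-1) i)%:~R) (fun i => N * (upd q j (p
  j) i)%:~R) / N ^+ d @[N --> +oo%R] -->
    m * \prod_i (upd q j (p j) i - upd p j (-1) i)%:~R.
  apply: ih => //.
  by apply: less => [i ij|]; rewrite ?updE ?updN.
have PE : \prod_i (q i - upd p j (-1) i)%:~R - \prod_i (upd q j (p j) i - upd p j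
  (-1) i)%:~R = \prod_i (q i - p i)%:~R :> R.
  rewrite !prodE; [|by []|by move=> i ij; rewrite ?updN|by move=> i ij; rewrite ?updN].
  by rewrite -mulrBl !updE -mulrzBr; congr (_ *~ _ * _); lia.
have : mass V mu w (fun i => N * (upd p j (-1) i)%:~R) (fun i => N * (q i)%:~R) / N
  ^+ d -
    mass V mu w (fun i => N * (upd p j (-1) i)%:~R) (fun i => N * (upd q j (p j)
      i)%:~R) / N ^+ d @[N --> +oo%R] -->
    m * \prod_i (q i - p i)%:~R.
  by rewrite -PE mulrBr; exact: (cvgB c1 c2).
apply: cvg_trans; apply: near_eq_cvg; near=> N.
have N0 : 0 < N by near: N; exact: nbhs_pinfty_gt.
rewrite -!mulrBl; congr (_ / _).
rewrite (@mass_split (fun i => N * (upd p j (-1) i)%:~R) (fun i => N * (q i)%:~R) j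
  (N * (p j)%:~R)).
  by rewrite !updM updK// addrC addKr.
by rewrite updE !ler_pM2l// !ler_int; lia.
Unshelve. all: by end_near. Qed.

(** From some scale [l] on, this is the limit taken with error 1; smaller cubes are contained in the
    one of scale [l]. The [N + 1] pays for rounding [N] up to an integer. *)
Lemma mass_growth : exists2 C : R, 0 <= C &
  forall N, 0 <= N -> mass V mu w (fun=> - N) (fun=> N) <= C * (N + 1) ^+ d.
Proof.
have [l Hl] := @boxmass_lim (fun=> 1%N) (fun=> 1%N) 1 (fun=> isT) (fun=> isT) ltr01.
pose s := @boxvol R d (fun=> 1%N) (fun=> 1%N) 1.
pose bm n := boxmass V mu (fun=> 1%N) (fun=> 1%N) n w.
have bmS n n' : (n <= n')%N -> bm n <= bm n'.
  by move=> nn; apply: le_mass => // i; rewrite !mul1n ?lerN2 ler_nat.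
have bm0 n : 0 <= bm n by exact: mass_ge0.
exists (bm l + `|m + 1| * s).
  by rewrite addr_ge0// mulr_ge0// /s /boxvol.
move=> N N0; have /andP[n1 n2] := truncn_itv N0; set n := Num.truncn N in n1 n2.
apply: (@le_trans _ _ (bm n.+1)).
  by apply: le_mass => // i; rewrite !mul1n ?lerN2 ltW.
have nd : (n.+1%:R : R) ^+ d <= (N + 1) ^+ d.
  by rewrite lerXn2r ?nnegrE ?addr_ge0// -natr1 lerD2r.
have C0 : 0 <= bm l + `|m + 1| * s by rewrite addr_ge0// mulr_ge0// /s /boxvol.
apply: le_trans (ler_wpM2l C0 nd).
have n1d : 1 <= (n.+1%:R : R) ^+ d by rewrite exprn_ege1// ler1n.
rewrite mulrDl.
have [ln|nl] := leqP l n.+1; last first.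
  apply: (@le_trans _ _ (bm l)); first exact/bmS/ltnW.
  apply: (@le_trans _ _ (bm l * n.+1%:R ^+ d)); first by rewrite ler_peMr.
  by rewrite lerDl !mulr_ge0// /s /boxvol.
have := Hl _ ln; rewrite mul1r ler_distl => /andP[_ h].
apply: le_trans h _.
have -> : @boxvol R d (fun=> 1%N) (fun=> 1%N) n.+1 = s * n.+1%:R ^+ d.
  by rewrite /s /boxvol exp1n muln1 natrM natrX.
have sn0 : 0 <= s * n.+1%:R ^+ d by rewrite mulr_ge0// /s /boxvol.
rewrite (_ : _ + _ = (m + 1) * (s * n.+1%:R ^+ d)); last by ring.
by apply: le_trans (ler_wpM2r sn0 (ler_norm _)) _; rewrite mulrA lerDr mulr_ge0.
Qed.

End box_limits.

(** * Riemann sums for decaying functions *)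

Section decay.
Context (R : realType) (d : nat) (V : 'M[R]_d).
Hypothesis uV : V \in unitmx.

Definition cube (r : R) := vbox V (fun=> - r) (fun=> r).

Lemma measurable_cube r : measurable (cube r).
Proof. exact: measurable_vbox. Qed.

Lemma subset_cube r r' : r <= r' -> cube r `<=` cube r'.
Proof. by move=> rr; apply: subset_vbox => i; rewrite ?lerN2. Qed.

Lemma coord_le_enorm (x : 'cV[R]_d) i : `|x i 0| <= enorm x.
Proof.
rewrite -sqrtr_sqr /enorm; apply: ler_wsqrtr.
by rewrite (bigD1 i)//= lerDl; apply: sumr_ge0 => j _; exact: sqr_ge0.
Qed.

(** An upper bound of the operator norm of [W] for the sup norm, kept at least 1 so that it can be
    moved across inequalities containing [1 + k]. *)
Definition op_bound (W : 'M[R]_d) : R := 1 + \sum_i \sum_j `|W i j|.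

Lemma op_bound_ge1 W : 1 <= op_bound W.
Proof. by rewrite lerDl; apply: sumr_ge0 => i _; exact: sumr_ge0. Qed.

Lemma mulmx_coord_le (W : 'M[R]_d) (x : 'cV[R]_d) (c : R) i :
  0 <= c -> (forall j, `|x j 0| <= c) -> `|(W *m x) i 0| <= op_bound W * c.
Proof.
move=> c0 xc; rewrite mxE; apply: (@le_trans _ _ (\sum_j `|W i j| * c)).
  apply: le_trans (ler_norm_sum _ _ _) _; apply: ler_sum => j _.
  by rewrite normrM ler_wpM2l.
rewrite -mulr_suml ler_wpM2r// /op_bound [X in _ <= _ + X](bigD1 i)//= addrCA lerDl.
by rewrite addr_ge0//; apply: sumr_ge0 => l _; exact: sumr_ge0.
Qed.

Lemma notin_cube (x : 'cV[R]_d) (r : R) : ~ cube r x ->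
  r <= op_bound (invmx V) * enorm x.
Proof.
move=> nx; rewrite leNgt; apply/negP => h; apply: nx => i.
have e0 : 0 <= enorm x by exact: sqrtr_ge0.
have := le_lt_trans (mulmx_coord_le (invmx V) i e0 (coord_le_enorm x)) h.
by rewrite ltr_norml => /andP[/ltW -> ->].
Qed.

(** Outside [cube k] one has [k <= L * enorm x], hence [1 + k <= L * (1 + enorm x)] as [L >= 1];
    this turns Euclidean decay into decay along lattice cubes, at the price of the factor
    [L ^ (d + 2)]. *)
Lemma decay_cube (phi : 'cV[R]_d -> R) (C beta : R) : 0 < C ->
  (2 * d + 2)%:R < beta -> decay_bound phi C beta ->
  exists2 D : R, 0 <= D & (forall x, `|phi x| <= D) /\
    forall (k : nat) x, ~ cube k%:R x -> `|phi x| <= D / (1 + k%:R) ^+ (d + 2).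
Proof.
move=> C0 hb dec; pose L := op_bound (invmx V).
have L1 : 1 <= L by exact: op_bound_ge1.
have Ld : 1 <= L ^+ (d + 2) by rewrite exprn_ege1.
have phiE x : `|phi x| <= C / (1 + enorm x) ^+ (d + 2).
  apply: le_trans (dec x) _; rewrite ler_wpM2l ?(ltW C0)//.
  have e0 : 0 <= enorm x by exact: sqrtr_ge0.
  rewrite -powR_mulrn ?addr_ge0// -powRN; apply: ler_powR; first by rewrite lerDl.
  rewrite lerN2; apply: le_trans (ltW hb); rewrite ler_nat; lia.
exists (C * L ^+ (d + 2)); first by rewrite mulr_ge0 ?ltW ?exprn_gt0//; lra.
split=> [x|k x /notin_cube kx]; apply: le_trans (phiE x) _.
  have e0 : 0 <= enorm x by exact: sqrtr_ge0.
  rewrite ler_wpM2l ?(ltW C0)// (le_trans _ Ld)// invf_le1 ?exprn_gt0 ?exprn_ege1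
    ?lerDl//.
  by rewrite ltr_pwDl.
have e0 : 0 <= enorm x by exact: sqrtr_ge0.
rewrite -mulrA ler_wpM2l ?(ltW C0)// -!exprVn -exprMn.
have k1 : 0 < 1 + k%:R :> R by rewrite ltr_pwDl.
have L0 : 0 <= L by apply: le_trans L1.
have h1 : 0 <= L / (1 + k%:R) by rewrite mulr_ge0// invr_ge0 ltW.
have h2 : 0 <= (1 + enorm x)^-1 by rewrite invr_ge0 addr_ge0.
rewrite lerXn2r ?nnegrE//.
rewrite ler_pdivlMr// mulrC ler_pdivrMr ?ltr_pwDl//.
rewrite -/L in kx; nra.
Qed.

End decay.

(** Decay times growth leaves [1 / (1 + q)^2], at most [1 / (q (q + 1))], whose sum telescopes;
    [2 ^ d] comes from [q + 2 <= 2 (1 + q)]. *)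
Lemma shell_bound (R : realFieldType) (d : nat) (C D q : R) : 0 <= C -> 0 <= D -> 0 <
  q ->
  D / (1 + q) ^+ (d + 2) * (C * (q + 1 + 1) ^+ d) <= C * D * 2 ^+ d * (q^-1 - (q +
    1)^-1).
Proof.
move=> C0 D0 q0.
have dq : 0 <= D / (1 + q) ^+ (d + 2) by rewrite divr_ge0// exprn_ge0//; lra.
have h1 : (q + 1 + 1) ^+ d <= 2 ^+ d * (1 + q) ^+ d.
  by rewrite -exprMn; apply: lerXn2r; rewrite ?nnegrE; lra.
apply: (@le_trans _ _ (D / (1 + q) ^+ (d + 2) * (C * (2 ^+ d * (1 + q) ^+ d)))).
  by rewrite ler_wpM2l// ler_wpM2l.
have qd : 0 < (1 + q) ^+ d by rewrite exprn_gt0//; lra.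
have -> : D / (1 + q) ^+ (d + 2) * (C * (2 ^+ d * (1 + q) ^+ d)) = C * D * 2 ^+ d /
  (1 + q) ^+ 2.
  by rewrite exprD; field; apply/andP; split; apply: lt0r_neq0 => //; lra.
rewrite ler_wpM2l ?mulr_ge0 ?exprn_ge0//.
have -> : q^-1 - (q + 1)^-1 = (q * (1 + q))^-1 by field; apply/andP; split;
  apply: lt0r_neq0 => //; lra.
rewrite lef_pV2 ?posrE ?exprn_gt0 ?mulr_gt0//; [|lra|lra].
by rewrite expr2; apply: ler_wpM2r; lra.
Qed.

Section riemann.
Context (R : realType) (d : nat) (V : 'M[R]_d).
Hypothesis uV : V \in unitmx.
Local Notation cube := (cube V).
Context (phi : 'cV[R]_d -> R) (C D : R).
Hypothesis phi_cont : continuous phi.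
Hypothesis C0 : 0 <= C.
Hypothesis D0 : 0 <= D.
Hypothesis phiD : forall x, `|phi x| <= D.
Hypothesis phi_decay : forall (k : nat) x, ~ cube k%:R x -> `|phi x| <= D / (1 +
  k%:R) ^+ (d + 2).

Let mphi (A : set (borel_cV R d)) : measurable_fun A (phi : borel_cV R d -> R).
Proof. by apply: measurable_funTS; exact: continuous_borel_cV. Qed.

(** The way in which a measure enters the Riemann approximation; a constant common to several
    measures makes the approximation uniform over them. *)
Definition growth (nu : {measure set (borel_cV R d) -> \bar R}) (C : R) :=
  forall k : nat, (nu (cube k%:R) <= (C * (k%:R + 1) ^+ d)%:E)%E.

(* The shell between the cubes of sides 2q and 2(q + 1) contributes at most
   [C D 2^d (1/q - 1/(q + 1))]. *)
Lemma tail_le (nu : {measure set (borel_cV R d) -> \bar R}) (r : nat) :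
  growth nu C -> (0 < r)%N ->
  (\int[nu]_(x in ~` cube r%:R) `|phi x|%:E <= (C * D * 2 ^+ d / r%:R)%:E)%E.
Proof.
move=> gr r0; pose F n := cube (r + n)%:R `\` cube r%:R.
have mF n : measurable (F n) by apply: measurableD; exact: measurable_cube.
have UF : \bigcup_n F n = ~` cube r%:R.
  apply/seteqP; split => [x [n _ []]//|x nx].
  pose s : R := \sum_i `|(invmx V *m (x : 'cV[R]_d)) i 0|.
  exists (Num.bound s) => //; split => // i.
  have s0 : 0 <= s by apply: sumr_ge0.
  have := archi_boundP s0; rewrite natrD.
  have : `|(invmx V *m (x : 'cV[R]_d)) i 0| <= s by rewrite /s (bigD1 i)//= lerDl
    sumr_ge0.
  have : 0 <= r%:R :> R by [].
  by rewrite ler_norml => ? /andP[? ?] ?; apply/andP; split; lra.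
(* The shells telescope by induction on [n]; the bound then passes to the complement of the cube by
   monotone convergence. *)
have Fle n : (\int[nu]_(x in F n) `|phi x|%:E <= (C * D * 2 ^+ d * (r%:R^-1 - (r +
  n)%:R^-1))%:E)%E.
  elim: n => [|n ih]; first by rewrite /F addn0 setDv integral_set0 subrr mulr0.
  have -> : F n.+1 = F n `|` (cube (r + n.+1)%:R `\` cube (r + n)%:R).
    apply/seteqP; split => [x [h1 h2]|x [[h1 h2]|[h1 h2]]].
    - by have [h|h] := pselect (cube (r + n)%:R x); [left|right].
    - by split => //; apply: subset_cube h1; rewrite ler_nat addnS.
    - by split => // h; apply: h2; apply: subset_cube h; rewrite ler_nat leq_addr.
  have mS : measurable (cube (r + n.+1)%:R `\` cube (r + n)%:R) by apply:
    measurableD; exact: measurable_cube.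
  rewrite ge0_integral_setU//; last 2 first.
  - by apply/measurable_EFinP; apply: measurableT_comp => //; exact: mphi.
  - by apply/disj_setPS => x [[h1 h2] [h3 h4]].
  apply: le_trans (leeD ih (_ : _ <= (C * D * 2 ^+ d * ((r + n)%:R^-1 - (r +
    n.+1)%:R^-1))%:E)%E) _; last first.
    by rewrite -EFinD lee_fin -mulrDr addrA subrK.
  apply: (@le_trans _ _ (\int[nu]_(x in cube (r + n.+1)%:R `\` cube (r + n)%:R) (D /
    (1 + (r + n)%:R) ^+ (d + 2))%:E)%E).
    apply: ge0_le_integral => //.
    - by apply/measurable_EFinP; apply: measurableT_comp => //; exact: mphi.
    - by move=> x [h1 h2]; rewrite lee_fin; exact: phi_decay.
  rewrite integral_cst//; set q : R := (r + n)%:R.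
  have q0 : 0 < q by rewrite ltr0n addn_gt0 r0.
  have qS : (r + n.+1)%:R = q + 1 :> R by rewrite addnS -natr1.
  have dq : 0 <= D / (1 + q) ^+ (d + 2) by rewrite divr_ge0// exprn_ge0// addr_ge0//
    ltW.
  apply: (@le_trans _ _ ((D / (1 + q) ^+ (d + 2))%:E * (C * (q + 1 + 1) ^+ d)%:E)%E).
    have gq : (nu (cube (r + n.+1)%:R `\` cube (r + n)%:R) <= (C * (q + 1 + 1) ^+
      d)%:E)%E.
      rewrite -qS; apply: le_trans (gr (r + n.+1)%N); apply: le_measure; rewrite ?inE//.
      exact: measurable_cube.
    by apply: lee_wpmul2l; rewrite ?lee_fin.
  rewrite -EFinM lee_fin qS.
  exact: shell_bound.
have := @ge0_nondecreasing_set_cvg_integral _ _ R F (fun x => `|phi x|%:E) nu.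
rewrite UF => /(_ _ mF _ _) cF; apply: cvge_le (cF _ _ _) => //.
- near=> n; apply: le_trans (Fle n) _; rewrite lee_fin ler_wpM2l ?mulr_ge0 ?exprn_ge0//.
  by rewrite lerBlDr lerDl.
- move=> n n' nn; apply/subsetPset => x [h1 h2]; split => //; apply: subset_cube h1.
  by rewrite ler_nat leq_add2l.
- by move=> n; apply/measurable_EFinP; apply: measurableT_comp => //; exact: mphi.
Unshelve. all: by end_near. Qed.

Lemma decay_integrable (nu : {measure set (borel_cV R d) -> \bar R}) :
  growth nu C -> nu.-integrable setT (EFin \o phi).
Proof.
move=> gr; apply/integrableP; split; first by apply/measurable_EFinP; exact: mphi.
have -> : setT = cube 1%:R `|` ~` cube 1%:R by rewrite setUv.
have mc := measurable_cube V 1%:R.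
rewrite ge0_integral_setU//; last 3 first.
- exact: measurableC.
- by rewrite setUv; apply/measurable_EFinP; apply: measurableT_comp => //; exact: mphi.
- by apply/disj_setPS => x [].
apply: lte_add_pinfty; last first.
  by apply: le_lt_trans (tail_le gr (ltn0Sn 0)) _; rewrite ltry.
apply: (@le_lt_trans _ _ (\int[nu]_(x in cube 1%:R) D%:E)%E).
  apply: ge0_le_integral => //.
  - by apply/measurable_EFinP; apply: measurableT_comp => //; exact: mphi.
  - by move=> x _; rewrite lee_fin.
rewrite integral_cst//; apply: lte_mul_pinfty => //.
by apply: le_lt_trans (gr 1%N) _; rewrite ltry.
Qed.

(** A Lebesgue number for a finite cover of the compact cube. The cover uses half radii, so [c] may
    lie outside the cube: it still falls into the full ball that contains [x]. *)
Lemma unif_cont_cube (r t : R) : 0 < t -> exists2 e : R, 0 < e &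
  forall x c, cube r x -> (forall i, `|(x : 'cV[R]_d) i 0 - (c : 'cV[R]_d) i 0| < e) ->
    `|phi x - phi c| <= t.
Proof.
move=> t0; have t20 : 0 < t / 2 by rewrite divr_gt0.
have /choice[del delP] : forall x : 'cV[R]_d, exists e : R, 0 < e /\
    forall y, ball x e y -> `|phi x - phi y| < t / 2.
  move=> x; have /cvgrPdist_lt/(_ _ t20)/nbhs_ballP[e /= e0 eP] := @phi_cont x.
  by exists e; split => // y /eP.
have cK := @compact_cube R d V r uV; rewrite compact_cover in cK.
have [x _|x Kx|F _ KF] := cK _ setT (fun x : 'cV[R]_d => ball x (del x / 2)).
- exact: ball_open.
- by exists x => //; apply: ballxx; rewrite divr_gt0//; case: (delP x).
have [e e0 eF] : exists2 e : R, 0 < e & forall x, x \in finmap.enum_fset F -> e <=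
  del x / 2.
  elim: (finmap.enum_fset F) => [|x s [e e0 es]]; first by exists 1.
  have dx : 0 < del x / 2 by rewrite divr_gt0//; case: (delP x).
  exists (Num.min e (del x / 2)); first by rewrite lt_min e0.
  move=> y; rewrite inE => /predU1P[->|ys]; first by rewrite ge_min lexx orbT.
  by rewrite ge_min es.
exists e => // x c xr xc.
have Kx : [set x : 'cV[R]_d | forall i, `|(invmx V *m x) i 0| <= r] x.
  by move=> i; have /andP[h1 h2] := xr i; rewrite ler_norml h1 ltW.
have [y yF yx] := KF _ Kx; have [dy yP] := delP y.
have bxc : ball x (del y / 2) c.
  split; first by rewrite divr_gt0.
  by move=> i j; rewrite ord1; apply: lt_le_trans (xc i) (eF _ yF).
have byc : ball y (del y) c by rewrite [del y]splitr; exact: ball_triangle yx bxc.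
have byx : ball y (del y) x by apply: le_ball yx; rewrite ler_pdivrMr// ler_peMr
  ?ler1n// ltW.
have := yP _ byc; have := yP _ byx; rewrite !ltr_norml ler_norml => /andP[? ?]
  /andP[? ?].
by apply/andP; split; lra.
Qed.

(* The number of cells on a side is odd so that no face of a cell lies in a
   coordinate hyperplane. *)
Definition grid_cell (r : nat) (Z : nat) (y : {ffun 'I_d -> 'I_(2 * Z + 1)}) :=
  gcell V (fun=> - r%:R) (2 * r%:R / (2 * Z + 1)%:R) y.

Definition grid_node (r : nat) (Z : nat) (y : {ffun 'I_d -> 'I_(2 * Z + 1)}) :
  'cV[R]_d :=
  V *m \col_i (- r%:R + 2 * r%:R / (2 * Z + 1)%:R * (y i)%:R).

Lemma cube_grid r Z : (0 < r)%N -> cube r%:R = \bigcup_(y in [set` enum {ffun 'I_d ->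
  'I_(2 * Z + 1)}]) grid_cell r y.
Proof.
move=> r0; set h : R := 2 * r%:R / (2 * Z + 1)%:R.
have n0 : 0 < (2 * Z + 1)%:R :> R by rewrite addn1.
have h0 : 0 < h by rewrite !mulr_gt0 ?invr_gt0// ltr0n.
have -> : cube r%:R = vbox V (fun i => - r%:R + h * (0%N)%:R) (fun i => - r%:R + h *
  (2 * Z + 1)%N%:R).
  by congr vbox; apply/funext => i; rewrite ?mulr0 ?addr0// /h divfK ?gt_eqF//; ring.
rewrite (vbox_gcell V (fun=> - r%:R) h0 (fun=> 0%N) (fun i => leqnn _)).
apply: eq_bigcupl; split => y /=; first by rewrite !mem_enum.
by rewrite !mem_enum inE => _; apply/forallP => i; rewrite /= ltn_ord.
Qed.

Lemma fin_num_growth (nu : {measure set (borel_cV R d) -> \bar R}) r (A : set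
  (borel_cV R d)) :
  growth nu C -> measurable A -> A `<=` cube r%:R -> (nu A < +oo)%E.
Proof.
move=> gr mA Ar; apply: (@le_lt_trans _ _ (nu (cube r%:R))).
  by apply: le_measure; rewrite ?inE//; exact: measurable_cube.
by apply: le_lt_trans (gr r) _; rewrite ltry.
Qed.

(** [r] and [Z] are fixed before [nu]: the tail bound and the mass of the cube depend on [nu] only
    through the growth constant. The same grid can thus be used for all rescaled measures and for
    their limit. *)
Lemma riemann_sum_approx (e : R) : 0 < e -> exists r Z : nat, (0 < r)%N /\
  forall nu : {measure set (borel_cV R d) -> \bar R}, growth nu C ->
    `|\int[nu]_x phi x - \sum_(y : {ffun 'I_d -> 'I_(2 * Z + 1)}) phi (grid_node r y)
      * fine (nu (grid_cell r y))| <= e.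
Proof.
move=> e0; have e20 : 0 < e / 2 by rewrite divr_gt0.
pose B := C * D * 2 ^+ d; have B0 : 0 <= B by rewrite !mulr_ge0// exprn_ge0.
pose r := (Num.bound (B / (e / 2))).+1; exists r.
have rB : B / r%:R <= e / 2.
  rewrite ler_pdivrMr// mulrC -ler_pdivrMr//.
  have : 0 <= B / (e / 2) by rewrite divr_ge0// ltW.
  by move=> /archi_boundP/ltW/le_trans; apply; rewrite ler_nat.
pose Mr := C * (r%:R + 1) ^+ d; have Mr0 : 0 <= Mr by rewrite mulr_ge0// exprn_ge0//
  addr_ge0.
(* [Mr] bounds the mass of the cube, so an oscillation of at most [t] on each cell costs at most
   [t * Mr <= e / 2] in total. *)
pose t := e / 2 / (Mr + 1).
have t0 : 0 < t by rewrite divr_gt0// ltr_wpDl.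
have tM : t * Mr <= e / 2.
  have -> : e / 2 = t * (Mr + 1) by rewrite divfK// gt_eqF// ltr_wpDl.
  by rewrite ler_wpM2l ?lerDl// ltW.
have [del del0 delP] := unif_cont_cube r%:R t0.
(* Each coordinate of a point of a cell differs from that of the node by at most [op_bound V] times
   the mesh; [Z] makes this less than [del]. *)
pose Z := Num.bound (op_bound V * (2 * r%:R) / del); exists Z; split => // nu gr.
set h : R := 2 * r%:R / (2 * Z + 1)%:R.
have n0 : 0 < (2 * Z + 1)%:R :> R by rewrite addn1.
have h0 : 0 < h by rewrite !mulr_gt0 ?invr_gt0// ltr0n.
have op1 := op_bound_ge1 V.
have op0 : 0 < op_bound V by apply: lt_le_trans op1.
have hdel : op_bound V * h < del.
  rewrite /h mulrA ltr_pdivrMr// [ltRHS]mulrC -ltr_pdivrMr//.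
  have : 0 <= op_bound V * (2 * r%:R) / del by rewrite divr_ge0 ?mulr_ge0// ltW.
  by move=> /archi_boundP/lt_le_trans; apply; rewrite ler_nat;
    exact: leq_trans (leq_pmull Z (ltn0Sn 1)) (leq_addr 1 _).
pose T : finType := {ffun 'I_d -> 'I_(2 * Z + 1)}.
pose cl (y : T) := grid_cell r y.
have mcl y : measurable (cl y) by exact: measurable_vbox.
have clr y : cl y `<=` cube r%:R.
  by rewrite (cube_grid Z)// => x yx; exists y => //=; rewrite mem_enum.
have ncl y : (nu (cl y) < +oo)%E by apply: (fin_num_growth gr (mcl y) (clr y)).
have mc := measurable_cube V r%:R.
have iphi A : measurable A -> nu.-integrable A (EFin \o phi).
  by move=> mA; apply: integrableS (decay_integrable gr).
have icst y k : nu.-integrable (cl y) (EFin \o cst k).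
  by apply: measurable_bounded_integrable => //; exact: bounded_cst.
have isub y : nu.-integrable (cl y) (EFin \o (fun x => phi x - phi (grid_node r y))).
  exact: (integrableB (mcl y) (iphi _ (mcl y)) (icst y (phi (grid_node r y)))).
have inorm y : nu.-integrable (cl y) (EFin \o (fun x => `|phi x - phi (grid_node r
  y)|)).
  exact: (integrable_abse (isub y)).
have cellE y : `|\int[nu]_(x in cl y) phi x - phi (grid_node r y) * fine (nu (cl y))|
  <= t * fine (nu (cl y)).
  rewrite -(Rintegral_cst nu (mcl y)) -RintegralB//; [|exact: iphi|exact: icst].
  apply: le_trans (le_normr_Rintegral (mcl y) (isub y)) _.
  rewrite -(Rintegral_cst nu (mcl y)); apply: le_Rintegral => //; first exact: icst.
  move=> x yx; apply: delP; first exact: clr yx.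
  move=> i; apply: le_lt_trans hdel.
  have -> : (x : 'cV[R]_d) i 0 - grid_node r y i 0 =
      (V *m (invmx V *m (x : 'cV[R]_d) - \col_i (- r%:R + h * (y i)%:R))) i 0.
    by rewrite mulmxBr mulKVmx// !mxE.
  apply: mulmx_coord_le; first exact: ltW.
  move=> j; rewrite mxE [X in _ + X]mxE [X in _ - X]mxE; have /andP[h1 h2] := yx j.
  rewrite -/h -[(y j).+1%:R]natr1 (mulrDr h) mulr1 addrA in h2; rewrite -/h in h1.
  rewrite ger0_norm ?subr_ge0//; apply: ltW; by rewrite ltrBlDl.
have cubeE : \int[nu]_(x in cube r%:R) phi x = \sum_y \int[nu]_(x in cl y) phi x.
  rewrite /Rintegral (cube_grid Z)// bigcup_seq integral_bigsetU_EFin ?enum_uniq//;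
    last 2 first.
  - exact: trivIset_gcell.
  - by apply/measurable_EFinP; exact: mphi.
  rewrite big_enum/= sum_fine//; move=> y _; apply: integrable_fin_num => //;
    exact: iphi.
have tailE : `|\int[nu]_(x in ~` cube r%:R) phi x| <= e / 2.
  apply: le_trans rB; rewrite -lee_fin EFin_normr_Rintegral//; last 2 first.
  - exact: measurableC.
  - by apply: iphi; exact: measurableC.
  apply: le_trans (tail_le gr (ltn0Sn _)); apply: le_abse_integral => //;
    first exact: measurableC.
  by apply/measurable_EFinP; exact: mphi.
have splitE : \int[nu]_x phi x = \int[nu]_(x in cube r%:R) phi x + \int[nu]_(x in ~`
  cube r%:R) phi x.
  rewrite -Rintegral_setU ?setUv//; first exact: measurableC.
  - exact: iphi.
  - by apply/disj_setPS => x [].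
have nufin A : measurable A -> A `<=` cube r%:R -> nu A \is a fin_num.
  by move=> mA Ar; rewrite ge0_fin_numE//; exact: (fin_num_growth gr mA Ar).
have nucube : \sum_y fine (nu (cl y)) = fine (nu (cube r%:R)).
  rewrite (cube_grid Z)// measure_fin_bigcup//; last exact: trivIset_gcell.
  rewrite -fsbig_seq ?enum_uniq// big_enum/= sum_fine//; move=> y _; exact: nufin.
have nuM : fine (nu (cube r%:R)) <= Mr by rewrite -lee_fin fineK ?nufin//; exact: gr.
rewrite splitE.
rewrite addrAC cubeE -sumrB [e]splitr.
apply: le_trans (ler_normD _ _) _; apply: lerD => //.
apply: le_trans (ler_norm_sum _ _ _) _.
apply: (@le_trans _ _ (\sum_y t * fine (nu (cl y)))); first by apply: ler_sum => y _;
  exact: cellE.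
by rewrite -mulr_sumr nucube (le_trans _ tM)// ler_wpM2l// ltW.
Qed.

End riemann.

(** * Rescaled measures *)

Lemma rescale_vbox (R : realType) (d : nat) (V : 'M[R]_d) (nu : lfmeasure R d) (eps :
  R) p q :
  V \in unitmx -> 0 < eps ->
  rescale eps nu (vbox V p q) =
  ((eps ^+ d)%:E * nu (vbox V (fun i => (eps^-1 * p i)%R) (fun i => (eps^-1 * q
    i)%R)))%E.
Proof. by move=> uV e0; rewrite /rescale image_scale. Qed.

Lemma growthS (R : realType) (d : nat) (V : 'M[R]_d) (nu : {measure set (borel_cV R
  d) -> \bar R}) (C C' : R) :
  C <= C' -> growth V nu C -> growth V nu C'.
Proof.
move=> CC gr k; apply: le_trans (gr k) _; rewrite lee_fin ler_wpM2r// exprn_ge0//.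
Qed.

Lemma growth_lebesgue (R : realType) (d : nat) (V : 'M[R]_d) (c : R) :
  V \in unitmx -> 0 < c -> lebesgue_cV (cell V) = c%:E -> growth V (@lebesgue_cV R d)
    (2 ^+ d * c).
Proof.
move=> uV c0 cE k.
have cubeS n : (0 < n)%N -> lebesgue_cV (cube V n%:R) = ((2 * n%:R) ^+ d * c)%:E.
  move=> n0; have n20 : 0 < 2 * n%:R :> R by rewrite mulr_gt0// ltr0n.
  have -> : cube V n%:R = vbox V (fun=> - n%:R) (fun=> - n%:R + 2 * n%:R).
    by congr vbox; apply/funext => i; ring.
  by rewrite (lebesgue_vbox uV (fun=> - n%:R) n20) cE -EFinM.
apply: (@le_trans _ _ (lebesgue_cV (cube V k.+1%:R))).
  apply: le_measure; rewrite ?inE; [exact: measurable_cube|exact: measurable_cube|].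
  by apply: subset_cube; rewrite ler_nat.
by rewrite cubeS// lee_fin exprMn natr1 mulrAC.
Qed.

Section rescaled_integral.
Context (R : realType) (d : nat) (dO : measure_display) (Omega : measurableType dO).
Context (V : 'M[R]_d) (mu : Omega -> lfmeasure R d) (w : Omega) (m c : R).
Hypothesis uV : V \in unitmx.
Hypothesis boxmass_lim : forall (a b : 'I_d -> nat) (e : R),
  (forall i, (0 < a i)%N) -> (forall i, (0 < b i)%N) -> 0 < e ->
  exists l, forall n, (l <= n)%N ->
    `|boxmass V mu a b n w - m * @boxvol R d a b n| <= e * @boxvol R d a b n.
Hypothesis m0 : 0 <= m.
Hypothesis c0 : 0 < c.
Hypothesis cellE : lebesgue_cV (cell V) = c%:E.

(* [rescale] is a measure only for [0 < eps], so the canonical instance cannot be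
   inferred without that proof. *)
Definition rescale_measure (eps : R) (e0 : 0 < eps) : {measure set (borel_cV R d) ->
  \bar R} :=
  Defs_rescale__canonical__measure_function_Measure (mu w) e0.

(** Rescaling turns the bound of [mass_growth] into [C (k + eps)^d], and
    [k + eps <= (1 + eps) (k + 1)]. *)
Lemma growth_rescale : exists2 C : R, 0 <= C &
  forall eps (e0 : 0 < eps), growth V (rescale_measure e0) (C * (1 + eps) ^+ d).
Proof.
have [C C0 HC] := mass_growth uV boxmass_lim; exists C => // eps e0 k.
have e0' : 0 < eps^-1 by rewrite invr_gt0.
rewrite -[leLHS]/(rescale eps (mu w) (cube V k%:R)) /cube rescale_vbox//.
have -> : vbox V (fun=> eps^-1 * - k%:R) (fun=> eps^-1 * k%:R) =
    vbox V (fun=> - (eps^-1 * k%:R)) (fun=> eps^-1 * k%:R).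
  by congr vbox; apply/funext => i; rewrite mulrN.
have ek : 0 <= eps^-1 * k%:R by rewrite mulr_ge0// ltW.
rewrite -(EFin_mass mu uV) -EFinM lee_fin.
apply: (@le_trans _ _ (eps ^+ d * (C * (eps^-1 * k%:R + 1) ^+ d))).
  by rewrite ler_wpM2l ?exprn_ge0 ?(ltW e0)// HC.
rewrite mulrCA -exprMn -mulrA ler_wpM2l// -exprMn.
apply: lerXn2r; rewrite ?nnegrE.
- by rewrite mulr_ge0 ?addr_ge0// ltW.
- by rewrite mulr_ge0 ?addr_ge0// ltW.
rewrite mulrDr mulrA mulfV ?gt_eqF// mul1r mulr1.
have : 0 <= eps * k%:R by rewrite mulr_ge0// ltW.
lra.
Qed.

(** In units of [h / 2] the corners of a cell are odd integers [p] and [p + 2], because [r] is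
    [2 Z + 1] units; being odd, they are not 0, and [cvg_mass_grid] applies with the dilation factor
    [(h / 2) / eps]. *)
Lemma cvg_rescale_grid_cell (r Z : nat) (y : {ffun 'I_d -> 'I_(2 * Z + 1)}) : (0 <
  r)%N ->
  fine (rescale eps (mu w) (grid_cell V r y)) @[eps --> 0^'+] -->
  m / c * fine (lebesgue_cV (grid_cell V r y)).
Proof.
move=> r0; set h : R := 2 * r%:R / (2 * Z + 1)%:R.
have n0 : 0 < (2 * Z + 1)%:R :> R by rewrite addn1.
have h0 : 0 < h by rewrite !mulr_gt0 ?invr_gt0// ltr0n.
have rh : r%:R = h / 2 * (2 * Z + 1)%:R by rewrite /h; field; lra.
have -> : m / c * fine (lebesgue_cV (grid_cell V r y)) = (h / 2) ^+ d * (m * 2 ^+ d).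
  have -> : grid_cell V r y = vbox V (fun i => - r%:R + h * (y i)%:R) (fun i => -
    r%:R + h * (y i)%:R + h).
    congr vbox; apply/funext => i.
    by rewrite -/h -[(y i).+1%:R]natr1 (mulrDr h) mulr1 addrA.
  rewrite lebesgue_vbox// cellE -EFinM/=.
  have -> : (h / 2) ^+ d = h ^+ d / 2 ^+ d by rewrite exprMn exprVn.
  have : 2 ^+ d != 0 :> R by rewrite expf_neq0.
  by move: (h ^+ d) (2 ^+ d) => X Y Y0; field; rewrite Y0 lt0r_neq0.
pose p i : int := 2 * (y i)%:Z - (2 * Z + 1)%:Z.
pose q i : int := p i + 2.
have pq i : [/\ p i < q i, p i != 0 & q i != 0] by rewrite /q /p; split; lia.
have pE i : - r%:R + h * (y i)%:R = h / 2 * (p i)%:~R.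
  by rewrite rh /p intrD intrM mulrNz !pmulrn; field.
have qE i : - r%:R + h * (y i).+1%:R = h / 2 * (q i)%:~R.
  by rewrite /q intrD mulrDr -pE -natr1; field.
have cg := cvg_mass_grid uV boxmass_lim pq.
have -> : m * 2 ^+ d = m * \prod_i (q i - p i)%:~R.
  congr (_ * _); rewrite (eq_bigr (fun=> 2)) ?prodr_const ?card_ord// => i _.
  by rewrite /q addrAC subrr add0r.
have c1 : (h / 2) / eps @[eps --> 0^'+] --> +oo%R.
  apply/cvgryPge => A; near=> eps.
  have e0 : 0 < eps by near: eps; exact: nbhs_right_gt.
  have A0 : 0 < `|A| + 1 by rewrite ltr_wpDl.
  rewrite ler_pdivlMr//; apply: (@le_trans _ _ ((`|A| + 1) * eps)).
    by rewrite ler_wpM2r ?(ltW e0)// (le_trans (ler_norm _))// lerDl.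
  rewrite mulrC -ler_pdivlMr//.
  by near: eps; apply: nbhs_right_le; apply: divr_gt0 => //; apply: divr_gt0.
have c2 := cvg_comp _ _ c1 cg.
have : (h / 2) ^+ d * (mass V mu w (fun i => h / 2 / eps * (p i)%:~R) (fun i => h / 2
  / eps * (q i)%:~R) /
    (h / 2 / eps) ^+ d) @[eps --> 0^'+] --> (h / 2) ^+ d * (m * \prod_i (q i - p
      i)%:~R).
  by apply: cvgM; [exact: cvg_cst|exact: c2].
apply: cvg_trans; apply: near_eq_cvg; near=> eps.
have e0 : 0 < eps by near: eps; exact: nbhs_right_gt.
have -> : grid_cell V r y = vbox V (fun i => h / 2 * (p i)%:~R) (fun i => h / 2 * (q
  i)%:~R).
  by congr vbox; apply/funext => i; rewrite -/h ?pE ?qE.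
rewrite rescale_vbox// fineM ?mu_vbox_fin//= /mass.
have -> : vbox V (fun i => eps^-1 * (h / 2 * (p i)%:~R)) (fun i => eps^-1 * (h / 2 *
  (q i)%:~R)) =
  vbox V (fun i => h / 2 / eps * (p i)%:~R) (fun i => h / 2 / eps * (q i)%:~R).
  by congr vbox; apply/funext => i; ring.
set M := fine _; rewrite [(h / 2 / eps) ^+ d]exprMn exprVn.
have hd : (h / 2) ^+ d != 0 by rewrite expf_neq0// gt_eqF// divr_gt0.
have ed : eps ^+ d != 0 by rewrite expf_neq0// gt_eqF.
by move: ((h / 2) ^+ d) (eps ^+ d) hd ed => X Y X0 Y0; field; rewrite ?X0 ?Y0.
Unshelve. all: by end_near. Qed.

Context (phi : 'cV[R]_d -> R) (D : R).
Hypothesis phi_cont : continuous phi.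
Hypothesis D0 : 0 <= D.
Hypothesis phiD : forall x, `|phi x| <= D.
Hypothesis phi_decay : forall (k : nat) x, ~ cube V k%:R x -> `|phi x| <= D / (1 +
  k%:R) ^+ (d + 2).

Lemma rescale_integrable eps (e0 : 0 < eps) :
  (rescale_measure e0).-integrable setT (EFin \o phi).
Proof.
have [C C0 HC] := growth_rescale.
have C'0 : 0 <= C * (1 + eps) ^+ d by rewrite mulr_ge0// exprn_ge0// addr_ge0// ltW.
exact: (decay_integrable phi_cont C'0 D0 phiD phi_decay (HC _ e0)).
Qed.

(** Both integrals are replaced by Riemann sums over one grid that does not depend on [eps]; between
    these sums there are only finitely many cell limits to take. *)
Lemma cvg_rescale_integral :
  (\int[rescale eps (mu w)]_x (phi x)%:E)%E @[eps --> 0^'+] -->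
  ((c^-1)%:E * m%:E * \int[@lebesgue_cV R d]_x (phi x)%:E)%E.
Proof.
have [C C0 HC] := growth_rescale.
have grl := growth_lebesgue uV c0 cellE.
pose C' := C * 2 ^+ d + 2 ^+ d * c.
have c2 : 0 <= 2 ^+ d * c by rewrite mulr_ge0 ?exprn_ge0// ltW.
have C2 : 0 <= C * 2 ^+ d by rewrite mulr_ge0 ?exprn_ge0.
have C'0 : 0 <= C' by rewrite addr_ge0.
have grl' : growth V (@lebesgue_cV R d) C' by apply: growthS grl; rewrite lerDr.
have gre eps (e0 : 0 < eps) : eps <= 1 -> growth V (rescale_measure e0) C'.
  move=> e1; apply: growthS (HC _ e0); apply: (@le_trans _ _ (C * 2 ^+ d));
    last by rewrite lerDl.
  by rewrite ler_wpM2l//; apply: lerXn2r; rewrite ?nnegrE; lra.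
have il := decay_integrable phi_cont C'0 D0 phiD phi_decay grl'.
set kap := m / c; have kap0 : 0 <= kap by rewrite divr_ge0// ltW.
have -> : ((c^-1)%:E * m%:E * \int[@lebesgue_cV R d]_x (phi x)%:E =
   (kap * \int[@lebesgue_cV R d]_x phi x)%:E)%E.
  rewrite /Rintegral EFinM fineK; last exact: integrable_fin_num il.
  by rewrite -EFinM mulrC.
apply/fine_cvgP; split.
  near=> eps; have e0 : 0 < eps by near: eps; exact: nbhs_right_gt.
  exact: (integrable_fin_num measurableT (rescale_integrable e0)).
apply/cvgrPdist_le => e e0.
(* The two approximation errors, [e1] for the rescaled measure and [kap * e1] for Lebesgue measure,
   add up to [e / 3]. *)
pose e1 := e / 3 / (1 + kap).
have e10 : 0 < e1 by rewrite !divr_gt0// ltr_pwDl.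
have [r [Z [r0 HrZ]]] := riemann_sum_approx uV phi_cont C'0 D0 phiD phi_decay e10.
have hl := HrZ _ grl'.
set Sl := (\sum_(y : {ffun 'I_d -> 'I_(2 * Z + 1)}) _) in hl.
have cS : \sum_(y : {ffun 'I_d -> 'I_(2 * Z + 1)}) phi (grid_node V r y) * fine
  (rescale eps (mu w) (grid_cell V r y)) @[eps --> 0^'+] --> kap * Sl.
  rewrite /Sl mulr_sumr; apply: cvgr_sum => y; rewrite mulrCA.
  by apply: cvgM; [exact: cvg_cst|exact: cvg_rescale_grid_cell].
have e3 : 0 < e / 3 by rewrite divr_gt0.
have {}cS : \forall eps \near 0^'+, `|kap * Sl - \sum_(y : {ffun 'I_d -> 'I_(2 * Z +
  1)}) phi (grid_node V r y) * fine (rescale eps (mu w) (grid_cell V r y))| <= e / 3.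
  by move/cvgrPdist_le : cS; exact.
near=> eps.
have ep : 0 < eps by near: eps; exact: nbhs_right_gt.
have e1' : eps <= 1 by near: eps; exact: nbhs_right_le.
have hS : `|kap * Sl - \sum_(y : {ffun 'I_d -> 'I_(2 * Z + 1)}) phi (grid_node V r y)
  * fine (rescale eps (mu w) (grid_cell V r y))| <= e / 3.
  by near: eps; exact: cS.
pose Ie : R := fine (\int[rescale eps (mu w)]_x (phi x)%:E)%E.
pose Se : R := \sum_(y : {ffun 'I_d -> 'I_(2 * Z + 1)}) phi (grid_node V r y) * fine
  (rescale eps (mu w) (grid_cell V r y)).
have he : `|Ie - Se| <= e1 := HrZ _ (gre _ ep e1').
rewrite -/Se in hS.
set Il := \int[_]_x _ in hl *.
suff : `|kap * Il - Ie| <= e by [].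
have k1 : (1 + kap) * e1 = e / 3 by rewrite /e1 mulrC divfK// gt_eqF// ltr_pwDl.
have -> : kap * Il - Ie = kap * (Il - Sl) + (kap * Sl - Se) - (Ie - Se) by ring.
apply: le_trans (ler_normB _ _) _; apply: (@le_trans _ _ (kap * e1 + e / 3 + e1));
  last first.
  have -> : kap * e1 + e / 3 + e1 = (1 + kap) * e1 + e / 3 by ring.
  rewrite k1; lra.
apply: lerD => //; apply: le_trans (ler_normD _ _) _; apply: lerD => //.
by rewrite normrM (ger0_norm kap0) ler_wpM2l.
Unshelve. all: by end_near. Qed.

End rescaled_integral.

Theorem theorem3p3 (R : realType) (d : nat) (k : group_kind)
    (dO : measure_display) (Omega : measurableType dO) (P : probability Omega R)
    (theta : acting_group R d k -> Omega -> Omega) (V : 'M[R]_d)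
    (mu : Omega -> lfmeasure R d) :
  (0 < d)%N ->
  V \in unitmx ->
  is_action theta ->
  stationary P theta ->
  ergodic P theta ->
  measurable_fun [set: Omega] (mu : Omega -> borel_lf R d) ->
  (forall (w : Omega) (g : acting_group R d k) (A : set (borel_cV R d)),
     measurable A -> mu (theta g w) A = translate V g (mu w) A) ->
  (intensity P V mu < +oo)%E ->
  exists A : set Omega,
    [/\ measurable A,
        invariant_set theta A,
        P A = 1%E,
        (forall phi : 'cV[R]_d -> R,
           continuous phi ->
           (exists C beta : R,
              [/\ 0 < C, (2 * d + 2)%:R < beta & decay_bound phi C beta]) ->
           forall w : Omega, A w ->
             (forall eps : R, 0 < eps ->
                (\int[rescale eps (mu w)]_x `|phi x|%:E < +oo)%E) /\
             (\int[rescale eps (mu w)]_x (phi x)%:E)%E @[eps --> 0^'+] -->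
               (intensity P V mu * \int[@lebesgue_cV R d]_x (phi x)%:E)%E) &
        (forall phi : 'cV[R]_d -> R, Cstar phi ->
           forall w : Omega, A w ->
             (\int[rescale eps (mu w)]_x (phi x)%:E)%E @[eps --> 0^'+] -->
               (intensity P V mu * \int[@lebesgue_cV R d]_x (phi x)%:E)%E)].
Proof.
move=> _ uV act stat erg mmu cov.
have [c c0 cellE] := lebesgue_cell uV.
rewrite /intensity cellE [fine _]/=.
have c0' : 0 < c^-1 by rewrite invr_gt0.
move=> fin.
(* This [m] is the mean mass of the cell, the intensity being [c^-1 * m]; since [c^-1 > 0], a finite
   intensity forces a finite mean. *)
have [m Em] : exists m : R, (\int[P]_w mu w (cell V) = m%:E)%E.
  have : (0 <= \int[P]_w mu w (cell V))%E by exact: integral_ge0.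
  case: (\int[P]_w mu w (cell V))%E fin => [m|+|//] _; first by exists m.
  by rewrite gt0_muley ?lte_fin// ltxx.
rewrite Em; have m0 := mean_ge0 Em.
have lim w : typical V mu m w -> forall (a b : 'I_d -> nat) (e : R),
    (forall i, (0 < a i)%N) -> (forall i, (0 < b i)%N) -> 0 < e ->
    exists l, forall n, (l <= n)%N ->
      `|boxmass V mu a b n w - m * @boxvol R d a b n| <= e * @boxvol R d a b n.
  by move=> tw a b e; exact: (typical_boxmass Em tw).
have main (phi : 'cV[R]_d -> R) : continuous phi ->
    (exists C beta : R, [/\ 0 < C, (2 * d + 2)%:R < beta & decay_bound phi C beta]) ->
    forall w : Omega, typical V mu m w ->
    (forall eps : R, 0 < eps -> (\int[rescale eps (mu w)]_x `|phi x|%:E < +oo)%E) /\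
    (\int[rescale eps (mu w)]_x (phi x)%:E)%E @[eps --> 0^'+] -->
      ((c^-1)%:E * m%:E * \int[@lebesgue_cV R d]_x (phi x)%:E)%E.
  move=> cphi [C [beta [C0 hb dec]]] w tw.
  have [D D0 [phiD phidec]] := decay_cube uV C0 hb dec.
  split; last exact: (cvg_rescale_integral uV (lim w tw) m0 c0 cellE cphi D0 phiD phidec).
  move=> eps e0; have := rescale_integrable uV (lim w tw) cphi D0 phiD phidec e0.
  by move=> /integrableP[_].
exists (typical V mu m); split.
- exact: (measurable_typical uV act stat erg mmu cov Em).
- exact: (invariant_typical uV act stat erg mmu cov Em).
- exact: (probability_typical uV act stat erg mmu cov Em).
- exact: main.
move=> phi [cphi dphi] w tw; apply: (main phi cphi _ w tw).2.
(* Functions in [Cstar] satisfy every decay bound; [2 * d + 3] is an exponent above the threshold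
   [2 * d + 2]. *)
have b0 : 0 < (2 * d + 3)%:R :> R by rewrite ltr0n addn3.
have [C C0 dC] := dphi _ b0; exists C, (2 * d + 3)%:R; split => //.
by rewrite ltr_nat !addnS ltnS.
Qed.
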